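(* Suppose $l$ divides $q+1$. The Steinberg module $I$ contains an irreducible $F\mathrm{Sp}_M$-submodule isomorphic to $X^+_\lambda$. If $p$ is odd, $I$ also contains a copy of $X^+_{\lambda[\kappa]}$, where $\kappa\in F_q^*$ is not a square. These two modules are not isomorphic, so $I$ contains their direct sum. Moreover (for $p$ odd), $X^+_\lambda$ and $X^+_{\lambda[\kappa]}$ are isomorphic to $\theta^nY^+_\lambda$ and $\theta^nY^+_{\lambda[\kappa]}$, where $Y_\lambda$ and $Y_{\lambda[\kappa]}$ are the Weil modules of types $\lambda$ and $\lambda[\kappa]$ restricted to $\mathrm{Sp}_M$. If $l=2$ then $X^+_\lambda$ and $X^+_{\lambda[\kappa]}$ are isomorphic to the restrictions to $\mathrm{Sp}_M$ of the Weil modules $Y^-_\lambda$ and $Y^-_{\lambda[\kappa]}$ of types $\lambda$ and $\lambda[\kappa]$ and degree $(q^n-1)/2$.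
   Context: Groups. Let $F_q$ be a field with $q$ elements, of characteristic $p$, let $n\ge1$ and $V$ a $2n$-dimensional $F_q$-space with a non-degenerate alternating form $\langle\ ,\ \rangle$; $\mathrm{Sp}=\mathrm{Sp}_{2n}(q)$ is the group of all $g\in\mathrm{GL}(V)$ preserving the form. Fix a symplectic basis $u_1,\dots,u_n,v_1,\dots,v_n$: $\langle u_i,v_j\rangle=\delta_{ij}$, $\langle u_i,u_j\rangle=\langle v_i,v_j\rangle=0$. Put $M=\mathrm{span}\{u_i\}$, $N=\mathrm{span}\{v_i\}$. $\mathrm{Sp}^M$ is the pointwise stabilizer of $M$ in $\mathrm{Sp}$, $\mathrm{Sp}_{M,N}$ is the subgroup preserving both $M$ and $N$, and $\mathrm{Sp}_M=\mathrm{Sp}^M\rtimes\mathrm{Sp}_{M,N}$ is the global stabilizer of $M$. $T$ is the group of $g\in\mathrm{Sp}_{M,N}$ whose matrix on $M$ relative to $u_1,\dots,u_n$ is upper triangular with 1's on the diagonal; $U=T\,\mathrm{Sp}^M$; $H$ is the group of $g\in\mathrm{Sp}_{M,N}$ having all $u_i,v_j$ as eigenvectors; $B=UH$. $F$ is a field of characteristic $l\neq p$ containing a primitive $p$-th root of unity, and $\lambda:F_q^+\to F^*$ is a non-trivial linear character. For $\kappa\in F_q^*$, $\lambda[\kappa](\alpha)=\lambda(\kappa\alpha)$. The module $X^+_\lambda$. Let $X=X_\lambda$ be an $F$-space with basis $(E_v)_{v\in N}$, an $F\mathrm{Sp}_M$-module via $saE_v=\lambda(\langle sav,av\rangle)E_{av}$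 for $s\in\mathrm{Sp}^M$, $a\in\mathrm{Sp}_{M,N}$. If $p$ is odd, $X^+_\lambda$ is the span of all $E_v+E_{-v}$, $0\ne v\in N$; if $p=2$, $X^+_\lambda$ is the span of all $E_v$, $0\neq v\in N$. It is an $\mathrm{Sp}_M$-submodule. Steinberg module. Let $w_i$ ($1\le i<n$) be the element of $\mathrm{Sp}$ permuting the basis as $(u_i,u_{i+1})(v_i,v_{i+1})$, and $c_j$ ($1\le j\le n$) the element with $c_ju_j=v_j$, $c_jv_j=-u_j$ fixing all other basis vectors. Let $W_2=\langle w_1,\dots,w_{n-1},c_1,\dots,c_n\rangle$, which normalizes $H$; $W=W_2H/H$ is the Weyl group, with length function $\ell$ relative to $w_1H,\dots,w_{n-1}H,c_nH$. For $w\in W$ choose $n_w\in W_2$ with $n_wH=w$. Put $e=\big(\sum_{w\in W}(-1)^{\ell(w)}n_w\big)\sum_{b\in B}b$ and $I=F\,\mathrm{Sp}\cdot e$, the (left) Steinberg module over $F$. Weil modules ($p$ odd). Let $Y=Y_\lambda$ be an $F$-space with basis $(\epsilon_v)_{v\in N}$. The Weil representation of type $\lambda$ is the representation $P:\mathrm{Sp}\to\mathrm{GL}(Y)$ determined by $P(sa)\epsilon_v=\theta(sa)^n\lambda(\langle sav,av\rangle)\epsilon_{av}$ for $s\in\mathrm{Sp}^M$, $a\in\mathrm{Sp}_{M,N}$, and $P(\rho)\epsilon_v=\big(\sum_{\alpha\in F_q}\lambda(\alpha^2)\big)^{-1}\sum_{\alpha\in F_q}\lambda(\alpha^2)\epsilon_{v+\alpha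 v_n}$, where $\rho(v)=v-\langle v_n,v\rangle v_n$ and $\theta:\mathrm{Sp}_M\to F^*$ is the linear character with $\theta(sa)=1$ if $\det a|_N$ is a square in $F_q^*$ and $\theta(sa)=-1$ otherwise. $Y^\pm_\lambda$ is the span of all $\epsilon_v\pm\epsilon_{-v}$, $0\ne v\in N$; both are $\mathrm{Sp}_M$-stable, and $Y^-_\lambda$ is $\mathrm{Sp}$-stable, called the Weil module of type $\lambda$ and degree $(q^n-1)/2$. $\theta^nY^+_\lambda$ denotes the $\mathrm{Sp}_M$-module obtained from $Y^+_\lambda$ by twisting by the character $\theta^n$. *)

(* Defs.v *)
From HB Require Import structures.
From mathcomp Require Import all_boot all_order all_algebra all_fingroup.
Set Implicit Arguments.
Unset Strict Implicit.
Unset Printing Implicit Defensive.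
Import GRing.Theory.
Local Open Scope ring_scope.

(* A left module over a set G of group elements is a vector space together
   with an action r : gT -> V -> V; only the r g with g \in G matter. *)
Section Modules.
Variables (gT : finGroupType) (F : fieldType).
Implicit Types (G : {set gT}) (V : vectType F).

Definition is_repr V G (P : gT -> 'End(V)) : Prop :=
  P 1%g = \1%VF /\ {in G &, forall g h, P (g * h)%g = (P g \o P h)%VF}.

Definition is_submodule V G (r : gT -> V -> V) (U : {vspace V}) : Prop :=
  forall g u, g \in G -> u \in U -> r g u \in U.

Definition irreducible_module V G (r : gT -> V -> V) (U : {vspace V}) : Prop :=
  [/\ is_submodule G r U, U != 0%VS &
      forall U' : {vspace V}, (U' <= U)%VS -> is_submodule G r U' ->
        U' = 0%VS \/ U' = U].

Definition iso_module V1 V2 G (r1 : gT -> V1 -> V1) (U1 : {vspace V1})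
    (r2 : gT -> V2 -> V2) (U2 : {vspace V2}) : Prop :=
  exists f : 'Hom(V1, V2),
    [/\ (U1 :&: lker f = 0)%VS, (f @: U1 = U2)%VS &
        forall g u, g \in G -> u \in U1 -> f (r1 g u) = r2 g (f u)].

Definition twist V (chi : gT -> F) (r : gT -> V -> V) (g : gT) (x : V) : V :=
  chi g *: r g x.

(* The group algebra of the whole finite group, as functions gT -> F. *)
Definition group_algebra := {ffun gT -> F^o}.

Definition ga_delta (g : gT) : group_algebra := [ffun h => (h == g)%:R].

Definition ga_mul (x y : group_algebra) : group_algebra :=
  [ffun g => \sum_h x h * y (h^-1 * g)%g].

Definition ga_left (g : gT) (x : group_algebra) : group_algebra :=
  ga_mul (ga_delta g) x.

End Modules.

(* V is the space of column vectors of size 2n, n = m.+1 >= 1, with its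
   standard symplectic basis u_1, .., u_n, v_1, .., v_n (indexed from 0). *)
Section Symplectic.
Variables (Fq : finFieldType) (m : nat).
Local Notation n := m.+1.
Local Notation V := 'cV[Fq]_(n + n).
Local Notation GL := {'GL_(n + n)[Fq]}.

Definition sform (x y : V) : Fq :=
  (x^T *m (block_mx 0 1%:M (- 1%:M) 0 : 'M_(n + n)) *m y) 0 0.

Definition mx (g : GL) : 'M[Fq]_(n + n) := GLval g.
Definition gact (g : GL) (x : V) : V := mx g *m x.

Definition ub (i : 'I_n) : V := col_mx (delta_mx i 0) 0.
Definition vb (i : 'I_n) : V := col_mx 0 (delta_mx i 0).
Definition Mspace : {vspace V} := <<codom ub>>%VS.
Definition Nspace : {vspace V} := <<codom vb>>%VS.

Definition Sp : {set GL} :=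
  [set g | [forall x, forall y, sform (gact g x) (gact g y) == sform x y]].

Definition Sp_fixM : {set GL} :=
  [set s in Sp | [forall (x | x \in Mspace), gact s x == x]].

Definition Sp_M : {set GL} :=
  [set g in Sp | [forall (x | x \in Mspace), gact g x \in Mspace]].

Definition Sp_MN : {set GL} :=
  [set a in Sp_M | [forall (x | x \in Nspace), gact a x \in Nspace]].

Definition Tgrp : {set GL} :=
  [set g in Sp_MN | [forall i : 'I_n, forall j : 'I_n,
     (ulsubmx (mx g) i i == 1) && ((j < i)%N ==> (ulsubmx (mx g) i j == 0))]].

Definition Ugrp : {set GL} := (Tgrp * Sp_fixM)%g.

Definition Hgrp : {set GL} :=
  [set g in Sp_MN | [forall i : 'I_n,
     [exists a, gact g (ub i) == a *: ub i]
     && [exists a, gact g (vb i) == a *: vb i]]].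

Definition Bgrp : {set GL} := (Ugrp * Hgrp)%g.

(* These two predicates each determine a single group element. *)
Definition is_w (i : 'I_m) (g : GL) : bool :=
  let s := tperm (widen_ord (leqnSn m) i) (lift ord0 i) in
  [forall j, (gact g (ub j) == ub (s j)) && (gact g (vb j) == vb (s j))].

Definition is_c (j : 'I_n) (g : GL) : bool :=
  [forall i, if i == j
     then (gact g (ub i) == vb i) && (gact g (vb i) == - ub i)
     else (gact g (ub i) == ub i) && (gact g (vb i) == vb i)].

Definition W2 : {set GL} :=
  <<[set g | [exists i, is_w i g] || [exists j, is_c j g]]>>%g.

Definition Weyl : {set coset_of Hgrp} := (W2 * Hgrp / Hgrp)%g.

Definition Weyl_gens : {set coset_of Hgrp} :=
  [set coset Hgrp g | g in [set g | [exists i, is_w i g] || is_c ord_max g]].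

(* Least k such that w is a product of k generators; k < #|Weyl| always
   suffices, and the generators are involutions. *)
Definition Weyl_length (w : coset_of Hgrp) : nat :=
  find (fun k => w \in (Weyl_gens ^+ k)%g) (iota 0 #|Weyl|).

Definition Weyl_transversal (nw : coset_of Hgrp -> GL) : Prop :=
  forall w, w \in Weyl -> nw w \in W2 /\ coset Hgrp (nw w) = w.

Section Coefficients.
Variable F : fieldType.
Implicit Types (lambda : Fq -> F) (g s a : GL).

Definition Steinberg_elt (nw : coset_of Hgrp -> GL) : group_algebra GL F :=
  ga_mul (\sum_(w in Weyl) (-1) ^+ Weyl_length w *: ga_delta F (nw w))
         (\sum_(b in Bgrp) ga_delta F b).

Definition Steinberg (nw : coset_of Hgrp -> GL) :
    {vspace group_algebra GL F} :=
  <<[seq ga_left g (Steinberg_elt nw) | g in Sp]>>%VS.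

Definition linear_character lambda : Prop :=
  (forall x, lambda x != 0) /\ {morph lambda : x y / x + y >-> x * y}.

Definition nontrivial_character lambda : Prop := exists x, lambda x != 1.

Definition twist_character lambda (kappa : Fq) : Fq -> F :=
  fun x => lambda (kappa * x).

(* N is identified with its coordinate space 'cV_n through the basis vb. *)
Definition inN (w : 'cV[Fq]_n) : V := \sum_i w i 0 *: vb i.

(* For g = s a with s in Sp_fixM and a in Sp_MN, this is (the coordinates of)
   a v, that is, the component in N of g v along M. *)
Definition actN g (w : 'cV[Fq]_n) : 'cV[Fq]_n := dsubmx (gact g (inN w)).

(* The common underlying space of X_lambda and Y_lambda. *)
Definition Nfun := {ffun 'cV[Fq]_n -> F^o}.
Definition Eb (v : 'cV[Fq]_n) : Nfun := [ffun w => (w == v)%:R].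

Definition X_act lambda g (f : Nfun) : Nfun :=
  \sum_v (f v * lambda (sform (gact g (inN v)) (inN (actN g v))))
           *: Eb (actN g v).

Definition X_plus : {vspace Nfun} :=
  if 2%N \in [pchar Fq] then <<[seq Eb v | v : 'cV[Fq]_n in predC1 0%R]>>%VS
  else <<[seq (Eb v + Eb (- v))%R | v : 'cV[Fq]_n in predC1 0%R]>>%VS.

(* For g = s a as above, drsubmx (mx g) is the matrix of a on N. *)
Definition theta g : F :=
  if [exists x : Fq, \det (drsubmx (mx g)) == x ^+ 2] then 1 else -1.

Definition theta_n g : F := theta g ^+ n.

(* The restriction of the Weil representation to Sp_M, written out because it
   makes sense on its own: with the factor theta ^+ n it extends to Sp when n
   is odd or F has characteristic 2, but not in general for n even. *)
Definition Y_act lambda g (f : Nfun) : Nfun :=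
  \sum_v (f v * (theta g ^+ n
                 * lambda (sform (gact g (inN v)) (inN (actN g v)))))
           *: Eb (actN g v).

Definition Y_plus : {vspace Nfun} :=
  <<[seq (Eb v + Eb (- v))%R | v : 'cV[Fq]_n in predC1 0%R]>>%VS.
Definition Y_minus : {vspace Nfun} :=
  <<[seq (Eb v - Eb (- v))%R | v : 'cV[Fq]_n in predC1 0%R]>>%VS.

(* The last clause concerns the unique group element acting on V as
   x |-> x - <v_n, x> v_n. *)
Definition Weil_repr lambda (P : GL -> 'End(Nfun)) : Prop :=
  [/\ is_repr Sp P,
      forall g f, g \in Sp_M -> P g f = Y_act lambda g f &
      forall rho : GL,
        (forall x, gact rho x = x - sform (vb ord_max) x *: vb ord_max) ->
        forall v, P rho (Eb v) =
          (\sum_alpha lambda (alpha ^+ 2))^-1 *: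
            \sum_alpha lambda (alpha ^+ 2)
              *: Eb (v + alpha *: delta_mx ord_max 0)].


Lemma inNE w : inN w = col_mx 0 w.
Proof.
apply/colP => j; rewrite -[j]splitK summxE; case: split => k /=.
  by rewrite col_mxEu mxE big1 // => i _; rewrite mxE col_mxEu mxE mulr0.
rewrite col_mxEd (bigD1 k) //= big1 => [|i /negPf ik]; last first.
  by rewrite mxE col_mxEd mxE eq_sym ik mulr0.
by rewrite mxE col_mxEd mxE !eqxx mulr1 addr0.
Qed.

Lemma inN_Nspace w : inN w \in Nspace.
Proof.
by apply: memv_suml => i _; apply/memvZ/memv_span/codom_f.
Qed.

Lemma Nspace_inN x : x \in Nspace -> inN (dsubmx x) = x.
Proof.
suff /subvP sN : (Nspace <= lker (linfun (@usubmx Fq n n 1)))%VS.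
  by move/sN; rewrite memv_ker lfunE => /eqP x0; rewrite inNE -{2}[x]vsubmxK x0.
by apply/span_subvP => _ /codomP[i ->]; rewrite memv_ker lfunE /= col_mxKu.
Qed.

Lemma sform_ub i x : sform (ub i) x = dsubmx x i 0.
Proof.
rewrite /sform /ub tr_col_mx trmx0 mul_row_block !mul0mx !mulmx0 !addr0 mulmx1.
rewrite -{1}[x]vsubmxK mul_row_col mul0mx add0r trmx_delta -rowE.
by rewrite !mxE.
Qed.

Lemma Sp_fixM_mod s x : s \in Sp_fixM -> dsubmx (gact s x) = dsubmx x.
Proof.
rewrite !inE => /andP[/forallP sSp /forall_inP fixM].
apply/colP => i; rewrite -!sform_ub.
have /fixM/eqP {1}<- : ub i \in Mspace by apply/memv_span/codom_f.
by have /forallP/(_ x)/eqP := sSp (ub i).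
Qed.

Lemma gactM g h x : gact (g * h)%g x = gact g (gact h x).
Proof. by rewrite /gact /mx GL_ME mulmxA. Qed.

Lemma actN_fixM s a w : s \in Sp_fixM -> actN (s * a)%g w = actN a w.
Proof. by move=> s_fix; rewrite /actN gactM Sp_fixM_mod. Qed.

Lemma inN_actN a w : a \in Sp_MN -> inN (actN a w) = gact a (inN w).
Proof.
rewrite inE => /andP[_ /forall_inP aN]; apply: Nspace_inN.
exact/aN/inN_Nspace.
Qed.

Lemma actN_mx g w : actN g w = drsubmx (mx g) *m w.
Proof.
rewrite /actN /gact inNE -[mx g]submxK mul_block_col !mulmx0 !add0r.
by rewrite col_mxKd block_mxKdr.
Qed.

Lemma theta_fixM s a : s \in Sp_fixM -> theta (s * a)%g = theta a.
Proof.
move=> s_fix; rewrite /theta.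
suff -> : drsubmx (mx (s * a)%g) = drsubmx (mx a) by [].
apply/matrixP => i j.
move/colP/(_ i): (actN_fixM a (delta_mx j 0) s_fix).
by rewrite !actN_mx -!colE !mxE.
Qed.

Lemma sum_Eb (c : 'cV[Fq]_n -> F) (h : 'cV[Fq]_n -> Nfun) w :
  \sum_v (Eb w v * c v) *: h v = c w *: h w.
Proof.
rewrite (bigD1 w) //= big1 => [|v /negPf vw]; rewrite !ffunE ?vw.
  by rewrite eqxx mul1r addr0.
by rewrite mul0r scale0r.
Qed.

Lemma X_actE lambda s a w : s \in Sp_fixM -> a \in Sp_MN ->
  X_act lambda (s * a)%g (Eb w) =
    lambda (sform (gact (s * a)%g (inN w)) (gact a (inN w))) *: Eb (actN a w).
Proof.
move=> sM aMN; rewrite /X_act.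
rewrite (sum_Eb (fun v => lambda _) (fun v => Eb _)).
by rewrite actN_fixM // inN_actN.
Qed.

Lemma Y_actE lambda s a w : s \in Sp_fixM -> a \in Sp_MN ->
  Y_act lambda (s * a)%g (Eb w) =
    (theta a ^+ n
     * lambda (sform (gact (s * a)%g (inN w)) (gact a (inN w))))
      *: Eb (actN a w).
Proof.
move=> sM aMN; rewrite /Y_act.
rewrite (sum_Eb (fun v => _ * lambda _) (fun v => Eb _)).
by rewrite actN_fixM // theta_fixM // inN_actN.
Qed.

End Coefficients.
End Symplectic.

(* Main.v *)
Require Import Defs.
From HB Require Import structures.
From mathcomp Require Import all_boot all_order all_algebra all_fingroup.
From mathcomp Require Import zify ring.
Set Implicit Arguments.
Unset Strict Implicit.
Unset Printing Implicit Defensive.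
Import GRing.Theory.
Local Open Scope ring_scope.

(** View the generator [e] of the Steinberg module [I] as a function on [Sp], right
    invariant under [B]: it takes the value [(-1) ^ l(w)] on the coset [n_w B] and
    vanishes off these cosets. The sign is computed as the determinant of [n_w] in
    the reflection representation ([len_sgn], [estE], [est_out]).

    Let [psi] be the linear character of [U] that is trivial on the simple root
    subgroups except the long one, where it is given by [lambda], so that
    [psi u = lambda (<u v_n, v_n>)], and let [f] be the sum of [psi(u)^-1 u e] over
    [u] in [U] ([fvec]). It is an element of [I] with the following properties.

    - It is not zero: its value at the product of all [c_j] comes from [u = 1]
      alone ([fvec_neq0]).
    - The group [Sp^M], contained in [U], acts on [f] through the character
      [s |-> lambda (<s v_n, v_n>)] ([fvec_fixM]).
    - It is fixed by every element of [Sp_{M,N}] that sends [v_n] to [v_n] or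
      [- v_n] ([fixes_emb]). By the LU decomposition this stabilizer is generated by
      its elements in [U] and [H], for which the claim is clear, and by the simple
      reflections [w_i] fixing [v_n]. For these, let [X] be the root subgroup. A
      monomial matrix carries [X] into [B] or into the opposite group, and [w_i]
      exchanges the two cases, so [e = e_+ - w_i e_+] with [e_+] fixed by [X]. Then
      the sum of [x e] over [x] in [X] is [q e_+] minus the sum of the [x w_i e_+].
      As [q = -1] in [F], this is minus the sum of the translates of [e_+] over the
      [q + 1] points of a projective line, on which [w_i] acts ([root_sum_refl]).

    Hence [E_v + E_{-v} |-> a f], where [a] in [Sp_{M,N}] sends [v_n] to [v], is a
    well defined homomorphism [Phi] from [X^+] to [I] ([gleft_line_vec],
    [Phi_equivariant]). The module [X^+] consists of the even functions vanishing at
    [0]. It is irreducible, because the characters [s |-> lambda (<s v, v>)] of [Sp^M]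
    separate the pairs [{v, -v}] and [Sp_{M,N}] permutes these pairs transitively
    ([X_plus_irreducible]). So [Phi] is injective.

    When [kappa] is not a square, no character [s |-> lambda (kappa <s w, w>)] with
    [w] nonzero equals one of the former, so the two modules are not isomorphic and
    their copies in [I] meet trivially ([no_common_eigenvector], [copies_direct]).
    The comparison with the Weil modules is formal: [theta] takes the values [1]
    and [-1], so twisting twice by [theta ^ n] changes nothing, and in
    characteristic [2] these signs, and those of the odd functions, disappear. *)

(** * The symplectic group in block form *)

Section GroupSets.
Variables (gT : finGroupType) (A : {set gT}).
Hypothesis gA : group_set A.

Lemma group_set_mul x y : x \in A -> y \in A -> (x * y)%g \in A.
Proof. exact: (@groupM _ (Group gA)). Qed.

Lemma group_set_inv x : x \in A -> x^-1%g \in A.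
Proof. exact: (@groupVr _ (Group gA)). Qed.

End GroupSets.

(** A constant of its own for the group and its elements: unification then compares
    group structures by name instead of rebuilding them from those of matrices. *)
Definition GLn (Fq : finFieldType) (m : nat) : finGroupType :=
  {'GL_(m.+1 + m.+1)[Fq]}.
Definition SpG Fq m : {set GLn Fq m} := Sp Fq m.
Definition SpM Fq m : {set GLn Fq m} := Sp_M Fq m.
Definition SpMN Fq m : {set GLn Fq m} := Sp_MN Fq m.
Definition SpfM Fq m : {set GLn Fq m} := Sp_fixM Fq m.
Definition Torus Fq m : {set GLn Fq m} := Hgrp Fq m.

Definition gmx Fq m (g : GLn Fq m) : 'M[Fq]_(m.+1 + m.+1) := Defs.mx g.
Definition vact Fq m (g : GLn Fq m) (x : 'cV[Fq]_(m.+1 + m.+1)) := gmx g *m x.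

Section SymplecticMatrices.
Variables (Fq : finFieldType) (m : nat).
Local Notation n := m.+1.
Local Notation V := 'cV[Fq]_(n + n).
Local Notation gT := (GLn Fq m).
Implicit Types (g h : gT) (x y : V) (D : 'M[Fq]_n).

Definition Jmx : 'M[Fq]_(n + n) := block_mx 0 1%:M (- 1%:M) 0.

Lemma mx_inj : injective (@gmx Fq m).
Proof. exact: val_inj. Qed.

Lemma mx_gmx g : Defs.mx g = gmx g.
Proof. by []. Qed.

Lemma gact_vact g x : Defs.gact g x = vact g x.
Proof. by []. Qed.

Lemma mxM g h : gmx (g * h)%g = gmx g *m gmx h.
Proof. by rewrite /gmx /Defs.mx GL_ME. Qed.

Lemma mx1 : gmx (1%g : gT) = 1%:M.
Proof. by rewrite /gmx /Defs.mx GL_1E. Qed.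

Lemma mxVK g : gmx g^-1%g *m gmx g = 1%:M.
Proof. by rewrite -mxM mulVg mx1. Qed.

Definition toGL (A : 'M[Fq]_(n + n)) : gT := insubd (1%g : gT) A.

Lemma mx_toGL A : A \in unitmx -> gmx (toGL A) = A.
Proof. by move=> uA; rewrite /gmx /Defs.mx /toGL; apply: (insubdK (1%g : gT)). Qed.

Lemma sformE x y :
  sform x y = ((usubmx x)^T *m dsubmx y - (dsubmx x)^T *m usubmx y) 0 0.
Proof.
rewrite /sform -{1}[x]vsubmxK -{1}[y]vsubmxK tr_col_mx mul_row_block.
by rewrite !mulmx0 add0r addr0 mulmxN !mulmx1 mul_row_col addrC mulNmx.
Qed.

Lemma sform_delta i j : sform (delta_mx i 0) (delta_mx j 0) = Jmx i j.
Proof. by rewrite /sform trmx_delta -rowE -colE !mxE. Qed.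

Lemma in_SpP g : reflect ((gmx g)^T *m Jmx *m gmx g = Jmx) (g \in SpG Fq m).
Proof.
apply: (iffP idP); last first.
  move=> gJ; rewrite inE; apply/forallP => x; apply/forallP => y.
  rewrite /sform /vact trmx_mul; apply/eqP.
  by rewrite -/Jmx !mulmxA -(mulmxA x^T) -(mulmxA x^T) gJ.
rewrite inE => /forallP gS; apply/matrixP => i j.
have /forallP/(_ (delta_mx j 0))/eqP := gS (delta_mx i 0).
rewrite sform_delta => <-; rewrite /sform /vact trmx_mul trmx_delta.
by rewrite -/Jmx !mulmxA -!mulmxA -rowE !mulmxA -colE !mxE.
Qed.

Lemma sform_Sp g x y : g \in SpG Fq m -> sform (vact g x) (vact g y) = sform x y.
Proof. by rewrite inE => /forallP/(_ x)/forallP/(_ y)/eqP. Qed.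

Lemma group_set_Sp : group_set (SpG Fq m).
Proof.
apply/group_setP; split.
  by apply/in_SpP; rewrite mx1 trmx1 mul1mx mulmx1.
move=> g h /in_SpP gS /in_SpP hS; apply/in_SpP.
rewrite mxM trmx_mul !mulmxA -(mulmxA _ _ Jmx).
by rewrite -(mulmxA _ _ (gmx g)) gS hS.
Qed.
Canonical Sp_group := Group group_set_Sp.

Lemma Sp_mul g h : g \in SpG Fq m -> h \in SpG Fq m -> (g * h)%g \in SpG Fq m.
Proof. exact: (group_set_mul group_set_Sp). Qed.

Lemma Sp_inv g : g \in SpG Fq m -> g^-1%g \in SpG Fq m.
Proof. exact: (group_set_inv group_set_Sp). Qed.

Lemma mem_Mspace x : (x \in Mspace Fq m) = (dsubmx x == 0).
Proof.
apply/idP/eqP => [|x0].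
  suff /subvP sM : (Mspace Fq m <= lker (linfun (@dsubmx Fq n n 1)))%VS.
    by move/sM; rewrite memv_ker lfunE => /eqP.
  by apply/span_subvP => _ /codomP[i ->]; rewrite memv_ker lfunE /= col_mxKd.
have -> : x = \sum_i usubmx x i 0 *: ub Fq i.
  rewrite -[LHS]vsubmxK x0; apply/colP => j; rewrite -[j]splitK summxE.
  case: split => k /=.
    rewrite col_mxEu (bigD1 k) //= big1 => [|i /negPf ik]; last first.
      by rewrite mxE /ub col_mxEu [delta_mx _ _ _ _]mxE eq_sym ik mulr0.
    by rewrite [RHS]addr0 [RHS]mxE /ub col_mxEu [delta_mx _ _ _ _]mxE !eqxx mulr1.
  by rewrite col_mxEd mxE big1 // => i _; rewrite mxE /ub col_mxEd [X in _ * X]mxE mulr0.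
by apply: memv_suml => i _; apply/memvZ/memv_span/codom_f.
Qed.

Lemma mem_Nspace x : (x \in Nspace Fq m) = (usubmx x == 0).
Proof.
apply/idP/eqP => [|x0].
  by move/Nspace_inN <-; rewrite inNE col_mxKu.
by rewrite -[x]vsubmxK x0 -inNE inN_Nspace.
Qed.

Lemma vact_col g (a b : 'cV_n) : vact g (col_mx a b) =
  col_mx (ulsubmx (gmx g) *m a + ursubmx (gmx g) *m b)
         (dlsubmx (gmx g) *m a + drsubmx (gmx g) *m b).
Proof. by rewrite /vact -{1}[gmx g]submxK mul_block_col. Qed.

Lemma mulmx_all0 k (A : 'M[Fq]_(k, n)) : (forall a : 'cV_n, A *m a = 0) -> A = 0.
Proof.
move=> A0; apply/matrixP => i j; have := A0 (delta_mx j 0).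
by rewrite -colE => /matrixP/(_ i 0); rewrite !mxE.
Qed.

Lemma mem_Sp_M g : (g \in SpM Fq m) = (g \in SpG Fq m) && (dlsubmx (gmx g) == 0).
Proof.
rewrite inE; congr (_ && _); apply/forall_inP/eqP => [gM | g0 x].
  apply: mulmx_all0 => a.
  have : vact g (col_mx a 0) \in Mspace Fq m by apply: gM; rewrite mem_Mspace col_mxKd.
  by rewrite mem_Mspace vact_col col_mxKd mulmx0 addr0 => /eqP.
rewrite !mem_Mspace => /eqP x0.
by rewrite gact_vact -[x]vsubmxK x0 vact_col col_mxKd g0 mul0mx mulmx0 addr0.
Qed.

Lemma mem_Sp_MN g : (g \in SpMN Fq m) =
  [&& g \in SpG Fq m, dlsubmx (gmx g) == 0 & ursubmx (gmx g) == 0].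
Proof.
rewrite inE mem_Sp_M -andbA; do 2 congr (_ && _).
apply/forall_inP/eqP => [gM | g0 x].
  apply: mulmx_all0 => a.
  have : vact g (col_mx 0 a) \in Nspace Fq m by apply: gM; rewrite mem_Nspace col_mxKu.
  by rewrite mem_Nspace vact_col col_mxKu mulmx0 add0r => /eqP.
rewrite !mem_Nspace => /eqP x0.
by rewrite gact_vact -[x]vsubmxK x0 vact_col col_mxKu g0 mul0mx mulmx0 addr0.
Qed.

Lemma mem_Sp_fixM g : (g \in SpfM Fq m) =
  [&& g \in SpG Fq m, dlsubmx (gmx g) == 0 & ulsubmx (gmx g) == 1%:M].
Proof.
rewrite inE; congr (_ && _); apply/forall_inP/andP => [gM | [/eqP d0 /eqP u1] x].
  have gMa a : vact g (col_mx a 0) = col_mx a 0.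
    by apply/eqP/gM; rewrite mem_Mspace col_mxKd.
  split; apply/eqP; last apply/subr0_eq; apply: mulmx_all0 => a.
    have := gMa a; rewrite vact_col mulmx0 addr0.
    by move/eq_col_mx => [_]; rewrite mulmx0 addr0.
  have := gMa a; rewrite vact_col mulmx0 addr0.
  by move/eq_col_mx => [ga _]; rewrite mulmxBl ga mul1mx subrr.
rewrite mem_Mspace => /eqP x0; rewrite gact_vact -[x]vsubmxK x0 vact_col d0 u1.
by rewrite mul1mx !mulmx0 mul0mx !addr0.
Qed.

Lemma Sp_M_blocks g : g \in SpM Fq m ->
  (ulsubmx (gmx g))^T *m drsubmx (gmx g) = 1%:M /\
  gmx g = block_mx (ulsubmx (gmx g)) (ursubmx (gmx g)) 0 (drsubmx (gmx g)).
Proof.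
rewrite mem_Sp_M => /andP[/in_SpP gS /eqP g0].
have gE : gmx g = block_mx (ulsubmx (gmx g)) (ursubmx (gmx g)) 0 (drsubmx (gmx g)).
  by rewrite -g0 submxK.
move: gS; rewrite {1 2}gE tr_block_mx trmx0 !mulmx_block.
rewrite !mulmx0 !mul0mx !mulmxN !mulmx1 !addr0 !add0r.
case/eq_block_mx => _ e1 _ _.
by split=> //; rewrite -e1 mul0mx add0r.
Qed.

(** The Levi factor: [D] acts on [N] and its contragredient on [M]. *)
Definition emb D : gT := toGL (block_mx (invmx D)^T 0 0 D).

Lemma mx_emb D : D \in unitmx -> gmx (emb D) = block_mx (invmx D)^T 0 0 D.
Proof.
move=> uD; apply: mx_toGL; rewrite unitmxE det_ublock det_tr det_inv.
by rewrite unitrMl ?unitrV.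
Qed.

Lemma emb_MN D : D \in unitmx -> emb D \in SpMN Fq m.
Proof.
move=> uD; rewrite mem_Sp_MN mx_emb // block_mxKdl block_mxKur !eqxx !andbT.
apply/in_SpP; rewrite mx_emb // tr_block_mx !trmx0 !mulmx_block.
rewrite !mulmx0 !mul0mx !mulmxN !mulmx1 !addr0 !add0r ?mulmx0 trmxK mulVmx //.
by rewrite mulNmx -trmx_mul mulVmx // trmx1 !mul0mx.
Qed.

Lemma emb_Sp D : D \in unitmx -> emb D \in SpG Fq m.
Proof. by move/emb_MN; rewrite mem_Sp_MN => /and3P[]. Qed.

Lemma invmxM D D' : D \in unitmx -> D' \in unitmx ->
  invmx (D *m D') = invmx D' *m invmx D.
Proof. move=> uD uD'; exact: (invrM uD uD'). Qed.

Lemma embM D D' : D \in unitmx -> D' \in unitmx ->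
  emb (D *m D') = (emb D * emb D')%g.
Proof.
move=> uD uD'; apply: mx_inj; rewrite mxM !mx_emb // ?unitmx_mul ?uD //.
by rewrite mulmx_block !mulmx0 !mul0mx !addr0 !add0r invmxM // trmx_mul.
Qed.

Lemma emb1 : emb 1%:M = 1%g.
Proof.
apply: mx_inj; rewrite mx_emb ?unitmx1 // mx1 invmx1 trmx1.
by rewrite -scalar_mx_block.
Qed.

Lemma embV D : D \in unitmx -> emb (invmx D) = (emb D)^-1%g.
Proof.
move=> uD; apply/(mulgI (emb D)); rewrite mulgV -embM ?unitmx_inv //.
by rewrite mulmxV // emb1.
Qed.

Lemma vact_emb D (w : 'cV_n) : D \in unitmx -> vact (emb D) (inN w) = inN (D *m w).
Proof.
move=> uD; rewrite !inNE vact_col mx_emb // block_mxKdl block_mxKdr block_mxKur.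
by rewrite !mul0mx mulmx0 !add0r.
Qed.

Lemma dr_unit g : g \in SpM Fq m -> drsubmx (gmx g) \in unitmx.
Proof.
by case/Sp_M_blocks => + _; case/mulmx1_unit.
Qed.

Lemma group_set_Sp_M : group_set (SpM Fq m).
Proof.
apply/group_setP; split.
  by rewrite mem_Sp_M group1 mx1 /= scalar_mx_block block_mxKdl.
move=> g h gM hM; move: (gM) (hM); rewrite !mem_Sp_M.
case/andP=> gS _ /andP[hS _]; rewrite groupM // mxM.
have [_ ->] := Sp_M_blocks gM; have [_ ->] := Sp_M_blocks hM.
by rewrite mulmx_block block_mxKdl mul0mx mulmx0 addr0 /=.
Qed.
Canonical Sp_M_group := Group group_set_Sp_M.

Lemma Sp_M_mul g h : g \in SpM Fq m -> h \in SpM Fq m -> (g * h)%g \in SpM Fq m.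
Proof. exact: (group_set_mul group_set_Sp_M). Qed.

Lemma Sp_M_inv g : g \in SpM Fq m -> g^-1%g \in SpM Fq m.
Proof. exact: (group_set_inv group_set_Sp_M). Qed.

Lemma Sp_fixM_M g : g \in SpfM Fq m -> g \in SpM Fq m.
Proof. by rewrite mem_Sp_fixM mem_Sp_M => /and3P[-> ->]. Qed.

Lemma Sp_fixM_dr g : g \in SpfM Fq m -> drsubmx (gmx g) = 1%:M.
Proof.
move=> gf; have [+ _] := Sp_M_blocks (Sp_fixM_M gf).
by move: gf; rewrite mem_Sp_fixM => /and3P[_ _ /eqP->]; rewrite trmx1 mul1mx.
Qed.

Lemma Sp_fixM_of_dr g : g \in SpM Fq m -> drsubmx (gmx g) = 1%:M ->
  g \in SpfM Fq m.
Proof.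
move=> gM g1; have [] := Sp_M_blocks gM; rewrite g1 mulmx1 => u1 _.
move: gM; rewrite mem_Sp_fixM mem_Sp_M => /andP[-> ->] /=.
by rewrite -[ulsubmx _]trmxK u1 trmx1.
Qed.

Lemma dr_mul g h : g \in SpM Fq m ->
  drsubmx (gmx (g * h)%g) = drsubmx (gmx g) *m drsubmx (gmx h).
Proof.
move=> gM; rewrite mxM; have [_ ->] := Sp_M_blocks gM.
by rewrite -{1}[gmx h]submxK mulmx_block !block_mxKdr mul0mx add0r.
Qed.

Lemma dr_emb D : D \in unitmx -> drsubmx (gmx (emb D)) = D.
Proof. by move=> uD; rewrite mx_emb // block_mxKdr. Qed.

Lemma emb_M D : D \in unitmx -> emb D \in SpM Fq m.
Proof. by move/emb_MN; rewrite inE => /andP[]. Qed.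

(** The group [Sp^M], parametrized by the symmetric matrices. *)
Definition rad (S : 'M[Fq]_n) : gT := toGL (block_mx 1%:M S 0 1%:M).

Lemma mx_rad S : gmx (rad S) = block_mx 1%:M S 0 1%:M.
Proof. by apply: mx_toGL; rewrite unitmxE det_ublock !det1 mulr1 unitr1. Qed.

Lemma rad_fixM S : S^T = S -> rad S \in SpfM Fq m.
Proof.
move=> sS; rewrite mem_Sp_fixM mx_rad block_mxKdl block_mxKul !eqxx !andbT.
apply/in_SpP; rewrite mx_rad tr_block_mx !trmx0 !trmx1 !mulmx_block.
rewrite !mulmx0 !mul0mx !mulmxN !mulmx1 !addr0 !add0r ?mulmx0 sS ?mul1mx.
by rewrite mul0mx add0r mulNmx mul1mx addNr.
Qed.

End SymplecticMatrices.

(** * The Borel subgroup as triangular matrices *)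

Section BorelSubgroup.
Variables (Fq : finFieldType) (m : nat).
Local Notation n := m.+1.
Local Notation gT := (GLn Fq m).
Implicit Types (g h : gT) (D : 'M[Fq]_n) (s t : 'S_(n + n)).

(** The position of a basis vector in the order [u_1, .., u_n, v_n, .., v_1], for
    which [B] is upper triangular and pairing by the form reverses the order. *)
Definition hgt (i : 'I_(n + n)) : nat := if (i < n)%N then nat_of_ord i else (3 * n - 1 - i)%N.

(** The index of the basis vector paired with a given one by the form. *)
Definition tau (i : 'I_(n + n)) : 'I_(n + n) :=
  match split i with inl j => rshift n j | inr j => lshift n j end.

Lemma tau_l (j : 'I_n) : tau (lshift n j) = rshift n j.
Proof. by rewrite /tau (unsplitK (inl j)). Qed.

Lemma tau_r (j : 'I_n) : tau (rshift n j) = lshift n j.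
Proof. by rewrite /tau (unsplitK (inr j)). Qed.

Lemma hgt_l (j : 'I_n) : hgt (lshift n j) = j.
Proof. by rewrite /hgt /= ltn_ord. Qed.

Lemma hgt_r (j : 'I_n) : hgt (rshift n j) = (2 * n - 1 - j)%N.
Proof. by rewrite /hgt /=; case: ifP => //; lia. Qed.

Lemma hgt_inj : injective hgt.
Proof.
move=> i j; have := ltn_ord i; have := ltn_ord j; rewrite /hgt => ? ? e.
by apply: val_inj => /=; move: e; do 2 case: ifP; lia.
Qed.

Lemma hgt_tau i : hgt (tau i) = (2 * n - 1 - hgt i)%N.
Proof.
by case: (split_ordP i) => j ->; rewrite ?(tau_l, tau_r) hgt_l hgt_r; have := ltn_ord j; lia.
Qed.

Lemma hgt_lt i : (hgt i < 2 * n)%N.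
Proof. by have := ltn_ord i; rewrite /hgt; case: ifP; lia. Qed.

(** A permutation preserves the sum of all heights, so none of them can drop. *)
Lemma perm_hgt_le s : (forall j, (hgt (s j) <= hgt j)%N) -> s = 1%g.
Proof.
move=> le_s; apply/permP => j; rewrite perm1; apply: hgt_inj; apply/eqP.
have /leqif_sum : forall i, true -> (hgt (s i) <= hgt i ?= iff (hgt (s i) == hgt i))%N.
  by move=> i _; split; rewrite ?le_s.
have -> : (\sum_i hgt i = \sum_i hgt (s i))%N by rewrite (reindex_inj (@perm_inj _ s)).
by case=> _ /esym; rewrite eqxx => /forallP/(_ j).
Qed.

Lemma Jmx_neq0 i j : (@Jmx Fq m i j != 0) = (j == tau i).
Proof.
rewrite /Jmx; case: (split_ordP i) => k ->; case: (split_ordP j) => k' ->;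
  rewrite ?tau_l ?tau_r ?block_mxEul ?block_mxEur ?block_mxEdl ?block_mxEdr !mxE;
  rewrite ?eq_lshift ?eq_rshift ?eq_lrshift ?eq_rlshift ?eqxx //.
  by rewrite [k' == _]eq_sym; case: (k == k'); rewrite ?oner_eq0 ?eqxx.
by rewrite [k' == _]eq_sym; case: (k == k'); rewrite ?mulr1n ?mulr0n ?oppr0 ?oppr_eq0 ?oner_eq0 ?eqxx.
Qed.

(** The group [B], described by triangularity for the heights; it is identified with
    the product [T Sp^M H] in [Bgrp_Borel]. *)
Definition Borel : {set gT} :=
  [set g in SpG Fq m | [forall i, forall j, (hgt j < hgt i)%N ==> (gmx g i j == 0)]].

Lemma BorelP g : reflect (g \in SpG Fq m /\ forall i j, (hgt j < hgt i)%N -> gmx g i j = 0)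
  (g \in Borel).
Proof.
rewrite [_ \in Borel]inE; apply: (iffP andP) => -[gS gT]; split=> //.
  by move=> i j ji; have /forallP/(_ j)/implyP/(_ ji)/eqP := forallP gT i.
by apply/forallP => i; apply/forallP => j; apply/implyP => /gT ->.
Qed.

Lemma Borel_Sp g : g \in Borel -> g \in SpG Fq m.
Proof. by case/BorelP. Qed.

Lemma group_set_Borel : group_set Borel.
Proof.
apply/group_setP; split.
  apply/BorelP; split; first exact: group1.
  by move=> i j; rewrite mx1 mxE; case: eqP => [->|]; rewrite ?ltnn.
move=> g h /BorelP[gS gT] /BorelP[hS hT]; apply/BorelP; split; first exact: Sp_mul.
move=> i j ji; rewrite mxM mxE big1 // => k _.
case: (ltnP (hgt k) (hgt i)) => ki; first by rewrite gT ?mul0r.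
by rewrite hT ?mulr0 // (leq_trans ji).
Qed.
Canonical Borel_group := Group group_set_Borel.

Lemma Borel_mul g h : g \in Borel -> h \in Borel -> (g * h)%g \in Borel.
Proof. exact: (group_set_mul group_set_Borel). Qed.

Lemma Borel_inv g : g \in Borel -> g^-1%g \in Borel.
Proof. exact: (group_set_inv group_set_Borel). Qed.

(** A subset of a finite group that is closed under products is a subgroup. *)
Lemma invmx_upper D : D \in unitmx -> (forall i j : 'I_n, (j < i)%N -> D i j = 0) ->
  forall i j : 'I_n, (j < i)%N -> invmx D i j = 0.
Proof.
pose P := [set x : {'GL_n[Fq]} | [forall i : 'I_n, forall j : 'I_n,
  (j < i)%N ==> (GLval x i j == 0)]].
have PP (x : {'GL_n[Fq]}) : reflect (forall i j : 'I_n, (j < i)%N -> GLval x i j = 0) (x \in P).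
  rewrite inE; apply: (iffP forallP) => xT i.
    by move=> j ji; have /forallP/(_ j)/implyP/(_ ji)/eqP := xT i.
  by apply/forallP => j; apply/implyP => /xT ->.
have gP : group_set P.
  apply/group_setP; split.
    by apply/PP => i j; rewrite GL_1E mxE; case: eqP => [->|]; rewrite ?ltnn.
  move=> x y /PP xT /PP yT; apply/PP => i j ji; rewrite GL_ME mxE big1 // => k _.
  case: (ltnP k i) => ki; first by rewrite xT ?mul0r.
  by rewrite yT ?mulr0 // (leq_trans ji).
move=> uD DT; pose x := insubd (1%g : {'GL_n[Fq]}) D.
have xD : GLval x = D by apply: (insubdK (1%g : {'GL_n[Fq]})).
have : x \in Group gP by apply/PP; rewrite xD.
by rewrite -groupV => /PP; rewrite GL_VxE xD.
Qed.

(** The block on [N] is the inverse transpose of the block on [M], and the heights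
    on [N] run backwards, so triangularity on [M] is enough. *)
Lemma Borel_of_upper g : g \in SpG Fq m -> dlsubmx (gmx g) = 0 ->
  (forall i j : 'I_n, (j < i)%N -> ulsubmx (gmx g) i j = 0) -> g \in Borel.
Proof.
move=> gS g0 gT; have gM : g \in SpM Fq m by rewrite mem_Sp_M gS g0 eqxx.
have [AD gE] := Sp_M_blocks gM.
set A := ulsubmx _ in AD gE gT; set D := drsubmx _ in AD gE.
have /mulmx1_unit[uA uD] := AD; rewrite unitmx_tr in uA.
have DE : D = (invmx A)^T.
  by rewrite trmx_inv -[RHS]mulmx1 -AD mulKmx // unitmx_tr.
apply/BorelP; split=> // i j; rewrite gE.
case: (split_ordP i) => k ->; case: (split_ordP j) => k' ->;
  rewrite ?hgt_l ?hgt_r ?block_mxEul ?block_mxEur ?block_mxEdl ?block_mxEdr ?[_ _ _]mxE //.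
- exact: gT.
- by have := ltn_ord k; have := ltn_ord k'; lia.
- by rewrite mxE.
- move=> kk; rewrite DE mxE invmx_upper //.
  by have := ltn_ord k; have := ltn_ord k'; lia.
Qed.

Lemma Borel_dl g : g \in Borel -> dlsubmx (gmx g) = 0.
Proof.
case/BorelP => _ gT; apply/matrixP => i j; rewrite !mxE gT // hgt_l hgt_r.
by have := ltn_ord i; have := ltn_ord j; lia.
Qed.

Lemma Borel_M g : g \in Borel -> g \in SpM Fq m.
Proof. by move=> gB; rewrite mem_Sp_M Borel_Sp ?Borel_dl ?eqxx. Qed.

Lemma Borel_ul g (i j : 'I_n) : g \in Borel -> (j < i)%N -> ulsubmx (gmx g) i j = 0.
Proof. by case/BorelP => _ gT ji; rewrite !mxE gT // !hgt_l. Qed.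

Lemma Borel_diag g i : g \in Borel -> gmx g i i * gmx g (tau i) (tau i) = 1.
Proof.
move=> gB; wlog [j ->] : i / exists j, i = lshift n j.
  move=> H; case: (split_ordP i) => j ->; first by apply: H; exists j.
  by rewrite tau_r mulrC -tau_l; apply: H; exists j.
rewrite tau_l; have [/matrixP/(_ j j) + _] := Sp_M_blocks (Borel_M gB).
rewrite !mxE eqxx (bigD1 j) //= big1 ?addr0 => [|k kj].
  by rewrite !mxE.
have [kj'|kj'] := ltnP k j.
  suff -> : drsubmx (gmx g) k j = 0 by rewrite mulr0.
  case/BorelP: gB => _ gT; rewrite !mxE gT // !hgt_r.
  by have := ltn_ord k; have := ltn_ord j; lia.
by rewrite mxE Borel_ul ?mul0r // ltn_neqAle kj' andbT eq_sym.
Qed.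

Lemma Borel_diag_neq0 g i : g \in Borel -> gmx g i i != 0.
Proof.
by move/(Borel_diag i)/eqP; apply: contraTneq => ->; rewrite mul0r eq_sym oner_eq0.
Qed.

(** The group [U = T Sp^M]. *)
Definition Unip : {set gT} := [set g in Borel | [forall i, gmx g i i == 1]].

Lemma UnipP g : reflect (g \in Borel /\ forall i, gmx g i i = 1) (g \in Unip).
Proof.
rewrite [_ \in Unip]inE; apply: (iffP andP) => -[gB g1]; split=> //.
  by move=> i; apply/eqP/(forallP g1).
by apply/forallP => i; rewrite g1.
Qed.

Lemma Borel_diagM g h i : g \in Borel -> h \in Borel ->
  gmx (g * h)%g i i = gmx g i i * gmx h i i.
Proof.
move=> /BorelP[gS gT] /BorelP[hS hT]; rewrite mxM mxE (bigD1 i) //= big1 ?addr0 // => k ki.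
case: (ltngtP (hgt k) (hgt i)) => [kl|kl|/hgt_inj kl]; last by rewrite kl eqxx in ki.
  by rewrite gT ?mul0r.
by rewrite hT ?mulr0.
Qed.

(** No height lies strictly between consecutive ones, so only the two extreme terms
    of the matrix product survive. *)
Lemma Unip_additive g h i j : g \in Unip -> h \in Unip -> hgt j = (hgt i).+1 ->
  gmx (g * h)%g i j = gmx g i j + gmx h i j.
Proof.
move=> /UnipP[/BorelP[gS gT] g1] /UnipP[/BorelP[hS hT] h1] ij; rewrite mxM mxE.
have ji : j != i by apply/eqP => e; move: ij; rewrite e; lia.
rewrite (bigD1 i) //= (bigD1 j) //= big1 ?addr0; last first.
  move=> k /andP[ki kj]; have [kl|kl] := ltnP (hgt k) (hgt i); first by rewrite gT ?mul0r.
  rewrite hT ?mulr0 // ltn_neqAle ij ltn_neqAle kl andbT -ij.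
  by rewrite !(inj_eq hgt_inj) eq_sym kj eq_sym.
by rewrite g1 h1 mulr1 mul1r addrC.
Qed.

Lemma group_set_Unip : group_set Unip.
Proof.
apply/group_setP; split.
  by apply/UnipP; split; [exact: group1 | move=> i; rewrite mx1 mxE eqxx].
move=> g h /UnipP[gB g1] /UnipP[hB h1]; apply/UnipP; split; first exact: Borel_mul.
by move=> i; rewrite Borel_diagM // g1 h1 mulr1.
Qed.
Canonical Unip_group := Group group_set_Unip.

Lemma Unip_mul g h : g \in Unip -> h \in Unip -> (g * h)%g \in Unip.
Proof. exact: (group_set_mul group_set_Unip). Qed.

Lemma Unip_inv g : g \in Unip -> g^-1%g \in Unip.
Proof. exact: (group_set_inv group_set_Unip). Qed.

Lemma Unip_Borel g : g \in Unip -> g \in Borel.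
Proof. by case/UnipP. Qed.

Lemma mem_Hgrp g : (g \in Torus Fq m) =
  (g \in SpG Fq m) && [forall i, forall j, (i != j) ==> (gmx g i j == 0)].
Proof.
apply/idP/andP => [|[gS /forallP gD]].
  rewrite inE mem_Sp_MN => /andP[/and3P[gS /eqP gl /eqP gr] /forallP gH]; split=> //.
  apply/forallP => i; apply/forallP => j; apply/implyP => ij.
  rewrite -[gmx g]submxK gl gr; move: ij.
  case: (split_ordP i) => k ->; case: (split_ordP j) => k' ->;
    rewrite ?block_mxEul ?block_mxEur ?block_mxEdl ?block_mxEdr ?mxE //.
    rewrite eq_lshift => /negPf kk; have /andP[/existsP[a /eqP]] := gH k'.
    rewrite ?gact_vact /ub vact_col mulmx0 addr0 scale_col_mx => /eq_col_mx[+ _] _.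
    rewrite -colE => /colP/(_ k); rewrite !mxE => ->.
    by rewrite kk mulr0.
  rewrite eq_rshift => /negPf kk; have /andP[_ /existsP[a /eqP]] := gH k'.
  rewrite ?gact_vact /vb vact_col mulmx0 scale_col_mx => /eq_col_mx[_].
  rewrite mulmx0 add0r -colE => /colP/(_ k); rewrite !mxE => ->.
  by rewrite kk mulr0.
have g0 i j : i != j -> gmx g i j = 0 by move=> ij; have /forallP/(_ j)/implyP/(_ ij)/eqP := gD i.
rewrite inE mem_Sp_MN gS /=; apply/andP; split.
  apply/andP; split; apply/eqP/matrixP => i j; rewrite !mxE g0 //.
    by rewrite eq_rlshift.
  by rewrite eq_lrshift.
apply/forallP => i; apply/andP; split; apply/existsP.
  exists (gmx g (lshift n i) (lshift n i)); apply/eqP.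
  rewrite ?gact_vact /ub vact_col !mulmx0 !addr0 scale_col_mx -!colE scaler0; congr col_mx.
    apply/colP => k; rewrite !mxE eqxx andbT; case: eqP => [->|/eqP ki]; rewrite ?mulr1 //.
    by rewrite g0 ?mulr0 // eq_lshift.
  by apply/colP => k; rewrite !mxE g0 // eq_rlshift.
exists (gmx g (rshift n i) (rshift n i)); apply/eqP.
rewrite ?gact_vact /vb vact_col !mulmx0 !add0r scale_col_mx -!colE scaler0; congr col_mx.
  by apply/colP => k; rewrite !mxE g0 // eq_lrshift.
apply/colP => k; rewrite !mxE eqxx andbT; case: eqP => [->|/eqP ki]; rewrite ?mulr1 //.
by rewrite g0 ?mulr0 // eq_rshift.
Qed.

Lemma HgrpP g : reflect (g \in SpG Fq m /\ forall i j, i != j -> gmx g i j = 0) (g \in Torus Fq m).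
Proof.
rewrite mem_Hgrp; apply: (iffP andP) => -[gS gD]; split=> //.
  by move=> i j ij; have /forallP/(_ j)/implyP/(_ ij)/eqP := forallP gD i.
by apply/forallP => i; apply/forallP => j; apply/implyP => /gD ->.
Qed.

Lemma Hgrp_Borel g : g \in Torus Fq m -> g \in Borel.
Proof.
case/HgrpP => gS gD; apply/BorelP; split=> // i j ij; apply: gD.
by apply: contraTneq ij => ->; rewrite ltnn.
Qed.

(** The diagonal of a triangular symplectic matrix is symplectic by [Borel_diag]. *)
Lemma Borel_torus_part g : g \in Borel -> exists2 h, h \in Torus Fq m & forall i, gmx h i i = gmx g i i.
Proof.
move=> gB; pose d := diag_mx (\row_i gmx g i i).
have ud : d \in unitmx.
  rewrite unitmxE det_diag unitfE; apply/prodf_neq0 => i _.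
  by rewrite mxE Borel_diag_neq0.
have hE i j : gmx (toGL d) i j = gmx g i i *+ (i == j) by rewrite mx_toGL // !mxE.
exists (toGL d) => [|i]; last by rewrite hE eqxx.
apply/HgrpP; split => [|i j /negPf ij]; last by rewrite hE ij.
apply/in_SpP/matrixP => i j; rewrite mxE (bigD1 j) //= big1 => [|k /negPf kj]; last first.
  by rewrite hE kj mulr0.
rewrite addr0 mxE (bigD1 i) //= big1 => [|k /negPf ki]; last first.
  by rewrite mxE hE ki mul0r.
rewrite addr0 mxE !hE !eqxx !mulr1n.
have [J0|] := eqVneq (@Jmx Fq m i j) 0; first by rewrite J0 mulr0 mul0r.
by rewrite Jmx_neq0 => /eqP ->; rewrite mulrAC Borel_diag // mul1r.
Qed.

Lemma Borel_factor g : g \in Borel -> exists u h, [/\ u \in Unip, h \in Torus Fq m & g = (u * h)%g].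
Proof.
move=> gB; have [h hH hg] := Borel_torus_part gB.
have hB := Hgrp_Borel hH.
exists (g * h^-1)%g, h; split; rewrite ?mulgKV //.
apply/UnipP; split=> [|i]; first by rewrite Borel_mul ?Borel_inv.
apply: (mulIf (Borel_diag_neq0 i hB)).
by rewrite -Borel_diagM ?Borel_mul ?Borel_inv // mulgKV hg mul1r.
Qed.

(** An element [u] of [Unip] with block [D] on [N] is [emb D] times an element whose
    block on [N] is trivial. *)
Lemma Bgrp_Borel : Bgrp Fq m = Borel.
Proof.
suff: ((Tgrp Fq m : {set gT}) * SpfM Fq m * Torus Fq m)%g = Borel by [].
apply/setP/subset_eqP/andP; split; apply/subsetP => g.
  case/mulsgP => _ h /mulsgP[t s tT sM ->] hH ->.
  apply: Borel_mul; last exact: Hgrp_Borel.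
  apply: Borel_mul; last first.
    move: sM; rewrite mem_Sp_fixM => /and3P[sS /eqP s0 /eqP s1].
    by apply: Borel_of_upper => // i j ji; rewrite s1 mxE; case: eqP ji => // ->; rewrite ltnn.
  move: tT; rewrite inE mem_Sp_MN => /andP[/and3P[tS /eqP t0 _] /forallP tT].
  apply: Borel_of_upper => // i j ji.
  by have /forallP/(_ j)/andP[_ /implyP/(_ ji)/eqP] := tT i.
case/Borel_factor => u [h [uU hH ->]]; apply: mem_mulg => //.
have [uB u1] := UnipP _ uU; have uM := Borel_M uB; have uD := dr_unit uM.
have [AD _] := Sp_M_blocks uM.
have AE : ulsubmx (gmx u) = (invmx (drsubmx (gmx u)))^T.
  rewrite -[LHS]trmxK -[X in X^T = _]mulmx1 -(mulmxV uD) mulmxA AD.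
  by rewrite mul1mx.
rewrite -[u](mulKVg (emb (drsubmx (gmx u)))).
apply: mem_mulg.
  rewrite inE emb_MN //=; apply/forallP => i; apply/forallP => j.
  rewrite mx_gmx mx_emb // block_mxKul -AE !mxE u1 eqxx /=; apply/implyP => ji.
  by have := Borel_ul uB ji; rewrite !mxE => ->.
apply: Sp_fixM_of_dr; first by rewrite Sp_M_mul ?Sp_M_inv ?emb_M.
by rewrite dr_mul ?Sp_M_inv ?emb_M // -embV // dr_emb ?unitmx_inv // mulVmx.
Qed.

End BorelSubgroup.

(** * Monomial matrices and the sign character *)

Section ShortWords.
Variables (qT : finGroupType) (A : {set qT}).

Lemma gen_word x : x \in <<A>>%g -> exists k, x \in (A ^+ k)%g.
Proof.
case/gen_prodgP => k [c cA ->]; exists k.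
elim: k c cA => [|k IH] c cA; first by rewrite big_ord0 expg0 inE.
by rewrite big_ord_recr expgSr mem_mulg //= IH.
Qed.

(** A word can be shortened as long as two of its prefixes have the same value. *)
Lemma short_word (G : {group qT}) k x : A \subset G -> x \in (A ^+ k)%g ->
  exists2 j, (j < #|G|)%N & x \in (A ^+ j)%g.
Proof.
move=> /subsetP sAG xA; pose e (y z : qT) := (y^-1 * z)%g \in A.
have : connect e 1%g x.
  elim: k x xA => [|k IH] x; first by rewrite expg0 inE => /eqP ->.
  rewrite expgSr => /mulsgP[y a yA aA ->].
  by apply: (connect_trans (IH _ yA)); apply: connect1; rewrite /e mulKg.
case/connectP => p pth ->; case: (shortenP pth) => q qth uq _ {p pth}.
have inG y r : y \in G -> path e y r -> {subset y :: r <= G}.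
  elim: r y => [|z r IH] y yG /=; first by move=> _ t; rewrite inE => /eqP ->.
  case/andP=> yz /IH sr t; rewrite inE => /predU1P[-> //|]; apply: sr.
  by rewrite -(groupMl _ (groupVr yG)) sAG.
have word y r : path e y r -> (y^-1 * last y r)%g \in (A ^+ size r)%g.
  elim: r y => [|z r IH] y /=; first by rewrite mulVg expg0 inE.
  case/andP=> yz /IH zr.
  have -> : (y^-1 * last z r = (y^-1 * z) * (z^-1 * last z r))%g by rewrite mulgA mulgK.
  by rewrite expgS mem_mulg.
exists (size q); last by have := word _ _ qth; rewrite invg1 mul1g.
rewrite cardE; apply: (uniq_leq_size uq) => y yq.
by rewrite mem_enum (inG _ _ (group1 G) qth).
Qed.
End ShortWords.

Section Monomial.
Variables (Fq : finFieldType) (m : nat).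
Local Notation n := m.+1.
Local Notation gT := (GLn Fq m).
Implicit Types (g h : gT) (D : 'M[Fq]_n) (s t : 'S_(n + n)).

Definition is_mono s g : bool := [forall i, forall j, (gmx g i j != 0) == (i == s j)].

Lemma monoP s g : reflect (forall i j, (gmx g i j != 0) = (i == s j)) (is_mono s g).
Proof.
apply: (iffP forallP) => sg i; first by move=> j; have /forallP/(_ j)/eqP := sg i.
by apply/forallP => j; rewrite sg.
Qed.

Lemma mono0 s g i j : is_mono s g -> i != s j -> gmx g i j = 0.
Proof. by move/monoP => sg; rewrite -sg negbK => /eqP. Qed.

Lemma mono_neq0 s g j : is_mono s g -> gmx g (s j) j != 0.
Proof. by move/monoP ->. Qed.

Lemma mono1 : is_mono 1%g (1%g : gT).
Proof.
apply/monoP => i j; rewrite mx1 perm1 mxE.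
by case: (i == j); rewrite ?oner_eq0 ?eqxx.
Qed.

Lemma monoM s t g h : is_mono s g -> is_mono t h -> is_mono (t * s)%g (g * h)%g.
Proof.
move=> sg th; apply/monoP => i j; rewrite mxM mxE (bigD1 (t j)) //= big1 ?addr0.
  by rewrite mulf_eq0 negb_or (mono_neq0 j th) andbT (monoP _ _ sg) permM.
by move=> k kj; rewrite (mono0 th) ?mulr0.
Qed.

Lemma mono_Hgrp g : (g \in Torus Fq m) = (g \in SpG Fq m) && is_mono 1%g g.
Proof.
apply/idP/andP => [gH | [gS g1]].
  have /HgrpP[gS gD] := gH; split=> //; apply/monoP => i j; rewrite perm1.
  have [->|/gD ->] := eqVneq i j; last by rewrite eqxx.
  by rewrite Borel_diag_neq0 // Hgrp_Borel.
by apply/HgrpP; split=> // i j ij; apply: (mono0 g1); rewrite perm1.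
Qed.

(** The permutation of a triangular monomial matrix does not increase heights. *)
Lemma mono_Borel s g : is_mono s g -> g \in Borel Fq m -> s = 1%g.
Proof.
move=> sg /BorelP[_ gT]; apply: perm_hgt_le => j; rewrite leqNgt; apply/negP => /gT.
by apply/eqP/mono_neq0.
Qed.

(** Two basis vectors are paired by the form exactly when their images are. *)
Lemma mono_tau s g : g \in SpG Fq m -> is_mono s g -> forall j, s (tau j) = tau (s j).
Proof.
move=> /in_SpP/matrixP gS sg j; apply/eqP; rewrite -(@Jmx_neq0 Fq).
have := gS j (tau j).
rewrite mxE (bigD1 (s (tau j))) //= big1 ?addr0; last first.
  by move=> k kj; rewrite (mono0 sg) ?mulr0.
rewrite mxE (bigD1 (s j)) //= big1 ?addr0; last first.
  by move=> k kj; rewrite mxE (mono0 sg) ?mul0r.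
move=> e; have : @Jmx Fq m j (tau j) != 0 by rewrite Jmx_neq0.
by rewrite -e; apply: contraNneq => ->; rewrite mulr0 mul0r.
Qed.

Definition Mon : {set gT} := [set g in SpG Fq m | [exists s, is_mono s g]].

Lemma MonP g : reflect (g \in SpG Fq m /\ exists s, is_mono s g) (g \in Mon).
Proof.
rewrite [_ \in Mon]inE; apply: (iffP andP) => -[gS gm]; split=> //; exact/existsP.
Qed.

Lemma Mon_Sp g : g \in Mon -> g \in SpG Fq m.
Proof. by case/MonP. Qed.

Lemma group_set_Mon : group_set Mon.
Proof.
apply/group_setP; split; first by apply/MonP; split; [apply: group1 | exists 1%g; apply: mono1].
move=> g h /MonP[gS [s sg]] /MonP[hS [t th]]; apply/MonP; split; first exact: Sp_mul.
by exists (t * s)%g; apply: monoM.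
Qed.
Canonical Mon_group := Group group_set_Mon.

Lemma Mon_mul g h : g \in Mon -> h \in Mon -> (g * h)%g \in Mon.
Proof. exact: (group_set_mul group_set_Mon). Qed.

Lemma Mon_inv g : g \in Mon -> g^-1%g \in Mon.
Proof. exact: (group_set_inv group_set_Mon). Qed.

Lemma monoV s g : is_mono s g -> is_mono s^-1%g g^-1%g.
Proof.
move=> sg; apply/monoP => i k; have /matrixP/(_ i (s^-1%g k)) := mxVK g.
rewrite [LHS]mxE (bigD1 k) //= big1 ?addr0 => [e|j jk]; last first.
  by rewrite (mono0 sg) ?mulr0 // permKV.
have gk : gmx g k (s^-1%g k) != 0 by rewrite -{1}(permKV s k) mono_neq0.
apply/idP/eqP => [g0|ik].
  have : gmx g^-1%g i k * gmx g k (s^-1%g k) != 0 by rewrite mulf_neq0.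
  by rewrite e mxE; case: (eqVneq i) => // _; rewrite eqxx.
by move: e; rewrite mxE ik eqxx => e; apply: contra_eq_neq e => ->; rewrite mul0r eq_sym oner_eq0.
Qed.

Lemma Mon_Borel g : g \in Mon -> g \in Borel Fq m -> g \in Torus Fq m.
Proof.
case/MonP=> gS [s sg] gB; rewrite mono_Hgrp gS /=.
by rewrite -(mono_Borel sg gB).
Qed.

Lemma group_set_Torus : group_set (Torus Fq m).
Proof.
apply/group_setP; split; first by rewrite mono_Hgrp mono1 andbT; apply: group1.
move=> g h; rewrite !mono_Hgrp => /andP[gS g1] /andP[hS h1].
by rewrite Sp_mul //= -[1%g](mulg1 1%g) monoM.
Qed.
Canonical Torus_group := Group group_set_Torus.

Lemma Torus_inv g : g \in Torus Fq m -> g^-1%g \in Torus Fq m.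
Proof. exact: (group_set_inv group_set_Torus). Qed.

Lemma Torus_Mon g : g \in Torus Fq m -> g \in Mon.
Proof. by rewrite mono_Hgrp => /andP[gS g1]; apply/MonP; split=> //; exists 1%g. Qed.

Lemma Torus_conj g h : g \in Mon -> h \in Torus Fq m -> (g^-1 * h * g)%g \in Torus Fq m.
Proof.
case/MonP=> gS [s sg]; rewrite !mono_Hgrp => /andP[hS h1].
rewrite !Sp_mul ?Sp_inv //=.
have := monoM (monoM (monoV sg) h1) sg.
by rewrite mul1g mulgV.
Qed.

Lemma Mon_norm : Mon \subset 'N(Torus Fq m)%g.
Proof.
apply/subsetP => g gM; rewrite inE; apply/subsetP => x /imsetP[h hH ->].
by rewrite conjgE mulgA Torus_conj.
Qed.

Section Sign.
Variable F : fieldType.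

(** The action on the reflection representation, of basis [x_1, .., x_n], when the
    indices of [u_j] and [v_j] stand for [x_j] and [- x_j]. *)
Definition refl_mx s : 'M[F]_n := \matrix_(i, j)
  ((lshift n i == s (lshift n j))%:R - (lshift n i == s (rshift n j))%:R).

(** The determinant in the reflection representation, read off from the nonzero
    entries of a monomial matrix: the sign character of the Weyl group. *)
Definition sgn g : F := \det (\matrix_(i, j < n)
  ((gmx g (lshift n i) (lshift n j) != 0)%:R - (gmx g (lshift n i) (rshift n j) != 0)%:R)).

Lemma sgn_mono s g : is_mono s g -> sgn g = \det (refl_mx s).
Proof.
by move/monoP => sg; congr (\det _); apply/matrixP => i j; rewrite !mxE !sg.
Qed.

Lemma refl_mxM s t : (forall j, s (tau j) = tau (s j)) -> (forall j, t (tau j) = tau (t j)) ->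
  refl_mx (t * s)%g = refl_mx s *m refl_mx t.
Proof.
move=> ss tt; apply/matrixP => i k; rewrite !mxE !permM.
have tr : t (rshift n k) = tau (t (lshift n k)) by rewrite -tt tau_l.
case: (split_ordP (t (lshift n k))) => j0 tl.
  rewrite tr tl tau_l (bigD1 j0) //= big1 => [|j jj]; rewrite !mxE tr tl tau_l.
    by rewrite eqxx eq_lrshift subr0 mulr1 addr0.
  by rewrite eq_lshift (negPf jj) eq_lrshift subrr mulr0.
rewrite tr tl tau_r (bigD1 j0) //= big1 => [|j jj]; rewrite !mxE tr tl tau_r.
  by rewrite eqxx eq_lrshift sub0r mulrN1 opprB addr0.
by rewrite eq_lshift (negPf jj) eq_lrshift subrr mulr0.
Qed.

Lemma sgnM g h : g \in Mon -> h \in Mon -> sgn (g * h)%g = sgn g * sgn h.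
Proof.
case/MonP=> gS [s sg] /MonP[hS [t th]].
rewrite (sgn_mono (monoM sg th)) refl_mxM ?det_mulmx; [|exact: mono_tau sg|exact: mono_tau th].
by rewrite (sgn_mono sg) (sgn_mono th).
Qed.

Lemma refl_mx1 : refl_mx 1%g = 1%:M.
Proof.
by apply/matrixP => i j; rewrite !mxE !perm1 eq_lshift eq_lrshift subr0.
Qed.

Lemma sgn_Torus h : h \in Torus Fq m -> sgn h = 1.
Proof. by rewrite mono_Hgrp => /andP[_ /sgn_mono ->]; rewrite refl_mx1 det1. Qed.

End Sign.
End Monomial.

(** * Permutations and reflections of the symplectic basis *)

Section Generators.
Variables (Fq : finFieldType) (m : nat).
Local Notation n := m.+1.
Local Notation gT := (GLn Fq m).
Implicit Types (g h : gT) (D : 'M[Fq]_n) (s t : 'S_(n + n)) (S T : {set 'I_n}).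

Lemma ubE i : ub Fq i = delta_mx (lshift n i) 0.
Proof.
apply/colP => k; rewrite /ub; case: (split_ordP k) => j ->.
  by rewrite col_mxEu !mxE eq_lshift.
by rewrite col_mxEd !mxE eq_rlshift.
Qed.

Lemma vbE i : vb Fq i = delta_mx (rshift n i) 0.
Proof.
apply/colP => k; rewrite /vb; case: (split_ordP k) => j ->.
  by rewrite col_mxEu !mxE eq_lrshift.
by rewrite col_mxEd !mxE eq_rshift.
Qed.

Lemma vact_ub g i k : vact g (ub Fq i) k 0 = gmx g k (lshift n i).
Proof. by rewrite ubE /vact -colE mxE. Qed.

Lemma vact_vb g i k : vact g (vb Fq i) k 0 = gmx g k (rshift n i).
Proof. by rewrite vbE /vact -colE mxE. Qed.

Lemma vactM g h x : vact (g * h)%g x = vact g (vact h x).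
Proof. by rewrite /vact mxM mulmxA. Qed.

Lemma vactN g x : vact g (- x) = - vact g x.
Proof. by rewrite /vact mulmxN. Qed.

Lemma vact_inj g h : (forall i, vact g (ub Fq i) = vact h (ub Fq i)) ->
  (forall i, vact g (vb Fq i) = vact h (vb Fq i)) -> g = h.
Proof.
move=> eu ev; apply: mx_inj; apply/matrixP => k l.
by case: (split_ordP l) => i ->; rewrite -?vact_ub -?vact_vb ?eu ?ev.
Qed.

(** Permutations acting simultaneously on the [u_i] and on the [v_i]. *)
Definition pel (s : 'S_n) : gT := emb (perm_mx s).

Lemma mx_pel (s : 'S_n) : gmx (pel s) = block_mx (perm_mx s) 0 0 (perm_mx s).
Proof.
rewrite mx_emb ?unitmx_perm //; congr block_mx.
have -> : invmx (perm_mx s) = perm_mx s^-1 :> 'M[Fq]_n.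
  rewrite -[RHS](mulKmx (unitmx_perm Fq s)) -perm_mxM mulgV perm_mx1 mulmx1.
  by [].
by rewrite tr_perm_mx invgK.
Qed.

Lemma pel_ub (s : 'S_n) j : vact (pel s) (ub Fq j) = ub Fq (s^-1%g j).
Proof.
rewrite /ub vact_col mx_pel block_mxKul block_mxKur block_mxKdl block_mxKdr.
rewrite !mulmx0 mul0mx !addr0 -colE; congr col_mx; apply/colP => i.
by rewrite !mxE (can2_eq (permK s) (permKV s)) andbT.
Qed.

Lemma pel_vb (s : 'S_n) j : vact (pel s) (vb Fq j) = vb Fq (s^-1%g j).
Proof.
rewrite /vb vact_col mx_pel block_mxKul block_mxKur block_mxKdl block_mxKdr.
rewrite !mulmx0 mul0mx !add0r -colE; congr col_mx; apply/colP => i.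
by rewrite !mxE (can2_eq (permK s) (permKV s)) andbT.
Qed.

Definition dbl (s : 'S_n) (k : 'I_(n + n)) : 'I_(n + n) :=
  match split k with inl j => lshift n (s j) | inr j => rshift n (s j) end.

Lemma dbl_inj (s : 'S_n) : injective (dbl s).
Proof.
move=> k l; rewrite /dbl.
case: (split_ordP k) => i ->; case: (split_ordP l) => j ->.
- by move/lshift_inj/perm_inj ->.
- by move/eqP; rewrite eq_lrshift.
- by move/eqP; rewrite eq_rlshift.
- by move/rshift_inj/perm_inj ->.
Qed.

Definition dbl_perm (s : 'S_n) : 'S_(n + n) := perm (@dbl_inj s).

Lemma dbl_l (s : 'S_n) j : dbl_perm s (lshift n j) = lshift n (s j).
Proof. by rewrite permE /dbl (unsplitK (inl j)). Qed.

Lemma dbl_r (s : 'S_n) j : dbl_perm s (rshift n j) = rshift n (s j).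
Proof. by rewrite permE /dbl (unsplitK (inr j)). Qed.

Lemma pel_mono (s : 'S_n) : is_mono (dbl_perm s^-1%g) (pel s).
Proof.
have bool0 (b : bool) : (b%:R != 0 :> Fq) = b by case: b; rewrite ?oner_eq0 ?eqxx.
apply/monoP => i j; rewrite mx_pel; case: (split_ordP j) => k ->.
  rewrite dbl_l; case: (split_ordP i) => k' ->.
    by rewrite block_mxEul !mxE bool0 eq_lshift (can2_eq (permK s) (permKV s)).
  by rewrite block_mxEdl mxE eqxx eq_rlshift.
rewrite dbl_r; case: (split_ordP i) => k' ->.
  by rewrite block_mxEur mxE eqxx eq_lrshift.
by rewrite block_mxEdr !mxE bool0 eq_rshift (can2_eq (permK s) (permKV s)).
Qed.

Lemma pel_Mon (s : 'S_n) : pel s \in Mon Fq m.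
Proof.
by apply/MonP; split; [rewrite emb_Sp ?unitmx_perm | exists (dbl_perm s^-1%g); apply: pel_mono].
Qed.

Lemma pelM (s t : 'S_n) : pel (s * t)%g = (pel s * pel t)%g.
Proof. by rewrite /pel perm_mxM embM ?unitmx_perm. Qed.

Lemma sgn_pel (F : fieldType) (s : 'S_n) : sgn F (pel s) = (-1) ^+ s.
Proof.
rewrite -det_perm; congr (\det _); apply/matrixP => i j.
rewrite !mxE mx_pel block_mxEul block_mxEur !mxE eqxx subr0.
by case: (s i == j); rewrite ?oner_eq0 ?eqxx.
Qed.

Definition adj (i : 'I_m) : 'S_n := tperm (widen_ord (leqnSn m) i) (lift ord0 i).

Lemma is_wP i g : is_w i g -> g = pel (adj i).
Proof.
move/forallP => gw; apply: vact_inj => j; have /andP[/eqP eu /eqP ev] := gw j.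
  by rewrite -gact_vact eu pel_ub tpermV.
by rewrite -gact_vact ev pel_vb tpermV.
Qed.

Lemma is_w_pel i : is_w i (pel (adj i)).
Proof.
apply/forallP => j; rewrite !gact_vact pel_ub pel_vb tpermV.
by rewrite !eqxx.
Qed.

(** The product of the reflections [c_j] for [j] in [S]. *)
Definition cel S : gT := toGL
  (block_mx (diag_mx (\row_i (i \notin S)%:R)) (- diag_mx (\row_i (i \in S)%:R))
            (diag_mx (\row_i (i \in S)%:R)) (diag_mx (\row_i (i \notin S)%:R))).

Lemma diag_mx_bool (P Q : pred 'I_n) :
  diag_mx (\row_i (P i)%:R) *m diag_mx (\row_i (Q i)%:R) =
  diag_mx (\row_i (P i && Q i)%:R) :> 'M[Fq]_n.
Proof.
by rewrite mulmx_diag; congr diag_mx; apply/rowP => i; rewrite !mxE -natrM mulnb.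
Qed.

Lemma diag_mx_bool_split (P : pred 'I_n) :
  diag_mx (\row_i (P i)%:R) + diag_mx (\row_i (~~ P i)%:R) = 1%:M :> 'M[Fq]_n.
Proof.
by apply/matrixP => i j; rewrite !mxE; case: (P i); case: (i == j); rewrite ?addr0 ?add0r ?mul0rn.
Qed.

Lemma diag_mx_bool0 : diag_mx (\row_i false%:R) = 0 :> 'M[Fq]_n.
Proof. by apply/matrixP => i j; rewrite !mxE mul0rn. Qed.

Lemma cel_mxK S (A := diag_mx (\row_i (i \notin S)%:R) : 'M[Fq]_n)
    (B := diag_mx (\row_i (i \in S)%:R) : 'M[Fq]_n) :
  [/\ A *m A = A, B *m B = B, A *m B = 0, B *m A = 0 & A + B = 1%:M].
Proof.
rewrite /A /B !diag_mx_bool; split.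
- by congr diag_mx; apply/rowP => i; rewrite !mxE andbb.
- by congr diag_mx; apply/rowP => i; rewrite !mxE andbb.
- by rewrite -diag_mx_bool0; congr diag_mx; apply/rowP => i; rewrite !mxE andNb.
- by rewrite -diag_mx_bool0; congr diag_mx; apply/rowP => i; rewrite !mxE andbN.
- by rewrite addrC; apply: (diag_mx_bool_split [in S]).
Qed.

Lemma mx_cel S : gmx (cel S) =
  block_mx (diag_mx (\row_i (i \notin S)%:R)) (- diag_mx (\row_i (i \in S)%:R))
           (diag_mx (\row_i (i \in S)%:R)) (diag_mx (\row_i (i \notin S)%:R)).
Proof.
apply: mx_toGL; have [] := cel_mxK S.
move: (diag_mx _) (diag_mx _) => B A AA BB AB BA AB1.
suff /mulmx1_unit[] : block_mx A (- B) B A *m block_mx A B (- B) A = 1%:M by [].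
rewrite mulmx_block !mulmxN !mulNmx opprK AA BB AB BA ?oppr0 ?addr0 [B + A]addrC AB1.
by rewrite ?addNr ?subrr -scalar_mx_block.
Qed.

Lemma cel_Sp S : cel S \in SpG Fq m.
Proof.
apply/in_SpP; rewrite mx_cel tr_block_mx linearN /= !tr_diag_mx.
have [] := cel_mxK S.
move: (diag_mx _) (diag_mx _) => B A AA BB AB BA AB1.
rewrite /Jmx !mulmx_block !mulmx0 !mulmxN !mulmx1 !addr0 !add0r.
rewrite ?mulNmx ?mulmxN ?opprK AA BB AB BA.
by rewrite ?oppr0 ?addr0 -?opprD [B + A]addrC AB1 ?addr0 ?subrr.
Qed.

Lemma cel_ub S j : vact (cel S) (ub Fq j) = if j \in S then vb Fq j else ub Fq j.
Proof.
rewrite {1}/ub vact_col mx_cel block_mxKul block_mxKur block_mxKdl block_mxKdr.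
rewrite !mulmx0 !addr0 !mul_diag_mx.
have [jS|jS] := boolP (j \in S); rewrite /ub /vb; congr col_mx; apply/colP => i;
  rewrite !mxE; case: eqP => [->|_]; by rewrite ?jS ?(negPf jS) ?mulr0 ?mulr1 ?mul0r ?mul1r.
Qed.

Lemma cel_vb S j : vact (cel S) (vb Fq j) = if j \in S then - ub Fq j else vb Fq j.
Proof.
rewrite {1}/vb vact_col mx_cel block_mxKul block_mxKur block_mxKdl block_mxKdr.
rewrite !mulmx0 !add0r mulNmx !mul_diag_mx.
have [jS|jS] := boolP (j \in S); rewrite /ub /vb ?opp_col_mx; congr col_mx; apply/colP => i;
  rewrite !mxE; case: eqP => [->|_]; by rewrite ?jS ?(negPf jS) ?mulr0 ?mulr1 ?mul0r ?mul1r ?oppr0.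
Qed.

Definition cel_fun S (k : 'I_(n + n)) : 'I_(n + n) :=
  match split k with
  | inl j => if j \in S then rshift n j else lshift n j
  | inr j => if j \in S then lshift n j else rshift n j
  end.

Lemma cel_funK S : involutive (cel_fun S).
Proof.
move=> k; rewrite /cel_fun; case: (split_ordP k) => j ->; have [jS|jS] := boolP (j \in S).
- by rewrite (unsplitK (inr j)) jS.
- by rewrite (unsplitK (inl j)) (negPf jS).
- by rewrite (unsplitK (inl j)) jS.
- by rewrite (unsplitK (inr j)) (negPf jS).
Qed.

Definition cel_perm S := perm (inv_inj (@cel_funK S)).

Lemma cel_mono S : is_mono (cel_perm S) (cel S).
Proof.
apply/monoP => k l; rewrite permE /cel_fun; case: (split_ordP l) => j ->.
  rewrite -vact_ub cel_ub ubE vbE.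
  by case: ifP => _; rewrite mxE andbT; case: (k == _); rewrite ?oner_eq0 ?eqxx.
rewrite -vact_vb cel_vb ubE vbE.
by case: ifP => _; rewrite !mxE andbT; case: (k == _); rewrite ?oppr_eq0 ?oner_eq0 ?eqxx.
Qed.

Lemma cel_Mon S : cel S \in Mon Fq m.
Proof. by apply/MonP; split; [apply: cel_Sp | exists (cel_perm S); apply: cel_mono]. Qed.

Lemma is_cP j g : is_c j g -> g = cel [set j].
Proof.
move/forallP => gc; apply: vact_inj => i; rewrite ?cel_ub ?cel_vb in_set1;
  have := gc i; rewrite !gact_vact; case: eqP => [->|_] /andP[/eqP eu /eqP ev] //.
Qed.

Lemma is_c_cel j : is_c j (cel [set j]).
Proof.
apply/forallP => i; rewrite !gact_vact cel_ub cel_vb in_set1.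
by case: eqP => _; rewrite !eqxx.
Qed.

Lemma sgn_cel1 (F : fieldType) j : sgn F (cel [set j]) = -1.
Proof.
rewrite (sgn_mono _ (cel_mono _)).
suff -> : refl_mx F (cel_perm [set j]) = diag_mx (\row_i (if i == j then -1 else 1)).
  rewrite det_diag (bigD1 j) //= big1 => [|i /negPf ij]; rewrite mxE ?eqxx ?mulr1 //.
  by rewrite ij.
apply/matrixP => i k; rewrite !mxE !permE /cel_fun (unsplitK (inl k)) (unsplitK (inr k)).
rewrite in_set1 [k == j]eq_sym; have [->|ij] := eqVneq j k.
  rewrite eq_lshift eq_lrshift sub0r; case: (eqVneq i k); rewrite ?mulr1n ?mulr0n ?oppr0 //.
rewrite eq_lshift eq_lrshift subr0; case: (eqVneq i k) => [->|]; rewrite ?mulr1n ?mulr0n //.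
by rewrite eq_sym (negPf ij).
Qed.

Lemma celU S T : [disjoint S & T] -> cel (S :|: T) = (cel S * cel T)%g.
Proof.
move=> dST; have nST i : i \in T -> (i \in S) = false.
  by move=> iT; apply: (disjointFl dST iT).
apply: vact_inj => i; rewrite vactM.
  rewrite !cel_ub in_setU; have [iT|iT] := boolP (i \in T).
    by rewrite orbT cel_vb nST.
  by rewrite orbF cel_ub.
rewrite !cel_vb in_setU; have [iT|iT] := boolP (i \in T).
  by rewrite orbT vactN cel_ub nST.
by rewrite orbF cel_vb.
Qed.

Lemma cel0 : cel set0 = 1%g.
Proof.
by apply: vact_inj => i; rewrite ?cel_ub ?cel_vb inE /vact mx1 mul1mx.
Qed.

Lemma adj_cel (i : 'I_m) : (pel (adj i) * cel [set lift ord0 i] * pel (adj i))%g =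
  cel [set widen_ord (leqnSn m) i].
Proof.
have e j : (adj i j == lift ord0 i) = (j == widen_ord (leqnSn m) i).
  by rewrite -(inj_eq (@perm_inj _ (adj i))) tpermK tpermR.
apply: vact_inj => j; rewrite !vactM.
  rewrite pel_ub tpermV !cel_ub !in_set1 e.
  by case: eqP => _; rewrite (pel_ub, pel_vb) tpermV tpermK.
rewrite pel_vb tpermV !cel_vb !in_set1 e.
by case: eqP => _; rewrite ?vactN (pel_ub, pel_vb) tpermV tpermK.
Qed.

End Generators.

(** * The Weyl group and the parity of lengths *)

Lemma conj_divr (G : finGroupType) (g h : G) : (g^-1 * (g * h^-1)^-1 * g = g^-1 * h)%g.
Proof. by rewrite invMg invgK mulgA mulgKV. Qed.

Lemma conj_divl (G : finGroupType) (g h : G) :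
  ((g^-1)^-1 * (g^-1 * h)^-1 * g^-1 = g * h^-1)%g.
Proof. by rewrite invMg !invgK mulgA mulgK. Qed.

Section WeylGroup.
Variables (Fq : finFieldType) (m : nat).
Local Notation n := m.+1.
Local Notation gT := (GLn Fq m).
Implicit Types (g h : gT) (S T : {set 'I_n}).

(** The group [W_2], which lifts the Weyl group. *)
Definition WeylLift : {set gT} := W2 Fq m.

Definition simple_refl : {set gT} :=
  [set g | [exists i : 'I_m, g == pel Fq (adj i)] || (g == cel Fq [set ord_max])].

Lemma WeylLiftE : WeylLift = <<[set g : gT | [exists i, is_w i g] || [exists j, is_c j g]]>>%g.
Proof. by []. Qed.

Lemma pel_simple i : pel Fq (adj i) \in simple_refl.
Proof. by rewrite inE; apply/orP; left; apply/existsP; exists i. Qed.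

(** As [w_j] conjugates [c_{j+1}] to [c_j], the single reflection [c_n] yields all
    the [c_j]. *)
Lemma cel_gen j : cel Fq [set j] \in <<simple_refl>>%g.
Proof.
have [k] := ubnP (m - j); elim: k j => // k IH j; rewrite ltnS => jk.
have [jm|jm] := ltnP j m; last first.
  have -> : j = ord_max by apply: val_inj; have := ltn_ord j; move=> /= ?; lia.
  by apply: mem_gen; rewrite inE eqxx orbT.
pose i := Ordinal jm.
have -> : j = widen_ord (leqnSn m) i by apply: val_inj.
have pi : pel Fq (adj i) \in <<simple_refl>>%g by rewrite mem_gen ?pel_simple.
have ci : cel Fq [set lift ord0 i] \in <<simple_refl>>%g.
  by apply: IH; rewrite /= /bump /=; lia.
by rewrite -adj_cel; apply: groupM => //; apply: groupM.
Qed.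

Lemma WeylLift_simple : WeylLift = <<simple_refl>>%g.
Proof.
rewrite WeylLiftE; apply/eqP; rewrite eqEsubset !gen_subG; apply/andP; split; apply/subsetP => g.
  rewrite inE => /orP[/existsP[i /is_wP ->]|/existsP[j /is_cP ->]]; last exact: cel_gen.
  by rewrite mem_gen ?pel_simple.
rewrite inE => /orP[/existsP[i /eqP ->]|/eqP ->]; apply: mem_gen; rewrite inE; apply/orP.
  by left; apply/existsP; exists i; apply: is_w_pel.
by right; apply/existsP; exists ord_max; apply: is_c_cel.
Qed.

Lemma WeylLift_mul g h : g \in WeylLift -> h \in WeylLift -> (g * h)%g \in WeylLift.
Proof. by rewrite WeylLiftE; apply: groupM. Qed.

Lemma WeylLift_inv g : g \in WeylLift -> g^-1%g \in WeylLift.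
Proof. by rewrite WeylLiftE groupV. Qed.

Lemma pel_WeylLift i : pel Fq (adj i) \in WeylLift.
Proof. by rewrite WeylLift_simple mem_gen ?pel_simple. Qed.

Lemma cel_WeylLift S : cel Fq S \in WeylLift.
Proof.
have [k] := ubnP #|S|; elim: k S => // k IH S; rewrite ltnS.
have [->|[j jS]] := set_0Vmem S; first by rewrite cel0 WeylLift_simple group1.
rewrite (cardsD1 j) jS -(setD1K jS) celU => [kS|]; last first.
  by rewrite disjoints1 !inE eqxx.
apply: WeylLift_mul; first by rewrite WeylLift_simple cel_gen.
by apply: IH; move: kS; rewrite setD1K.
Qed.

Lemma simple_Mon g : g \in simple_refl -> g \in Mon Fq m.
Proof.
by rewrite inE => /orP[/existsP[i /eqP ->]|/eqP ->]; [apply: pel_Mon | apply: cel_Mon].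
Qed.

Lemma WeylLift_Mon g : g \in WeylLift -> g \in Mon Fq m.
Proof.
have /subsetP : WeylLift \subset Mon_group Fq m.
  by rewrite WeylLift_simple gen_subG; apply/subsetP => h; apply: simple_Mon.
exact.
Qed.

Definition WeylG : {set coset_of (Torus Fq m)} := Weyl Fq m.
Definition simple_cosets : {set coset_of (Torus Fq m)} :=
  [set coset (Torus Fq m) g | g in simple_refl].
Definition len (w : coset_of (Torus Fq m)) : nat := Weyl_length w.

Lemma simple_cosetsE : simple_cosets = Weyl_gens Fq m.
Proof.
apply/setP => w; apply/imsetP/imsetP => -[g gS ->]; exists g => //; move: gS; rewrite !inE.
  case/orP=> [/existsP[i /eqP ->]|/eqP ->]; apply/orP; [left|right; apply: is_c_cel].
  by apply/existsP; exists i; apply: is_w_pel.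
case/orP=> [/existsP[i /is_wP ->]|/is_cP ->]; apply/orP; [left|by right].
by apply/existsP; exists i.
Qed.

Lemma lenE w : len w = find (fun k => w \in (simple_cosets ^+ k)%g) (iota 0 #|WeylG|).
Proof. by rewrite simple_cosetsE. Qed.

Lemma WeylE : WeylG = [set coset (Torus Fq m) g | g in WeylLift].
Proof.
have -> : WeylG = (WeylLift * Torus Fq m / Torus Fq m)%g by [].
have nW : WeylLift \subset 'N(Torus Fq m)%g.
  by apply: subset_trans (Mon_norm Fq m); apply/subsetP => g; apply: WeylLift_Mon.
rewrite (quotientMidr (Torus_group Fq m)) /quotient /morphim /= (setIidPr nW).
by [].
Qed.

Lemma coset_eq g h : g \in Mon Fq m -> h \in Mon Fq m ->
  (coset (Torus Fq m) g == coset (Torus Fq m) h) = ((g^-1 * h)%g \in Torus Fq m).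
Proof.
move=> gM hM; have /subsetP nM := Mon_norm Fq m.
have /= P := @rcoset_kercosetP _ (Torus_group Fq m) _ _ (nM _ gM) (nM _ hM).
apply/eqP/idP => [/P | gh].
  rewrite mem_rcoset => ghH; have := Torus_conj gM (Torus_inv ghH).
  by rewrite conj_divr.
apply/P; rewrite mem_rcoset; have := Torus_conj (Mon_inv gM) (Torus_inv gh).
by rewrite conj_divl.
Qed.

(** Each simple reflection has sign [-1], so the sign is the parity of the length. *)
Lemma sgn_word (F : fieldType) k w : w \in (simple_cosets ^+ k)%g ->
  exists g, [/\ g \in WeylLift, coset (Torus Fq m) g = w & sgn F g = (-1) ^+ k].
Proof.
elim: k w => [|k IH] w.
  have Torus1 : 1%g \in Torus Fq m := group1 (Torus_group Fq m).
  rewrite expg0 inE => /eqP ->; exists 1%g; split; last by rewrite sgn_Torus.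
    by rewrite WeylLiftE group1.
  by rewrite coset_id.
rewrite expgS => /mulsgP[_ w' /imsetP[g gS ->] /IH[h [hW <- hk]] ->].
have gW : g \in WeylLift by rewrite WeylLift_simple mem_gen.
exists (g * h)%g; split; first exact: WeylLift_mul.
  have /subsetP nM := Mon_norm Fq m.
  by rewrite (@morphM _ _ _ (coset_morphism (Torus_group Fq m))) // nM ?WeylLift_Mon.
rewrite sgnM ?WeylLift_Mon // hk exprS; congr (_ * _).
move: gS; rewrite inE => /orP[/existsP[i /eqP ->]|/eqP ->]; last by rewrite sgn_cel1.
by rewrite sgn_pel odd_tperm; case: eqP => // /(congr1 val) /=; rewrite /bump; lia.
Qed.

(** The search defining the length succeeds below the order of the Weyl group by
    [short_word], so the length is the length of an actual word. *)
Lemma len_sgn (F : fieldType) g : g \in WeylLift ->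
  (-1) ^+ len (coset (Torus Fq m) g) = sgn F g.
Proof.
move=> gW; set w := coset _ g.
have wW : w \in WeylG by rewrite WeylE imset_f.
suff wl : w \in (simple_cosets ^+ len w)%g.
  have [h [hW hw <-]] := sgn_word F wl.
  have hg : (h^-1 * g)%g \in Torus Fq m by rewrite -coset_eq ?WeylLift_Mon // hw.
  by rewrite -[in RHS](mulKVg h g) (sgnM _ _ (Torus_Mon hg)) ?WeylLift_Mon // (sgn_Torus F hg) mulr1.
rewrite lenE; set P := (fun k => _); set s := iota _ _.
have hP : has P s.
  have WeylGE : WeylG = (WeylLift / Torus Fq m)%g.
    rewrite WeylE /quotient /morphim /= (setIidPr _) //.
    by apply: subset_trans (Mon_norm Fq m); apply/subsetP => h; apply: WeylLift_Mon.
  have : w \in <<simple_cosets>>%g.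
    have : w \in (<<simple_refl>> / Torus Fq m)%g by rewrite -WeylLift_simple -WeylGE.
    rewrite (quotient_gen (H := Torus_group Fq m)).
      by rewrite /quotient /morphim /= (setIidPr _) //;
         apply: subset_trans (Mon_norm Fq m); apply/subsetP => h; apply: simple_Mon.
    by apply: subset_trans (Mon_norm Fq m); apply/subsetP => h; apply: simple_Mon.
  case/gen_word => k wk.
  have [|j jW wj] := @short_word _ _ (<<simple_refl>> / Torus_group Fq m)%G k w _ wk.
    apply/subsetP => _ /imsetP[h hS ->]; apply: mem_quotient; exact: mem_gen.
  apply/hasP; exists j => //; rewrite mem_iota /= add0n.
  by rewrite WeylGE WeylLift_simple.
have := nth_find 0%N hP; rewrite nth_iota //.
by move: hP; rewrite has_find size_iota.
Qed.

End WeylGroup.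

(** * The Steinberg element as a function on the group *)

Section PairMatrices.
Variables (R : fieldType) (n : nat) (a b : 'I_n).
Hypothesis ab : a != b.
Implicit Types x y z t : R.

(** The matrix acting as a given 2 x 2 matrix on the coordinates [a] and [b]. *)
Definition pair_mx x y z t : 'M[R]_n :=
  1%:M + (x - 1) *: delta_mx a a + y *: delta_mx a b + z *: delta_mx b a
       + (t - 1) *: delta_mx b b.

Lemma pair_mxM x y z t x' y' z' t' :
  pair_mx x y z t *m pair_mx x' y' z' t' =
  pair_mx (x * x' + y * z') (x * y' + y * t') (z * x' + t * z') (z * y' + t * t').
Proof.
have ba : b != a by rewrite eq_sym.
rewrite /pair_mx !mulmxDl !mulmxDr !mul1mx !mulmx1 -!scalemxAl -!scalemxAr.
rewrite !mul_delta_mx_cond !eqxx (negPf ab) (negPf ba) !mulr1n !mulr0n !scaler0 ?addr0 ?add0r.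
by apply/matrixP => i j; rewrite !mxE; ring.
Qed.

Lemma pair_mx1 : pair_mx 1 0 0 1 = 1%:M.
Proof. by rewrite /pair_mx subrr !scale0r !addr0. Qed.

Lemma pair_mx_unit x y z t : x * t - y * z != 0 -> pair_mx x y z t \in unitmx.
Proof.
set d := x * t - y * z => d0.
suff /mulmx1_unit[] : pair_mx x y z t *m pair_mx (t / d) (- y / d) (- z / d) (x / d) = 1%:M by [].
rewrite pair_mxM -pair_mx1.
by congr pair_mx; rewrite /d; field.
Qed.

Lemma pair_mx_tperm : pair_mx 0 1 1 0 = perm_mx (tperm a b).
Proof.
have ba : b != a by rewrite eq_sym.
apply/matrixP => i j; rewrite !mxE.
case: tpermP => [->|->|/eqP/negPf -> /eqP/negPf ->] /=.
- by rewrite eqxx (negPf ab) (eq_sym b j) (eq_sym a j) /=; case: (j == a); case: (j == b) => /=; ring.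
- by rewrite eqxx (negPf ba) (eq_sym b j) (eq_sym a j) /=; case: (j == a); case: (j == b) => /=; ring.
- by ring.
Qed.

Definition low_mx t := pair_mx 1 0 t 1.
Definition torus_mx x t := pair_mx x 0 0 t.
Definition swap_mx : 'M[R]_n := perm_mx (tperm a b).

Lemma low_mx_unit t : low_mx t \in unitmx.
Proof. by apply: pair_mx_unit; rewrite mul0r subr0 mulr1 oner_eq0. Qed.

Lemma torus_mx_unit x t : x != 0 -> t != 0 -> torus_mx x t \in unitmx.
Proof. by move=> x0 t0; apply: pair_mx_unit; rewrite mul0r subr0 mulf_neq0. Qed.

Lemma swap_mx_unit : swap_mx \in unitmx.
Proof. exact: unitmx_perm. Qed.

Lemma low_mxM t u : low_mx t *m low_mx u = low_mx (t + u).
Proof. by rewrite pair_mxM; congr pair_mx; ring. Qed.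

Lemma low_mx0 : low_mx 0 = 1%:M.
Proof. exact: pair_mx1. Qed.

Lemma invmx_low t : invmx (low_mx t) = low_mx (- t).
Proof.
by rewrite -[RHS](mulKmx (low_mx_unit t)) low_mxM subrr low_mx0 mulmx1.
Qed.

Lemma low_mx_torus x t u : t != 0 ->
  low_mx u *m torus_mx x t = torus_mx x t *m low_mx (x * u / t).
Proof. by move=> t0; rewrite !pair_mxM; congr pair_mx; field. Qed.

(** The relation of SL_2 that moves a lower unipotent matrix into the big cell. *)
Lemma swap_low_swap t : t != 0 ->
  swap_mx *m low_mx t *m swap_mx =
  low_mx t^-1 *m torus_mx t (- t^-1) *m (swap_mx *m low_mx t^-1).
Proof. by move=> t0; rewrite /swap_mx -pair_mx_tperm !pair_mxM; congr pair_mx; field. Qed.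

End PairMatrices.

Lemma ga_leftE (G : finGroupType) (F : fieldType) (g : G) (x : group_algebra G F) k :
  ga_left g x k = x (g^-1 * k)%g.
Proof.
rewrite /ga_left /ga_mul ffunE (bigD1 g) //= big1 => [|h /negPf hg].
  by rewrite ffunE eqxx mul1r addr0.
by rewrite ffunE hg mul0r.
Qed.

Lemma mulVg_conj (G : finGroupType) (a h x : G) :
  (a^-1 * x = (a^-1 * h * a)^-1 * (a^-1 * (h * x)))%g.
Proof. by rewrite !invMg invgK !mulgA mulgK mulgKV. Qed.

(* From here on the group law of [GLn] is used only through its axioms. *)
Opaque GLn emb toGL.

Section SteinbergElement.
Variables (Fq : finFieldType) (F : fieldType) (m : nat).
Local Notation n := m.+1.
Local Notation gT := (GLn Fq m).
Local Notation GA := (group_algebra gT F).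
Variable nw : coset_of (Torus Fq m) -> gT.
Hypothesis nwP : forall w, w \in WeylG Fq m -> nw w \in WeylLift Fq m /\ coset (Torus Fq m) (nw w) = w.
Implicit Types (g h x y : gT).

(** A signed sum of indicator functions of cosets [n_w B]. *)
Definition est : GA :=
  [ffun x => \sum_(w in WeylG Fq m) (-1) ^+ len w * (((nw w)^-1 * x)%g \in Borel Fq m)%:R].

Lemma estE a c : a \in WeylLift Fq m -> c \in Borel Fq m -> est (a * c)%g = sgn F a.
Proof.
move=> aW cB; rewrite ffunE -(len_sgn F aW).
have aG : coset (Torus Fq m) a \in WeylG Fq m by rewrite WeylE imset_f.
rewrite (bigD1 (coset (Torus Fq m) a)) //= big1 ?addr0 => [|w /andP[wG wa]].
  have [nW nE] := nwP aG; rewrite mulgA Borel_mul ?mulr1 // Hgrp_Borel //.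
  by rewrite -coset_eq ?WeylLift_Mon // nE.
have [nW nE] := nwP wG; have [nB|] := boolP (_ \in Borel Fq m); last by rewrite mulr0.
case/negP: wa; rewrite -nE coset_eq ?WeylLift_Mon // Mon_Borel //.
  by rewrite Mon_mul ?Mon_inv ?WeylLift_Mon.
by rewrite -[X in X \in _](mulgK c) Borel_mul ?Borel_inv // -mulgA.
Qed.

Lemma est_out x : (forall a, a \in WeylLift Fq m -> (a^-1 * x)%g \notin Borel Fq m) -> est x = 0.
Proof.
move=> xW; rewrite ffunE big1 // => w /nwP[nW _].
by rewrite (negPf (xW _ nW)) mulr0.
Qed.

Lemma est_cases x : (exists a c, [/\ a \in WeylLift Fq m, c \in Borel Fq m & x = (a * c)%g]) \/
  (forall a, a \in WeylLift Fq m -> (a^-1 * x)%g \notin Borel Fq m).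
Proof.
have [/existsP[a /andP[aW aB]]|/existsPn nx] :=
  boolP [exists a, (a \in WeylLift Fq m) && ((a^-1 * x)%g \in Borel Fq m)].
  by left; exists a, (a^-1 * x)%g; rewrite mulKVg.
by right=> a aW; have := nx a; rewrite aW.
Qed.

Lemma est_Borel x c : c \in Borel Fq m -> est (x * c)%g = est x.
Proof.
move=> cB; rewrite !ffunE; apply: eq_bigr => w _; congr (_ * _%:R).
congr nat_of_bool; rewrite mulgA; apply/idP/idP => xB; last exact: Borel_mul.
by rewrite -[X in X \in _](mulgK c) Borel_mul ?Borel_inv.
Qed.

Lemma est_WeylLift a x : a \in WeylLift Fq m -> est (a * x)%g = sgn F a * est x.
Proof.
move=> aW; have [[a' [c [aW' cB ->]]]|xW] := est_cases x.
  by rewrite mulgA !estE ?WeylLift_mul // sgnM ?WeylLift_Mon.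
rewrite !est_out ?mulr0 // => a' aW'; rewrite mulgA -[a]invgK -invMg.
by rewrite xW // WeylLift_mul ?WeylLift_inv.
Qed.

(** The torus is normalized by the monomial matrices and contained in [B], so it
    preserves every coset in the support. *)
Lemma est_Torus h x : h \in Torus Fq m -> est (h * x)%g = est x.
Proof.
move=> hH; have conjE a : (a * (a^-1 * h * a) = h * a)%g by rewrite mulgA mulgA mulgV mul1g.
have [[a [c [aW cB ->]]]|xW] := est_cases x.
  rewrite mulgA -conjE -mulgA !estE // Borel_mul // Hgrp_Borel // Torus_conj //.
  exact: WeylLift_Mon.
rewrite !est_out // => a aW; apply: contra (xW a aW) => hx.
have hB : (a^-1 * h * a)%g \in Borel Fq m by rewrite Hgrp_Borel // Torus_conj ?WeylLift_Mon.
have -> : (a^-1 * x = (a^-1 * h * a)^-1 * (a^-1 * (h * x)))%g.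
  exact: mulVg_conj.
by rewrite Borel_mul ?Borel_inv.
Qed.

End SteinbergElement.

(** * Simple short root subgroups *)

Section RankOne.
Variables (Fq : finFieldType) (m : nat) (i : 'I_m).
Local Notation n := m.+1.
Local Notation gT := (GLn Fq m).
Local Notation a := (widen_ord (leqnSn m) i).
Local Notation b := (lift ord0 i : 'I_n).
Local Notation la := (lshift n a).
Local Notation lb := (lshift n b).
Local Notation ra := (rshift n a).
Local Notation rb := (rshift n b).
Implicit Types (g h : gT) (x y z t : Fq) (s : 'S_(n + n)).

Lemma adj_neq : a != b.
Proof. by apply/eqP => /(congr1 val) /=; rewrite /bump /=; lia. Qed.

(** A root subgroup for a simple short root. *)
Definition xel t : gT := emb (low_mx a b t).
Definition tel x t : gT := emb (torus_mx a b x t).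
Local Notation w := (pel Fq (adj i)).

Lemma xelM t u : (xel t * xel u)%g = xel (t + u).
Proof. by rewrite /xel -embM ?low_mx_unit ?adj_neq // low_mxM ?adj_neq. Qed.

Lemma xel0 : xel 0 = 1%g.
Proof. by rewrite /xel low_mx0 emb1. Qed.

Lemma wK : (w * w)%g = 1%g.
Proof. by rewrite -pelM tperm2 /pel perm_mx1 emb1. Qed.

Lemma xel_torus x t u : x != 0 -> t != 0 ->
  (xel u * tel x t = tel x t * xel (x * u / t)%R)%g.
Proof.
move=> x0 t0; rewrite /xel /tel.
rewrite -(embM (low_mx_unit adj_neq u) (torus_mx_unit adj_neq x0 t0)).
rewrite -(embM (torus_mx_unit adj_neq x0 t0) (low_mx_unit adj_neq _)).
by rewrite low_mx_torus ?adj_neq.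
Qed.

Lemma xel_bruhat t : t != 0 ->
  (w * xel t * w = xel t^-1%R * tel t (- t^-1)%R * (w * xel t^-1%R))%g.
Proof.
move=> t0; have s0 : - t^-1 != 0 by rewrite oppr_eq0 invr_eq0.
have uL (u : Fq) := low_mx_unit adj_neq u; have uT := torus_mx_unit adj_neq t0 s0.
have uS := swap_mx_unit Fq a b.
have uSL u : swap_mx Fq a b *m low_mx a b u \in unitmx by rewrite unitmx_mul uS uL.
have uLT u : low_mx a b u *m torus_mx a b t (- t^-1) \in unitmx by rewrite unitmx_mul uL uT.
have -> : w = emb (swap_mx Fq a b) by [].
rewrite /xel /tel -(embM uS (uL _)) -(embM (uSL _) uS) -(embM (uL _) uT).
rewrite -(embM uS (uL _)) -(embM (uLT _) (uSL _)).
by congr emb; apply: swap_low_swap; rewrite ?adj_neq.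
Qed.

Lemma mx_xel t : gmx (xel t) = 1%:M - t *: delta_mx la lb + t *: delta_mx rb ra.
Proof.
rewrite /xel mx_emb ?low_mx_unit ?adj_neq // invmx_low ?adj_neq //.
apply/matrixP => k l; rewrite /low_mx /pair_mx.
case: (split_ordP k) => k' ->; case: (split_ordP l) => l' ->.
- rewrite block_mxEul !mxE !eq_lshift !eq_lrshift /=.
  by rewrite (eq_sym l' k') (andbC (l' == b) (k' == a)); ring.
- by rewrite block_mxEur !mxE !(eq_lshift, eq_lrshift, eq_rlshift, eq_rshift) ?andbF /=; ring.
- by rewrite block_mxEdl !mxE !(eq_lshift, eq_lrshift, eq_rlshift, eq_rshift) ?andbF /=; ring.
- by rewrite block_mxEdr !mxE !(eq_lshift, eq_lrshift, eq_rlshift, eq_rshift) ?andbF /=; ring.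
Qed.

Lemma hgt_ab : hgt lb = (hgt la).+1.
Proof. by rewrite !hgt_l. Qed.

Lemma xel_Unip t : xel t \in Unip Fq m.
Proof.
have la_lb : la != lb by rewrite eq_lshift adj_neq.
have hr : (hgt rb < hgt ra)%N.
  by rewrite !hgt_r /= /bump /=; have := ltn_ord i; lia.
apply/UnipP; split=> [|k]; last first.
  rewrite mx_xel !mxE eqxx.
  have -> : (k == la) && (k == lb) = false by case: eqP => // ->; rewrite (negPf la_lb).
  have -> : (k == rb) && (k == ra) = false by case: eqP => // ->; rewrite eq_rshift eq_sym (negPf adj_neq).
  by rewrite !mulr0 subr0 addr0.
apply/BorelP; split; first by rewrite emb_Sp // low_mx_unit ?adj_neq.
move=> k l kl; rewrite mx_xel !mxE.
have -> : (k == l) = false by case: eqP kl => // ->; rewrite ltnn.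
have -> : (k == la) && (l == lb) = false.
  by case: eqP kl => // ->; case: eqP => // ->; rewrite hgt_ab; lia.
have -> : (k == rb) && (l == ra) = false.
  by case: eqP kl => // ->; case: eqP => // ->; lia.
by rewrite !mulr0 subr0 addr0.
Qed.

Lemma mx_conj_xel g t k l : gmx (g^-1 * xel t * g)%g k l =
  (k == l)%:R - t * (gmx g^-1%g k la * gmx g lb l) + t * (gmx g^-1%g k rb * gmx g ra l).
Proof.
have dE (A B : 'M[Fq]_(n + n)) p q : (A *m delta_mx p q *m B) k l = A k p * B q l.
  rewrite !mxE (bigD1 q) //= big1 => [|j /negPf jq].
    rewrite addr0 !mxE (bigD1 p) //= big1 => [|j /negPf jp]; rewrite !mxE ?eqxx ?mulr1 ?addr0 //.
    by rewrite jp mulr0.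
  rewrite !mxE big1 ?mul0r // => j' _; by rewrite mxE jq andbF mulr0.
rewrite !mxM mx_xel !mulmxDr !mulmxDl mulmxN mulNmx -!scalemxAr -!scalemxAl mulmx1 mxVK.
have mE (A B : 'M[Fq]_(n + n)) : (A + B) k l = A k l + B k l by rewrite mxE.
have nE (A : 'M[Fq]_(n + n)) : (- A) k l = - A k l by rewrite mxE.
have zE c (A : 'M[Fq]_(n + n)) : (c *: A) k l = c * A k l by rewrite mxE.
by rewrite !mE nE !zE !dE mxE.
Qed.

(** The root subgroup, seen from [g], points into the Borel subgroup. *)
Definition positive g : bool := [forall t, (g^-1 * xel t * g)%g \in Borel Fq m].

(** Conjugation by a monomial matrix moves the two nonzero off-diagonal entries of
    the root subgroup, and these stay above the diagonal together because [tau]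
    reverses heights. *)
Lemma positive_mono s g : g \in SpG Fq m -> is_mono s g ->
  positive g = (hgt (s^-1%g la) < hgt (s^-1%g lb))%N.
Proof.
move=> gS sg; set k0 := s^-1%g la; set l0 := s^-1%g lb.
have ss := mono_tau gS sg.
have ra0 : s^-1%g ra = tau k0 by apply: (canLR (permK s)); rewrite ss permKV tau_l.
have rb0 : s^-1%g rb = tau l0 by apply: (canLR (permK s)); rewrite ss permKV tau_l.
have k0l0 : k0 != l0 by rewrite (inj_eq perm_inj) eq_lshift adj_neq.
have first0 k l : ~~ ((k == k0) && (l == l0)) -> gmx g^-1%g k la * gmx g lb l = 0.
  rewrite negb_and => /orP[kk|ll]; first by rewrite (mono0 (monoV sg)) ?mul0r.
  by rewrite (mono0 sg) ?mulr0 // eq_sym (can2_eq (permK s) (permKV s)).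
have second0 k l : ~~ ((k == tau l0) && (l == tau k0)) -> gmx g^-1%g k rb * gmx g ra l = 0.
  rewrite negb_and => /orP[kk|ll]; first by rewrite (mono0 (monoV sg)) ?mul0r // rb0.
  by rewrite (mono0 sg) ?mulr0 // eq_sym (can2_eq (permK s) (permKV s)) ra0.
apply/forallP/idP => [/(_ 1) /BorelP[_ gB]|lt t].
  rewrite ltnNge; apply/negP; rewrite leq_eqVlt => /orP[/eqP/hgt_inj e|lt].
    by rewrite e eqxx in k0l0.
  have := gB _ _ lt; rewrite mx_conj_xel (negPf k0l0) second0 ?mulr0 ?addr0 ?sub0r ?mul1r.
    apply/eqP; rewrite oppr_eq0 mulf_eq0 negb_or.
    rewrite (mono_neq0 la (monoV sg)) -[X in gmx g X _](permKV s lb).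
    exact: mono_neq0.
  rewrite negb_and; apply/orP; left; apply/eqP => e.
  have : s k0 = s (tau l0) by rewrite e.
  rewrite ss !permKV tau_l => /eqP.
  by rewrite eq_lrshift.
apply/BorelP; split.
  by rewrite !Sp_mul ?Sp_inv // emb_Sp // low_mx_unit ?adj_neq.
move=> k l kl; rewrite mx_conj_xel first0 ?second0 ?mulr0 ?subr0 ?addr0.
- by case: eqP kl => // ->; rewrite ltnn.
- apply/negP => /andP[/eqP kE /eqP lE]; move: kl; rewrite kE lE !hgt_tau.
  by have := hgt_lt k0; have := hgt_lt l0; lia.
- apply/negP => /andP[/eqP kE /eqP lE]; move: kl; rewrite kE lE; lia.
Qed.

Lemma positive_Borel g c : c \in Borel Fq m -> positive (g * c)%g = positive g.
Proof.
move=> cB; apply/forallP/forallP => H t; have := H t.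
  rewrite invMg => tB; have : (c * (c^-1 * g^-1 * xel t * (g * c)) * c^-1)%g \in Borel Fq m.
    exact: Borel_mul (Borel_mul cB tB) (Borel_inv cB).
  by rewrite !mulgA mulgV mul1g mulgK.
move=> tB; have -> : ((g * c)^-1 * xel t * (g * c) = c^-1 * (g^-1 * xel t * g) * c)%g.
  by rewrite invMg !mulgA.
exact: Borel_mul (Borel_mul (Borel_inv cB) tB) cB.
Qed.

Lemma positive_xel g t : positive (xel t * g)%g = positive g.
Proof.
rewrite /positive; apply: eq_forallb => u.
have -> : ((xel t * g)^-1 * xel u * (xel t * g) = g^-1 * ((xel t)^-1 * (xel u * xel t)) * g)%g.
  by rewrite invMg !mulgA.
by rewrite xelM addrC -xelM mulKg.
Qed.

Lemma positive_torus g x t : x != 0 -> t != 0 -> positive (tel x t * g)%g = positive g.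
Proof.
move=> x0 t0.
have hE u : ((tel x t)^-1 * xel u * tel x t)%g = xel (x * u / t).
  by rewrite -mulgA (xel_torus u x0 t0) mulKg.
have gE u : ((tel x t * g)^-1 * xel u * (tel x t * g))%g =
            (g^-1 * xel (x * u / t)%R * g)%g.
  by rewrite -hE invMg !mulgA.
apply/forallP/forallP => H u; last by rewrite gE; apply: H.
have e : x * (u * t / x) / t = u by field; rewrite x0 t0.
by move: (H (u * t / x)); rewrite (gE (u * t / x)) e.
Qed.

End RankOne.

(** * An eigenvector of the unipotent group *)

Section Eigenvector.
Variables (Fq : finFieldType) (F : fieldType) (m : nat).
Local Notation n := m.+1.
Local Notation gT := (GLn Fq m).
Local Notation GA := (group_algebra gT F).
Variable nw : coset_of (Torus Fq m) -> gT.
Hypothesis nwP : forall w, w \in WeylG Fq m -> nw w \in WeylLift Fq m /\ coset (Torus Fq m) (nw w) = w.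
Hypothesis card_Fq : #|Fq|%:R = -1 :> F.
Variable lambda : Fq -> F.
Hypothesis lambda_char : linear_character lambda.
Implicit Types (g h x y u : gT).
Local Notation est := (est F nw).

Section RankOneSum.
Variable i : 'I_m.
Local Notation w := (pel Fq (adj i)).
Local Notation xel := (@xel Fq m i).
Local Notation a := (widen_ord (leqnSn m) i).
Local Notation b := (lift ord0 i : 'I_n).
Local Notation la := (lshift n a).
Local Notation lb := (lshift n b).
Local Notation ra := (rshift n a).
Local Notation rb := (rshift n b).

Definition est_pos x : F := if positive i x then est x else 0.

Lemma est_pos_xel t x : est_pos (xel t * x)%g = est_pos x.
Proof.
rewrite /est_pos positive_xel; case: ifP => // /forallP/(_ t) xB.
have -> : (xel t * x = x * (x^-1 * xel t * x))%g by rewrite -mulgA mulKVg.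
by rewrite est_Borel.
Qed.

Lemma tel_Torus c d : c != 0 -> d != 0 -> tel i c d \in Torus Fq m.
Proof.
move=> c0 d0; have uT := torus_mx_unit (adj_neq i) c0 d0.
have offd (e f : Fq) (k l : 'I_n) : k != l -> torus_mx a b e f k l = 0.
  move=> /negPf kl; rewrite !mxE kl.
  have -> : (k == a) && (l == a) = false.
    by apply/negP => /andP[/eqP kE /eqP lE]; rewrite kE lE eqxx in kl.
  have -> : (k == b) && (l == b) = false.
    by apply/negP => /andP[/eqP kE /eqP lE]; rewrite kE lE eqxx in kl.
  by rewrite !mul0r !mulr0 !addr0.
have iT : invmx (torus_mx a b c d) = torus_mx a b c^-1 d^-1.
  rewrite -[RHS](mulKmx uT) pair_mxM ?adj_neq // !mulr0 !mul0r !addr0 !add0r.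
  by rewrite !divff // (pair_mx1 Fq a b) mulmx1.
apply/HgrpP; split; first exact: emb_Sp.
move=> k l; rewrite mx_emb // iT.
case: (split_ordP k) => k' ->; case: (split_ordP l) => l' ->;
  rewrite ?eq_lshift ?eq_rshift => kl; rewrite ?block_mxEul ?block_mxEur ?block_mxEdl ?block_mxEdr.
- by rewrite mxE offd // eq_sym.
- by rewrite mxE.
- by rewrite mxE.
- exact: offd.
Qed.

Lemma est_pos_tel c d x : c != 0 -> d != 0 -> est_pos (tel i c d * x)%g = est_pos x.
Proof. by move=> c0 d0; rewrite /est_pos positive_torus ?est_Torus ?tel_Torus. Qed.

(** A monomial matrix sends the root subgroup to a positive or to a negative one,
    and the simple reflection exchanges the two cases. *)
Lemma est_split x : est x = est_pos x - est_pos (w * x)%g.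
Proof.
have wW := pel_WeylLift Fq i.
have sw : sgn F w = -1.
  by rewrite sgn_pel odd_tperm adj_neq.
have [[c [d [cW dB ->]]]|xW] := est_cases x; last first.
  have e0 := est_out F nwP xW.
  by rewrite /est_pos (est_WeylLift F nwP) // e0 mulr0 !if_same subrr.
have pd g : positive i (g * d)%g = positive i g := positive_Borel i g dB.
rewrite /est_pos mulgA !pd !(estE F nwP) ?WeylLift_mul //.
rewrite sgnM ?WeylLift_Mon // sw mulN1r.
have /MonP[cS [s sc]] := WeylLift_Mon cW.
have wcS : (w * c)%g \in SpG Fq m by rewrite Sp_mul // Mon_Sp ?pel_Mon.
rewrite (positive_mono i cS sc) (positive_mono i wcS (monoM (pel_mono _ _) sc)).
have -> : ((s * dbl_perm (adj i)^-1)^-1%g la) = s^-1%g lb.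
  rewrite invMg permM; congr (_ _); apply: (canLR (permK _)).
  by rewrite dbl_l tpermV tpermR.
have -> : ((s * dbl_perm (adj i)^-1)^-1%g lb) = s^-1%g la.
  rewrite invMg permM; congr (_ _); apply: (canLR (permK _)).
  by rewrite dbl_l tpermV tpermL.
have : hgt (s^-1%g la) != hgt (s^-1%g lb).
  by rewrite (inj_eq (@hgt_inj m)) (inj_eq perm_inj) eq_lshift adj_neq.
by case: ltngtP => // _ _; rewrite ?subr0 ?sub0r ?opprK.
Qed.

(** As [q = -1] in [F], the average over a root subgroup is, up to sign, the sum
    of [est_pos] over the [q + 1] points of a projective line, and the reflection
    permutes these points. *)
Definition root_sum x : F := \sum_t est (xel t * x)%g.

Lemma root_sumE x :
  root_sum x = - (est_pos x + \sum_t est_pos (w * (xel t * x))%g).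
Proof.
rewrite /root_sum (eq_bigr _ (fun t _ => est_split _)) sumrB opprD; congr (_ - _).
rewrite (eq_bigr (fun=> est_pos x)) => [|t _]; last exact: est_pos_xel.
by rewrite sumr_const -mulr_natl card_Fq mulN1r.
Qed.

Lemma root_sum_refl x : root_sum (w * x)%g = root_sum x.
Proof.
rewrite !root_sumE; congr (- _).
rewrite (bigD1 0) //= [in RHS](bigD1 0) //= !xel0 !mul1g mulgA wK mul1g.
rewrite addrCA; congr (_ + (_ + _)).
rewrite [RHS](reindex_inj invr_inj) /=.
apply: eq_big => [t|t t0]; first by rewrite invr_eq0.
rewrite !mulgA xel_bruhat // -!mulgA est_pos_xel est_pos_tel ?oppr_eq0 ?invr_eq0 //.
Qed.

End RankOneSum.

Local Notation lm := (lshift n (ord_max : 'I_n)).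
Local Notation rm := (rshift n (ord_max : 'I_n)).

Lemma lambda0 : lambda 0 = 1.
Proof.
have [l0 lD] := lambda_char; apply: (mulIf (l0 0)).
by rewrite -lD addr0 mul1r.
Qed.

Lemma hgt_lm_rm : hgt rm = (hgt lm).+1.
Proof. by rewrite hgt_l hgt_r /=; lia. Qed.

(** The character of the unipotent radical carried by the long simple root. *)
Definition psi u : F := lambda (gmx u lm rm).

Lemma psiM u v : u \in Unip Fq m -> v \in Unip Fq m -> psi (u * v)%g = psi u * psi v.
Proof.
move=> uU vU; rewrite /psi (Unip_additive uU vU hgt_lm_rm).
by have [_ ->] := lambda_char.
Qed.

Lemma psi_neq0 u : psi u != 0.
Proof. by have [l0 _] := lambda_char; apply: l0. Qed.

(** Since [psi] is a character, this is the sum of [psi(u)^-1 u e] over [u] in [U]. *)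
Definition fvec : GA := [ffun x => \sum_(u in Unip Fq m) psi u * est (u * x)%g].

Lemma fvec_Unip u x : u \in Unip Fq m -> fvec (u * x)%g = (psi u)^-1 * fvec x.
Proof.
move=> uU; rewrite !ffunE [in RHS](reindex_inj (mulIg u)) /= mulr_sumr.
apply: eq_big => [v|v vU].
  apply/idP/idP => [vU|]; first exact: Unip_mul.
  by move=> vuU; rewrite -[v](mulgK u) Unip_mul ?Unip_inv.
by rewrite psiM // mulgA mulrCA !mulrA mulfK ?psi_neq0.
Qed.

(** The diagonal entries of a symplectic [h] at paired indices are inverse to each
    other, so the condition makes them equal and conjugation keeps the entry. *)
Lemma psi_Torus h u : h \in Torus Fq m -> gmx h rm rm ^+ 2 = 1 ->
  psi (h * u * h^-1)%g = psi u.
Proof.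
move=> hH h2; congr lambda.
have /HgrpP[_ hD] := hH; have /HgrpP[_ hVD] := Torus_inv hH.
have hr0 : gmx h rm rm != 0 by rewrite Borel_diag_neq0 // Hgrp_Borel.
have hl : gmx h lm lm = gmx h rm rm.
  apply: (mulIf hr0); rewrite -expr2 h2 -[in X in _ * gmx h X X]tau_l.
  by rewrite Borel_diag // Hgrp_Borel.
have hV : gmx h rm rm * gmx h^-1%g rm rm = 1.
  by rewrite -Borel_diagM ?Borel_inv ?Hgrp_Borel // mulgV mx1 mxE eqxx.
rewrite !mxM mxE (bigD1 rm) //= big1 ?addr0 => [|k kr]; last by rewrite hVD ?mulr0.
rewrite mxE (bigD1 lm) //= big1 ?addr0 => [|k kr]; last by rewrite hD ?mul0r // eq_sym.
by rewrite hl mulrAC hV mul1r.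
Qed.

Lemma Unip_Torus h u : h \in Torus Fq m -> (h * u * h^-1)%g \in Unip Fq m = (u \in Unip Fq m).
Proof.
have conj g y : g \in Torus Fq m -> y \in Unip Fq m -> (g * y * g^-1)%g \in Unip Fq m.
  move=> gH /UnipP[yB y1]; have gB := Hgrp_Borel gH.
  apply/UnipP; split=> [|k]; first by rewrite !Borel_mul ?Borel_inv.
  rewrite !Borel_diagM ?Borel_mul ?Borel_inv // y1 mulr1 -Borel_diagM ?Borel_inv //.
  by rewrite mulgV mx1 mxE eqxx.
move=> hH; apply/idP/idP => [huU|]; last exact: conj.
have := conj _ _ (Torus_inv hH) huU.
by rewrite invgK -!mulgA mulKg mulVg mulg1.
Qed.

Lemma fvec_Torus h x : h \in Torus Fq m -> gmx h rm rm ^+ 2 = 1 -> fvec (h * x)%g = fvec x.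
Proof.
move=> hH h2; rewrite !ffunE (reindex_inj (conjg_inj h^-1%g)) /=.
apply: eq_big => u; rewrite conjgE invgK; first by rewrite mulgA Unip_Torus.
by move=> _; rewrite mulgA psi_Torus // -!mulgA mulKg est_Torus.
Qed.

Section ReflectionInvariance.
Variable i : 'I_m.
Hypothesis im : (i.+1 < m)%N.
Local Notation w := (pel Fq (adj i)).
Local Notation xel := (@xel Fq m i).
Local Notation a := (widen_ord (leqnSn m) i).
Local Notation b := (lift ord0 i : 'I_n).
Local Notation la := (lshift n a).
Local Notation lb := (lshift n b).
Local Notation ra := (rshift n a).
Local Notation rb := (rshift n b).
Local Notation s := (dbl_perm (adj i)).

(** A simple reflection changes the relative order of two pairs of heights only. *)
Lemma hgt_swap k l : (hgt l < hgt k)%N ->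
  [\/ (hgt (s l) < hgt (s k))%N, k = lb /\ l = la | k = ra /\ l = rb].
Proof.
have h k' : hgt (s k') = (if hgt k' == hgt la then hgt lb else
  if hgt k' == hgt lb then hgt la else if hgt k' == hgt ra then hgt rb else
  if hgt k' == hgt rb then hgt ra else hgt k').
  rewrite !(inj_eq (@hgt_inj m)).
  case: (split_ordP k') => j ->; rewrite ?dbl_l ?dbl_r !(eq_lshift, eq_rshift, eq_lrshift, eq_rlshift).
    case: tpermP => [->|->|]; rewrite ?eqxx //; last by move=> /eqP/negPf -> /eqP/negPf ->.
    by rewrite eq_sym (negPf (adj_neq i)).
  case: tpermP => [->|->|]; rewrite ?eqxx //; last by move=> /eqP/negPf -> /eqP/negPf ->.
  by rewrite eq_sym (negPf (adj_neq i)).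
have e1 : hgt la = i by rewrite hgt_l.
have e2 : hgt lb = i.+1 by rewrite hgt_l.
have e3 : hgt ra = (2 * n - 1 - i)%N by rewrite hgt_r.
have e4 : hgt rb = (2 * n - 1 - i.+1)%N by rewrite hgt_r.
move=> lk.
have [[kE lE]|nl] := eqVneq (hgt k, hgt l) (hgt lb, hgt la).
  by apply: Or32; split; apply: hgt_inj.
have [[kE lE]|nr] := eqVneq (hgt k, hgt l) (hgt ra, hgt rb).
  by apply: Or33; split; apply: hgt_inj.
apply: Or31; rewrite !h; move: nl nr; rewrite !xpair_eqE e1 e2 e3 e4.
have := hgt_lt k; have := hgt_lt l; have := ltn_ord i.
by do !case: eqP; lia.
Qed.

(** The root subgroup of a short root has one entry on [M] and one on [N], tied by
    the symplectic condition. *)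
Lemma Unip_opp_entry u : u \in Unip Fq m -> gmx u rb ra = - gmx u la lb.
Proof.
move=> uU; have [uB u1] := UnipP _ uU; have [_ uT] := BorelP _ uB.
have [/matrixP/(_ b a) + _] := Sp_M_blocks (Borel_M uB).
rewrite !mxE (eq_sym b a) (negPf (adj_neq i)) (bigD1 a) //= (bigD1 b) 1?eq_sym ?adj_neq //=.
rewrite big1 ?addr0 => [|k /andP[ka kb]].
  by rewrite !mxE !u1 mulr1 mul1r => /eqP; rewrite addrC addr_eq0 => /eqP.
rewrite !mxE; have [ak|ka'] := ltnP k a.
  rewrite [X in _ * X]uT ?mulr0 // !hgt_r.
  by move: ak => /=; have := ltn_ord i; have := ltn_ord k; lia.
rewrite uT ?mul0r // !hgt_l /=.
have : val k != i by rewrite -val_eqE in ka.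
have : val k != i.+1 by rewrite -val_eqE in kb.
by move: ka' => /=; rewrite /bump /=; lia.
Qed.

(** A complement of the root subgroup in [U], normalized by the simple reflection. *)
Definition Unip0 := [set u in Unip Fq m | gmx u la lb == 0].

Lemma mem_Unip0 u : (u \in Unip0) = (u \in Unip Fq m) && (gmx u la lb == 0).
Proof. by rewrite [LHS]inE. Qed.

Lemma mx_conj_w y k l : gmx (w * y * w)%g k l = gmx y (s k) (s l).
Proof.
have wm k' l' : gmx w k' l' = (s k' == l')%:R.
  rewrite mx_pel; case: (split_ordP k') => j ->; case: (split_ordP l') => j' ->.
  - by rewrite block_mxEul !mxE dbl_l eq_lshift.
  - by rewrite block_mxEur !mxE dbl_l eq_lrshift.
  - by rewrite block_mxEdl !mxE dbl_r eq_rlshift.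
  - by rewrite block_mxEdr !mxE dbl_r eq_rshift.
have ss : involutive s.
  move=> k'; case: (split_ordP k') => j ->; rewrite ?dbl_l ?dbl_r; by rewrite tpermK.
rewrite !mxM mxE (bigD1 (s l)) //= big1 ?addr0 => [|k' kl]; last first.
  by rewrite wm (can2_eq ss ss) (negPf kl) mulr0.
rewrite wm ss eqxx mulr1 mxE (bigD1 (s k)) //= big1 ?addr0 => [|k' kl]; last first.
  by rewrite wm eq_sym (negPf kl) mul0r.
by rewrite wm eqxx mul1r.
Qed.

Lemma Unip0_conj y : y \in Unip0 -> (w * y * w)%g \in Unip0.
Proof.
rewrite !mem_Unip0 => /andP[yU /eqP y0].
have [yB y1] := UnipP _ yU; have [yS yT] := BorelP _ yB.
have wS : w \in SpG Fq m by rewrite Mon_Sp ?pel_Mon.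
apply/andP; split; last first.
  rewrite mx_conj_w !dbl_l tpermL tpermR yT //.
  by rewrite !hgt_l /= /bump /=; lia.
apply/UnipP; split=> [|k]; last by rewrite mx_conj_w y1.
apply/BorelP; split; first by rewrite !Sp_mul.
move=> k l /hgt_swap[lt|[-> ->]|[-> ->]]; rewrite mx_conj_w.
- exact: yT.
- by rewrite !dbl_l tpermL tpermR.
- by rewrite !dbl_r tpermL tpermR Unip_opp_entry // y0 oppr0.
Qed.

Lemma psi_conj_w y : psi (w * y * w)%g = psi y.
Proof.
have sm : adj i ord_max = ord_max.
  rewrite tpermD //; apply/eqP => /(congr1 val) /=; have := ltn_ord i.
    by lia.
  by rewrite /bump /=; lia.
by rewrite /psi mx_conj_w dbl_l dbl_r sm.
Qed.

Lemma xel_la_lb t : gmx (xel t) la lb = - t.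
Proof.
by rewrite mx_xel !mxE !eqxx !(eq_lshift, eq_lrshift) (negPf (adj_neq i)) /= mulr0 addr0 sub0r mulr1.
Qed.

Lemma psi_xel t : psi (xel t) = 1.
Proof.
rewrite /psi mx_xel !mxE !(eq_lshift, eq_rshift, eq_lrshift, eq_rlshift) andbF /=.
by rewrite !mulr0 addr0 subr0 lambda0.
Qed.

(** Each element of [U] is a root element times an element of [Unip0], and [psi] is
    trivial on the former. *)
Lemma fvec_root_sum x : fvec x = \sum_(y in Unip0) psi y * root_sum i (y * x)%g.
Proof.
have hab : hgt lb = (hgt la).+1 := hgt_ab i.
rewrite ffunE (partition_big (fun u => - gmx u la lb) xpredT) //=.
under [RHS]eq_bigr => y _ do rewrite /root_sum mulr_sumr.
rewrite [RHS]exchange_big; apply: eq_bigr => t _ /=.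
rewrite (reindex_inj (mulgI (xel t))) /=.
have xU := xel_Unip i t.
have inU y : ((xel t * y)%g \in Unip Fq m) = (y \in Unip Fq m).
  apply/idP/idP => [xyU|]; last exact: Unip_mul.
  by rewrite -[y](mulKg (xel t)) Unip_mul ?Unip_inv.
apply: eq_big => [y|y].
  rewrite inU mem_Unip0; case yU: (y \in Unip Fq m) => //=.
  by rewrite (Unip_additive xU yU hab) xel_la_lb opprD opprK -subr_eq0 addrAC subrr add0r oppr_eq0.
by rewrite inU => /andP[yU _]; rewrite (psiM xU yU) psi_xel mul1r mulgA.
Qed.

Lemma fvec_refl x : fvec (w * x)%g = fvec x.
Proof.
have conjK y : (w * (w * y * w) * w = y)%g by rewrite !mulgA wK mul1g -mulgA wK mulg1.
have conj_inj : injective (fun y => w * y * w)%g by apply: inv_inj => y; exact: conjK.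
rewrite !fvec_root_sum [RHS](reindex_inj conj_inj) /=.
apply: eq_big => [y|y yU].
  by apply/idP/idP => [/Unip0_conj //|/Unip0_conj]; rewrite conjK.
by rewrite psi_conj_w -!mulgA root_sum_refl !mulgA.
Qed.

End ReflectionInvariance.
End Eigenvector.

(** * The stabilizer of the eigenvector *)

Section Stabilizer.
Variables (Fq : finFieldType) (F : fieldType) (m : nat).
Local Notation n := m.+1.
Local Notation gT := (GLn Fq m).
Local Notation GA := (group_algebra gT F).
Variable nw : coset_of (Torus Fq m) -> gT.
Hypothesis nwP : forall w, w \in WeylG Fq m -> nw w \in WeylLift Fq m /\ coset (Torus Fq m) (nw w) = w.
Hypothesis card_Fq : #|Fq|%:R = -1 :> F.
Variable lambda : Fq -> F.
Hypothesis lambda_char : linear_character lambda.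
Implicit Types (g h x y u : gT) (D : 'M[Fq]_n).
Local Notation est := (est F nw).
Local Notation fvec := (fvec nw lambda).
Local Notation psi := (psi lambda).
Local Notation lm := (lshift n (ord_max : 'I_n)).
Local Notation rm := (rshift n (ord_max : 'I_n)).

(** Conjugation by the longest element makes [u] lower unitriangular, and such a
    matrix is the product of a monomial and an upper triangular one only if it is
    the identity. *)
Lemma opposite_Unip u a c : u \in Unip Fq m -> a \in Mon Fq m -> c \in Borel Fq m ->
  (u * cel Fq setT)%g = (a * c)%g -> u = 1%g.
Proof.
move=> uU aM cB uac; set g := cel Fq setT in uac.
have [uB u1] := UnipP _ uU; have [uS uT] := BorelP _ uB.
have gs : is_mono (cel_perm setT) g by apply: cel_mono.
have gtau k : cel_perm setT k = tau k.
  by rewrite permE /cel_fun /tau; case: (split k) => j; rewrite inE.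
have yE k l : gmx (g^-1 * u * g)%g k l =
    gmx g^-1%g k (tau k) * gmx u (tau k) (tau l) * gmx g (tau l) l.
  rewrite !mxM mxE (bigD1 (tau l)) //= big1 ?addr0 => [|j jl]; last first.
    by rewrite (mono0 gs) ?mulr0 // gtau.
  rewrite mxE (bigD1 (tau k)) //= big1 ?addr0 // => j jk.
  rewrite (mono0 (monoV gs)) ?mul0r //; apply: contra jk => /eqP ->.
  by rewrite -gtau permKV.
have y1 k : gmx (g^-1 * u * g)%g k k = 1.
  have := mxVK g => /matrixP/(_ k k); rewrite mxE (bigD1 (tau k)) //= big1 => [|j jk]; last first.
    by rewrite (mono0 gs) ?mulr0 // gtau.
  by rewrite yE u1 mulr1 addr0 => ->; rewrite mxE eqxx.
have gM := cel_Mon Fq setT.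
have /MonP[mS [s ms]] : (g^-1 * a)%g \in Mon Fq m by rewrite Mon_mul ?Mon_inv.
have yac : (g^-1 * u * g = g^-1 * a * c)%g by rewrite -mulgA uac mulgA.
have s1 : s^-1%g = 1%g.
  apply: perm_hgt_le => k; rewrite leqNgt; apply/negP => lt.
  have := y1 k; rewrite yac mxM mxE (bigD1 (s^-1%g k)) //= big1 ?addr0 => [|j jk].
    by have [_ -> //] := BorelP _ cB; rewrite mulr0 => /eqP; rewrite eq_sym oner_eq0.
  rewrite (mono0 ms) ?mul0r //; apply: contra jk => /eqP ->.
  by rewrite permK.
have mH : (g^-1 * a)%g \in Torus Fq m.
  by rewrite mono_Hgrp mS; rewrite -[s]invgK s1 invg1 in ms.
have yB : (g^-1 * u * g)%g \in Borel Fq m by rewrite yac Borel_mul // Hgrp_Borel.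
suff y_1 : (g^-1 * u * g = 1)%g.
  by rewrite -[u](mulKg g^-1%g) -[(g^-1 * u)%g](mulgK g) y_1 mul1g invgK mulgV.
apply: mx_inj; apply/matrixP => k l; rewrite mx1 [RHS]mxE.
have [->|kl] := eqVneq k l; first by rewrite y1.
have [lt|lt|/hgt_inj e] := ltngtP (hgt l) (hgt k); last by rewrite e eqxx in kl.
  by have [_ ->] := BorelP _ yB.
rewrite yE uT ?mulr0 ?mul0r // !hgt_tau.
by move: (hgt_lt k) (hgt_lt l) lt; clear; lia.
Qed.

(** At the longest element only the term [u = 1] contributes, by [opposite_Unip]. *)
Lemma fvec_neq0 : fvec != 0.
Proof.
apply/eqP => /ffunP/(_ (cel Fq setT)); rewrite ffunE [RHS]ffunE.
have gM := cel_Mon Fq (setT : {set 'I_n}).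
rewrite (bigD1 1%g) /=; last exact: (group1 (Unip_group Fq m)).
rewrite big1 ?addr0 => [|u /andP[uU u1]]; last first.
  have [[a [c [aW cB uac]]]|xW] := est_cases (u * cel Fq setT)%g.
    by rewrite (opposite_Unip uU (WeylLift_Mon aW) cB uac) eqxx in u1.
  by rewrite (est_out F nwP xW) mulr0.
have Borel1 : 1%g \in Borel Fq m := group1 (Borel_group Fq m).
rewrite mul1g -[cel _ _]mulg1 (estE F nwP) ?cel_WeylLift //; apply/eqP.
rewrite mulf_neq0 ?psi_neq0 //.
have : sgn F (cel Fq (setT : {set 'I_n})) * sgn F (cel Fq (setT : {set 'I_n}))^-1%g = 1.
  by rewrite -sgnM ?Mon_inv // mulgV sgn_Torus // (group1 (Torus_group Fq m)).
by move=> e; apply: contra_eq_neq e => ->; rewrite mul0r eq_sym oner_eq0.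
Qed.

Lemma fvec_fixM u x : u \in SpfM Fq m -> fvec (u * x)%g = (psi u)^-1 * fvec x.
Proof.
move=> uM; apply: fvec_Unip => //; move: (uM); rewrite mem_Sp_fixM => /and3P[uS /eqP u0 /eqP ul].
have uB : u \in Borel Fq m.
  apply: Borel_of_upper => // i j ji; rewrite ul mxE.
  by case: eqP ji => // ->; rewrite ltnn.
apply/UnipP; split=> // k; rewrite -[gmx u]submxK ul u0 (Sp_fixM_dr uM).
by case: (split_ordP k) => j ->; rewrite ?block_mxEul ?block_mxEdr mxE eqxx.
Qed.

Definition fixes g := forall x, fvec (g * x)%g = fvec x.

Lemma fixesM g h : fixes g -> fixes h -> fixes (g * h)%g.
Proof. by move=> gf hf x; rewrite -mulgA gf hf. Qed.

Lemma emb_entry_lr D (k l : 'I_n) : D \in unitmx -> gmx (emb D) (lshift n k) (rshift n l) = 0.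
Proof. by move=> uD; rewrite mx_emb // block_mxEur mxE. Qed.

(** Such a block gives an element of [B], whose part in [U] has trivial [psi] and
    whose diagonal part is covered by [fvec_Torus]. *)
Lemma fixes_lower D : D \in unitmx -> (forall i j : 'I_n, (i < j)%N -> D i j = 0) ->
  D ord_max ord_max ^+ 2 = 1 -> fixes (emb D).
Proof.
move=> uD DT D1.
have dB : emb D \in Borel Fq m.
  have := emb_MN uD; rewrite mem_Sp_MN => /and3P[dS /eqP d0 _].
  apply: Borel_of_upper => // i j ji; rewrite mx_emb // block_mxKul trmx_inv.
  apply: invmx_upper => //; first by rewrite unitmx_tr.
  by move=> i' j' ji'; rewrite mxE DT.
have [u [h [uU hH dE]]] := Borel_factor dB.
have hB := Hgrp_Borel hH; have [uB u1] := UnipP _ uU.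
have hr : gmx h rm rm = D ord_max ord_max.
  have : gmx (emb D) rm rm = D ord_max ord_max by rewrite mx_emb // block_mxEdr.
  by rewrite dE Borel_diagM // u1 mul1r.
have u0 : gmx u lm rm = 0.
  rewrite -[u](mulgK h) -dE mxM mxE (bigD1 rm) //= big1 => [|k kr].
    by rewrite emb_entry_lr // mul0r addr0.
  by have /HgrpP[_ hD] := Torus_inv hH; rewrite hD ?mulr0.
move=> x; rewrite dE -mulgA (fvec_Unip _ lambda_char) // fvec_Torus ?hr //.
by rewrite /psi u0 lambda0 // invr1 mul1r.
Qed.

(** By induction on [k - j], conjugating by adjacent transpositions. *)
Lemma fixes_tperm (j k : 'I_n) : (j < k)%N -> (k < m)%N -> fixes (pel Fq (tperm j k)).
Proof.
move=> jk km; have [d] := ubnP (k - j); elim: d k jk km => // d IH k jk km.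
rewrite ltnS => kd.
have k1m : (k.-1 < m)%N by lia.
have k1n : (k.-1 < n)%N by lia.
pose i := Ordinal k1m; pose k1 := Ordinal k1n.
have adjE : tperm k1 k = adj i.
  by congr tperm; apply: val_inj => //=; rewrite /bump /=; lia.
have fadj : fixes (pel Fq (tperm k1 k)).
  by move=> x; rewrite adjE; apply: fvec_refl => //=; lia.
have [jk1|] := eqVneq j k1; first by rewrite jk1.
rewrite -val_eqE /= => jk1.
have -> : tperm j k = (tperm k1 k * tperm j k1 * tperm k1 k)%g.
  have -> : (tperm k1 k * tperm j k1 * tperm k1 k)%g = (tperm j k1 ^ tperm k1 k)%g.
    by rewrite conjgE tpermV mulgA.
  by rewrite tpermJ tpermL tpermD //; apply/eqP => /(congr1 val) /=; lia.
rewrite !pelM; apply: fixesM => //; apply: fixesM => //.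
by apply: IH => /=; lia.
Qed.

(** By induction on the largest index moved, each time composing with a product of
    adjacent transpositions below the last index. *)
Lemma fixes_perm (s : 'S_n) : s ord_max = ord_max -> fixes (pel Fq s).
Proof.
suff H k (t : 'S_n) : (k <= m)%N -> (forall j : 'I_n, (k <= j)%N -> t j = j) -> fixes (pel Fq t).
  move=> sm; apply: (H m) => // j mj; have -> : j = ord_max by apply: val_inj => /=; have := ltn_ord j; lia.
  exact: sm.
elim: k t => [|k IH] t km tfix.
  have -> : t = 1%g by apply/permP => j; rewrite tfix ?perm1.
  by move=> x; rewrite /pel perm_mx1 emb1 mul1g.
have kn : (k < n)%N by lia.
pose k0 := Ordinal kn.
have tk : (t k0 <= k)%N.
  rewrite leqNgt; apply/negP => lt; have := tfix _ lt.
  by move/perm_inj => e; move: lt; rewrite e /= ltnn.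
have -> : t = ((t * tperm (t k0) k0) * tperm (t k0) k0)%g by rewrite -mulgA tperm2 mulg1.
rewrite pelM; apply: fixesM.
  apply: IH => [|j]; first by lia.
  rewrite leq_eqVlt => /predU1P[kj|kj].
    have -> : j = k0 by apply: val_inj.
    by rewrite permM tpermL.
  rewrite permM (tfix j kj) tpermD //; apply/eqP => /(congr1 val) /=; lia.
have [->|ne] := eqVneq (t k0) k0.
  by move=> x; rewrite tperm1 /pel perm_mx1 emb1 mul1g.
apply: fixes_tperm => //=; rewrite ltn_neqAle tk andbT.
by rewrite -val_eqE in ne.
Qed.

(** Reverses all indices except the last, so that conjugation by it exchanges upper
    and lower triangular matrices without moving the last basis vector. *)
Definition flip (i : 'I_n) : 'I_n := if i == ord_max then ord_max else inord (m.-1 - i).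

Lemma flip_val (i : 'I_n) : val (flip i) = if i == ord_max then m else (m.-1 - i)%N.
Proof.
rewrite /flip; case: ifP => // /negbT; rewrite -val_eqE /= => im.
by rewrite inordK //; have := ltn_ord i; lia.
Qed.

Lemma flipK : involutive flip.
Proof.
move=> i; apply: val_inj; rewrite !flip_val.
have := flip_val i; rewrite -!val_eqE /= => ->; have := ltn_ord i.
have [/eqP ->|] := boolP (nat_of_ord i == m); first by rewrite eqxx.
by move=> ne lt; case: eqP; lia.
Qed.

Definition flip_perm := perm (inv_inj flipK).

Lemma mx_conj_flip (A : 'M[Fq]_n) i j :
  (perm_mx flip_perm *m A *m perm_mx flip_perm) i j = A (flip i) (flip j).
Proof.
have fV : flip_perm^-1%g = flip_perm.
  apply/permP => k; apply: (@perm_inj _ flip_perm); rewrite permKV.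
  by rewrite !permE flipK.
by rewrite -row_permE -{2}fV -col_permE !mxE !permE.
Qed.

Lemma fixes_upper D : D \in unitmx -> (forall i j : 'I_n, (j < i)%N -> D i j = 0) ->
  (forall i, D i i = 1) -> (forall i : 'I_n, (i < m)%N -> D i ord_max = 0) -> fixes (emb D).
Proof.
move=> uD DT D1 Dm; set R := perm_mx flip_perm : 'M[Fq]_n.
have uR : R \in unitmx := unitmx_perm Fq _.
have RR : R *m R = 1%:M.
  rewrite -perm_mxM; have -> : (flip_perm * flip_perm)%g = 1%g.
    by apply/permP => k; rewrite permM !permE flipK.
  exact: perm_mx1.
have uC : R *m D *m R \in unitmx by rewrite !unitmx_mul uR uD.
have fm : flip_perm ord_max = ord_max by rewrite permE /flip eqxx.
have -> : D = R *m (R *m D *m R) *m R.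
  by rewrite !mulmxA RR mul1mx -mulmxA RR mulmx1.
rewrite !embM ?unitmx_mul ?uR ?uC ?uD //.
have fR : fixes (emb R) := fixes_perm fm.
rewrite -!mulgA; apply: fixesM => //; rewrite !mulgA; apply: fixesM => //.
rewrite -!embM ?unitmx_mul ?uR ?uD //; apply: fixes_lower => // [i j ij|].
  rewrite mx_conj_flip; have [jm|jm] := eqVneq j ord_max.
    rewrite {2}/flip jm eqxx Dm // flip_val.
    by move: ij; rewrite jm -val_eqE /=; case: eqP; lia.
  have im : (i == ord_max) = false.
    by apply/negbTE; rewrite -val_eqE /=; move: (ltn_ord j) ij; clear; lia.
  apply: DT; rewrite !flip_val (negPf jm) im.
  by move: jm ij (ltn_ord j); rewrite -val_eqE /=; clear; lia.
by rewrite mx_conj_flip D1 expr1n.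
Qed.

(** Take the LU decomposition of the transpose of [D]. The hypothesis on the last
    column of [D] forces the permutation to fix the last index, so all three factors
    fix the last vector up to sign. *)
Lemma fixes_emb D e : D \in unitmx -> e ^+ 2 = 1 ->
  (forall i, D i ord_max = e *+ (i == ord_max)) -> fixes (emb D).
Proof.
move=> uD e2 De.
have e0 : e != 0 by apply: contra_eq_neq e2 => ->; rewrite expr0n eq_sym oner_eq0.
have := cormen_lup_correct D^T; have := cormen_lup_perm D^T.
have := @cormen_lup_lower _ _ D^T; have := @cormen_lup_upper _ _ D^T.
have := cormen_lup_detL D^T.
case: (cormen_lup D^T) => [[P L] U] /= detL UT LT /is_perm_mxP[s PE] PLU.
rewrite {P}PE in PLU.
have uL : L \in unitmx by rewrite unitmxE detL unitr1.
have uU : U \in unitmx.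
  have : perm_mx s *m D^T \in unitmx by rewrite unitmx_mul unitmx_perm unitmx_tr.
  by rewrite [_ *m _]PLU unitmx_mul uL.
have PD i j : (L *m U) i j = D j (s i).
  by rewrite -[L *m U]PLU -[_ * _]row_permE !mxE.
have UV := invmx_upper uU UT.
pose k := s^-1%g ord_max.
have Lk j : L k j = e * invmx U ord_max j.
  have -> : L k j = ((L *m U) *m invmx U) k j by rewrite mulmxK.
  rewrite mxE (bigD1 ord_max) //= big1 ?addr0 => [|i im]; rewrite PD permKV De ?eqxx //.
  by rewrite (negPf im) mulr0n mul0r.
have km : k = ord_max.
  apply: val_inj; apply/eqP; rewrite eqn_leq -ltnS ltn_ord /= leqNgt; apply/negP => lt.
  have := Lk k; rewrite UV // mulr0 LT // eqxx => /eqP.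
  by rewrite oner_eq0.
have sm : s ord_max = ord_max by rewrite -{1}km permKV.
have Lm (j : 'I_n) : (j < m)%N -> L ord_max j = 0.
  by move=> jm; rewrite -km Lk UV ?mulr0.
have Um : U ord_max ord_max = e.
  have := PD ord_max ord_max; rewrite sm De eqxx mxE (bigD1 ord_max) //= LT // eqxx mul1r.
  rewrite big1 ?addr0 // => j jm; rewrite Lm ?mul0r // ltn_neqAle -ltnS ltn_ord andbT.
  by rewrite -val_eqE in jm.
have uUT : U^T \in unitmx by rewrite unitmx_tr.
have uLT : L^T \in unitmx by rewrite unitmx_tr.
have DE : D = U^T *m L^T *m perm_mx s.
  rewrite -trmx_mul -[L *m U]PLU -[_ * _]/(_ *m _) trmx_mul trmxK tr_perm_mx -mulmxA -perm_mxM.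
  by rewrite mulVg perm_mx1 mulmx1.
rewrite DE !embM ?unitmx_perm ?unitmx_mul ?uUT ?uLT //.
apply: fixesM; last exact: fixes_perm.
apply: fixesM.
  apply: fixes_lower => // [i j ij|]; first by rewrite mxE UT.
  by rewrite mxE Um.
apply: fixes_upper => // [i j ji|i|i im]; rewrite mxE.
- by rewrite LT ?(ltnW ji) //; case: eqP ji => // ->; rewrite ltnn.
- by rewrite LT ?eqxx.
- exact: Lm.
Qed.

End Stabilizer.

(** * Characters of symmetric matrices and even functions *)

Lemma span_ind (K : fieldType) (V : vectType K) (s : seq V) (P : V -> Prop) :
  P 0 -> (forall a x y, P x -> P y -> P (a *: x + y)) -> {in s, forall x, P x} ->
  forall x, x \in <<s>>%VS -> P x.
Proof.
move=> P0 PD Ps x /(coord_span (X := in_tuple s)) ->.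
elim/big_ind: _ => // [y z Py Pz|i _]; first by rewrite -[y]scale1r; apply: PD.
rewrite -[_ *: _]addr0; apply: PD => //; apply: Ps.
by rewrite (mem_nth 0).
Qed.

Section SeparateCharacters.
Variables (Fq : finFieldType) (F : fieldType) (n : nat) (lambda : Fq -> F).
Hypothesis lambda_char : linear_character lambda.
Hypothesis lambda_nontriv : nontrivial_character lambda.
Implicit Types (v w : 'cV[Fq]_n) (S : 'M[Fq]_n).

(** For [S] the block of [s] in [Sp^M], this is [<s v, v>]. *)
Definition qform S v : Fq := (v^T *m S *m v) 0 0.

Lemma qformN S v : qform S (- v) = qform S v.
Proof. by rewrite /qform [(- v)^T]linearN /= mulmxN !mulNmx opprK. Qed.

Lemma qformZ c S v : qform (c *: S) v = c * qform S v.
Proof. by rewrite /qform -scalemxAr -scalemxAl mxE. Qed.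

Lemma qformD S S' v : qform (S + S') v = qform S v + qform S' v.
Proof. by rewrite /qform mulmxDr mulmxDl mxE. Qed.

Lemma qform_delta i j v : qform (delta_mx i j) v = v i 0 * v j 0.
Proof.
rewrite /qform mxE (bigD1 j) //= big1 => [|k /negPf kj].
  rewrite addr0 mxE (bigD1 i) //= big1 => [|k /negPf ki]; rewrite !mxE ?eqxx ?mulr1 ?addr0 //.
  by rewrite ki mulr0.
by rewrite mxE big1 ?mul0r // => k' _; rewrite [delta_mx _ _ _ _]mxE kj andbF mulr0.
Qed.

(** The symmetric matrices form a vector space, so a nonzero difference of the two
    forms could be scaled to a value where the nontrivial [lambda] is not one. *)
Lemma qform_eq v w c :
  (forall S, S^T = S -> lambda (qform S v) = lambda (c * qform S w)) ->
  forall S, S^T = S -> qform S v = c * qform S w.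
Proof.
move=> eq_l S sS; have [l0 lD] := lambda_char.
apply/eqP; rewrite -subr_eq0; apply/eqP; set d := _ - _.
have ld a : lambda (a * d) = 1.
  have := eq_l (a *: S); rewrite linearZ /= sS => /(_ erefl).
  rewrite !qformZ mulrBr mulrCA => e; apply: (mulIf (l0 (a * (c * qform S w)))).
  by rewrite -lD subrK e mul1r mulrCA.
have [//|d0] := eqVneq d 0.
have [x] := lambda_nontriv; case/negP.
by rewrite -[x](divfK d0) ld.
Qed.

Lemma qform_eq_coef v w c :
  (forall S, S^T = S -> lambda (qform S v) = lambda (c * qform S w)) ->
  forall i j, (v i 0 * v j 0) *+ (i != j).+1 = (c * (w i 0 * w j 0)) *+ (i != j).+1.
Proof.
move/qform_eq => e i j; have [<-|ij] := eqVneq i j.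
  by have := e (delta_mx i i); rewrite trmx_delta !qform_delta => /(_ erefl) ->.
have := e (delta_mx i j + delta_mx j i); rewrite linearD /= !trmx_delta addrC => /(_ erefl).
by rewrite !qformD !qform_delta [v j 0 * _]mulrC [w j 0 * _]mulrC -!mulr2n mulrnAr.
Qed.

(** The products of coordinates [v_i v_j] determine [v] up to sign; in characteristic
    [2] the squares alone determine it. *)
Lemma qform_sep v w :
  (forall S, S^T = S -> lambda (qform S v) = lambda (qform S w)) -> v = w \/ v = - w.
Proof.
move=> e; have {}e : forall S, S^T = S -> lambda (qform S v) = lambda (1 * qform S w).
  by move=> S sS; rewrite mul1r e.
have sq i : v i 0 = w i 0 \/ v i 0 = - w i 0.
  have := qform_eq_coef e i i; rewrite eqxx mul1r /= !mulr1n => /eqP.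
  by rewrite -!expr2 eqf_sqr => /orP[/eqP|/eqP]; [left|right].
have [c2|c2] := boolP (2 \in [pchar Fq]).
  by left; apply/colP => i; case: (sq i) => // ->; rewrite oppr_pchar2.
have two : 2%:R != 0 :> Fq by move: c2; rewrite inE.
have pr i j : v i 0 * v j 0 = w i 0 * w j 0.
  have := qform_eq_coef e i j; rewrite mul1r; case: (i != j) => //= /eqP.
  by rewrite -subr_eq0 -mulrnBl -mulr_natl mulf_eq0 (negPf two) subr_eq0 => /eqP.
have [w0|/existsP[i wi]] := boolP [forall i, w i 0 == 0]; last first.
  have vE j : v j 0 = (v i 0 / w i 0) * w j 0.
    have vi : v i 0 != 0 by case: (sq i) => ->; rewrite ?oppr_eq0.
    apply: (mulfI vi); rewrite pr !mulrA.
    by rewrite [v i 0 * v i 0]pr; field.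
  case: (sq i) => vi; [left|right]; apply/colP => j; rewrite ?mxE vE vi.
    by rewrite divff ?mul1r.
  by rewrite mulNr divff // mulN1r.
left; apply/colP => i; have := sq i; rewrite (eqP (forallP w0 i)) oppr0.
by case.
Qed.

(** A nonzero coordinate of [w] would give [c] as the square of a quotient. *)
Lemma qform_nonsquare v w c : c != 0 -> ~ (exists y, c = y ^+ 2) ->
  (forall S, S^T = S -> lambda (qform S v) = lambda (c * qform S w)) -> w = 0.
Proof.
move=> c0 nsq e; apply/colP => i; rewrite mxE; apply/eqP; apply: contra_notT nsq => wi.
exists (v i 0 / w i 0); have := qform_eq_coef e i i; rewrite eqxx /= !mulr1n => h.
by rewrite expr_div_n expr2 h expr2 mulfK // mulf_neq0.
Qed.

End SeparateCharacters.

(* The next definitions mention the action of the matrix group itself. *)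
Transparent GLn.

Section EvenFunctions.
Variables (Fq : finFieldType) (F : fieldType) (m : nat).
Local Notation n := m.+1.
Local Notation gT := (GLn Fq m).
Implicit Types (g h : gT) (v w : 'cV[Fq]_n) (f : Nfun Fq m F) (lambda : Fq -> F).

Definition xact lambda (g : gT) f : Nfun Fq m F := X_act lambda g f.
Opaque GLn.

Definition drg (g : gT) : 'M[Fq]_n := drsubmx (gmx g).
(** The argument of [lambda] in the action of [g] on [E_v]. *)
Definition phase (g : gT) v : Fq := sform (vact g (inN v)) (inN (drg g *m v)).

Lemma xactE lambda g f v : g \in SpM Fq m ->
  xact lambda g f (drg g *m v) = f v * lambda (phase g v).
Proof.
move=> gM; rewrite /xact /X_act sum_ffunE (bigD1 v) //= big1 ?addr0 => [|w wv].
  by rewrite !ffunE actN_mx eqxx; apply: mulr1.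
rewrite !ffunE actN_mx -[drsubmx _]/(drg g).
rewrite (can_eq (mulKmx (dr_unit gM))) eq_sym (negPf wv).
exact: mulr0.
Qed.

Lemma phaseN g v : phase g (- v) = phase g v.
Proof.
have inN_opp w : inN (- w) = - inN w by rewrite !inNE opp_col_mx oppr0.
rewrite /phase mulmxN !inN_opp vactN /sform.
by rewrite [(- _)^T]linearN /= mulmxN !mulNmx opprK.
Qed.

Lemma phase_rad S v : S^T = S -> phase (rad S) v = qform S v.
Proof.
move=> sS; rewrite /phase /drg !inNE vact_col mx_rad block_mxKur block_mxKdr.
rewrite !mulmx0 !add0r mul1mx sformE !col_mxKu !col_mxKd mulmx0 subr0 trmx_mul sS.
by rewrite /qform.
Qed.

Lemma drg_rad S : drg (rad S) = 1%:M.
Proof. by rewrite /drg mx_rad block_mxKdr. Qed.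

Lemma drg_emb D : D \in unitmx -> drg (emb D) = D.
Proof. exact: dr_emb. Qed.

Lemma phase_emb D v : D \in unitmx -> phase (emb D) v = 0.
Proof.
move=> uD; rewrite /phase (drg_emb uD) vact_emb // !inNE sformE.
by rewrite !col_mxKu trmx0 mul0mx mulmx0 subrr mxE.
Qed.

Lemma xact_rad lambda S f v : S^T = S ->
  xact lambda (rad S) f v = f v * lambda (qform S v).
Proof.
move=> sS; rewrite -{1}[v](mul1mx v) -(drg_rad S) xactE ?phase_rad //.
exact/Sp_fixM_M/rad_fixM.
Qed.

(** A set of representatives for the nonzero vectors up to sign. *)
Definition sign_rep v : bool := (v != 0) && (enum_rank v <= enum_rank (- v))%N.
Definition rep v : 'cV[Fq]_n := if sign_rep v then v else - v.

Lemma sign_rep_neq0 v : sign_rep v -> v != 0.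
Proof. by case/andP. Qed.

Lemma rep_sign_rep v : v != 0 -> sign_rep (rep v).
Proof.
move=> v0; rewrite /rep; case hv: (sign_rep v) => //.
rewrite /sign_rep oppr_eq0 v0 opprK; move/negbT: hv.
by rewrite /sign_rep v0 /= -ltnNge => /ltnW.
Qed.

Lemma rep_id v : sign_rep v -> rep v = v.
Proof. by rewrite /rep => ->. Qed.

Lemma repN v : rep (- v) = rep v.
Proof.
rewrite /rep opprK; have [v0|v0] := eqVneq v 0.
  by rewrite v0 oppr0.
case hv: (sign_rep v); case hw: (sign_rep (- v)) => //.
  move: hv hw; rewrite /sign_rep opprK => /andP[_ le1] /andP[_ le2].
  by apply: enum_rank_inj; apply: val_inj; apply/eqP; rewrite eqn_leq le1 le2.
by have := rep_sign_rep v0; rewrite /rep hv hw.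
Qed.

Lemma repP v : rep v = v \/ rep v = - v.
Proof. by rewrite /rep; case: ifP; [left|right]. Qed.

(** This is [E_v + E_{-v}] for odd [q] and [E_v] for even [q], so that both parities
    can be treated together. *)
Definition Epm v : Nfun Fq m F := [ffun w => ((w == v) || (w == - v))%:R].

Definition even_fun f : Prop := f 0 = 0 /\ forall v, f (- v) = f v.

Lemma even_funD c f1 f2 : even_fun f1 -> even_fun f2 -> even_fun (c *: f1 + f2).
Proof.
move=> [z1 e1] [z2 e2]; split=> [|v]; rewrite !ffunE; first by rewrite z1 z2 scaler0 addr0.
by rewrite e1 e2.
Qed.

Lemma even_fun0 : even_fun 0.
Proof. by split=> [|v]; rewrite !ffunE. Qed.

Lemma Epm_even v : v != 0 -> even_fun (Epm v).
Proof.
move=> v0; split=> [|w]; rewrite !ffunE.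
  by rewrite eq_sym (negPf v0) eq_sym oppr_eq0 (negPf v0).
by rewrite eqr_oppLR eqr_opp orbC.
Qed.

Lemma Epm_neq0 v : Epm v != 0.
Proof. by apply/eqP => /ffunP/(_ v)/eqP; rewrite !ffunE eqxx oner_eq0. Qed.

Lemma opp_char2 v : 2 \in [pchar Fq] -> - v = v.
Proof. by move=> c2; apply/colP => i; rewrite mxE oppr_pchar2. Qed.

Lemma opp_fixed v : 2 \notin [pchar Fq] -> v != 0 -> (v == - v) = false.
Proof.
move=> c2 v0; apply: contraNF v0 => /eqP e; apply/eqP/colP => i; rewrite mxE.
have /eqP := congr1 (fun w : 'cV_n => w i 0) e; rewrite mxE -addr_eq0 -mulr2n -mulr_natl mulf_eq0.
have two : 2%:R != 0 :> Fq by move: c2; rewrite inE.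
by rewrite (negPf two) => /eqP.
Qed.

Lemma Epm_E v : v != 0 -> Epm v = if 2 \in [pchar Fq] then Eb F v else Eb F v + Eb F (- v).
Proof.
move=> v0; apply/ffunP => w; have [c2|c2] := boolP (2 \in [pchar Fq]); rewrite !ffunE.
  by rewrite opp_char2 // orbb.
have [->|wv] := eqVneq w v; first by rewrite opp_fixed // addr0.
by rewrite add0r.
Qed.

Lemma X_plusE : X_plus Fq m F = <<[seq Epm v | v : 'cV[Fq]_n in predC1 0%R]>>%VS.
Proof.
rewrite /X_plus; case: ifP => c2; congr <<_>>%VS; apply/eq_in_map => v;
  by rewrite mem_enum => v0; rewrite Epm_E ?c2.
Qed.

Lemma Epm_X v : v != 0 -> Epm v \in X_plus Fq m F.
Proof.
by move=> v0; rewrite X_plusE; apply/memv_span/map_f; rewrite mem_enum.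
Qed.

Lemma even_fun_sum f : even_fun f -> f = \sum_(v | sign_rep v) f v *: Epm v.
Proof.
move=> [f0 fN]; apply/ffunP => w; rewrite sum_ffunE.
have [->|w0] := eqVneq w 0.
  rewrite f0 big1 // => v /sign_rep_neq0 v0; have [e _] := Epm_even v0.
  by rewrite ffunE e scaler0.
rewrite (bigD1 (rep w)) ?rep_sign_rep //= big1 ?addr0 => [|v /andP[hv vw]].
  rewrite !ffunE; have [->|->] := repP w; first by rewrite eqxx /= [_ *: _]mulr1.
  by rewrite opprK eqxx orbT fN [_ *: _]mulr1.
rewrite !ffunE; case: eqP => [wv|_].
  by rewrite wv rep_id ?eqxx in vw.
case: eqP => [wv|_]; last exact: mulr0.
by rewrite wv repN rep_id ?eqxx in vw.
Qed.

Lemma X_plusP f : f \in X_plus Fq m F <-> even_fun f.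
Proof.
split=> [|ef]; last first.
  rewrite (even_fun_sum ef); apply: memv_suml => v /sign_rep_neq0 v0.
  exact/memvZ/Epm_X.
rewrite X_plusE; move: f; apply: span_ind => [|c x y|x /mapP[v + ->]]; first exact: even_fun0.
  exact: even_funD.
by rewrite mem_enum; apply: Epm_even.
Qed.

Lemma xact_even lambda g f : g \in SpM Fq m -> even_fun f -> even_fun (xact lambda g f).
Proof.
move=> gM [f0 fN]; split=> [|w].
  by rewrite -[X in xact _ _ _ X](mulmx0 _ (drg g)) xactE // f0 mul0r.
rewrite -[w](mulKVmx (dr_unit gM)) -mulmxN !xactE //.
by rewrite fN phaseN.
Qed.

Lemma xact_emb_Epm lambda D v : linear_character lambda -> D \in unitmx ->
  xact lambda (emb D) (Epm v) = Epm (D *m v).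
Proof.
move=> lc uD; apply/ffunP => w; rewrite -[w](mulKVmx uD).
have := xactE lambda (Epm v) (invmx D *m w) (emb_M uD).
rewrite drg_emb // => ->; rewrite phase_emb // lambda0 // mulr1.
by rewrite !ffunE !mulKVmx // -mulmxN !(can2_eq (mulKVmx uD) (mulKmx uD)).
Qed.

(** A column is a multiple of the first column of its extended column basis. *)
Lemma extend_vector v : v != 0 ->
  exists2 D : 'M[Fq]_n, D \in unitmx & D *m delta_mx ord_max 0 = v.
Proof.
move=> v0; pose C := col_ebase v; have uC : C \in unitmx := col_ebase_unit v.
have r1 : \rank v = 1%N.
  by apply/eqP; rewrite eqn_leq rank_leq_col lt0n mxrank_eq0.
have vE : v = C *m (row_ebase v 0 0 *: delta_mx ord0 0).
  rewrite -{1}[v]mulmx_ebase r1 -mulmxA; congr (_ *m _).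
  rewrite [row_ebase v]mx11_scalar mul_mx_scalar mxE; congr (_ *: _).
  by apply/matrixP => i j; rewrite !mxE !ord1 eqxx andbT; case: i => [[|i] ?].
have c0 : row_ebase v 0 0 != 0.
  by apply: contraNneq v0 => c0; rewrite vE c0 scale0r mulmx0.
pose P : 'M[Fq]_n := perm_mx (tperm ord0 ord_max).
exists (row_ebase v 0 0 *: (C *m P)).
  by rewrite unitmxZ ?unitfE // unitmx_mul uC unitmx_perm.
rewrite [RHS]vE -scalemxAl -scalemxAr -mulmxA; congr (_ *: (_ *m _)).
apply/colP => i; rewrite -colE !mxE andbT; congr (_%:R); congr nat_of_bool.
by rewrite (can2_eq (tpermK _ _) (tpermK _ _)) tpermR.
Qed.

Lemma transitive_vectors v w : v != 0 -> w != 0 ->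
  exists2 D : 'M[Fq]_n, D \in unitmx & D *m v = w.
Proof.
move=> /extend_vector[D uD <-] /extend_vector[D' uD' <-].
exists (D' *m invmx D); first by rewrite unitmx_mul unitmx_inv uD uD'.
by rewrite mulmxA mulmxKV.
Qed.

Section Irreducibility.
Variable lambda : Fq -> F.
Hypothesis lambda_char : linear_character lambda.
Hypothesis lambda_nontriv : nontrivial_character lambda.
Variable U : {vspace Nfun Fq m F}.
Hypothesis U_even : (U <= X_plus Fq m F)%VS.
Hypothesis U_stable : forall g f, g \in SpM Fq m -> f \in U -> xact lambda g f \in U.

(** A vector of smallest support in a submodule is supported on a pair of
    opposite vectors, since the unipotent radical separates such pairs. *)
Lemma submodule_Epm f : f \in U -> f != 0 -> exists2 v, v != 0 & Epm v \in U.
Proof.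
have [k] := ubnP #|[pred v | f v != 0]|; elim: k f => // k IH f.
rewrite ltnS => sf fU fn0.
have ef : even_fun f by apply/X_plusP/(subvP U_even).
have [v fv] : exists v, f v != 0.
  apply/existsP; apply: contraNT fn0 => /existsPn f0; apply/eqP/ffunP => v.
  by rewrite ffunE; apply/eqP; have := f0 v; rewrite negbK.
have v0 : v != 0 by apply: contraNneq fv => ->; case: ef => ->.
have [/existsP[w /and3P[fw wv wnv]]|/existsPn supp] :=
  boolP [exists w, [&& f w != 0, w != v & w != - v]].
  have [S sS lS] : exists2 S, S^T = S & lambda (qform S v) != lambda (qform S w).
    have [/existsP[S /andP[/eqP sS lS]]|/existsPn nS] :=
      boolP [exists S : 'M[Fq]_n, (S^T == S) && (lambda (qform S v) != lambda (qform S w))].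
      by exists S.
    suff [e|e] : v = w \/ v = - w by rewrite e ?opprK ?eqxx in wv wnv.
    apply: (qform_sep lambda_char lambda_nontriv) => S sS.
    by have := nS S; rewrite sS eqxx /= negbK => /eqP.
  pose f' := xact lambda (rad S) f - lambda (qform S w) *: f.
  have fE u : f' u = f u * (lambda (qform S u) - lambda (qform S w)).
    by rewrite 3!ffunE xact_rad // mulrBr [in RHS](mulrC (f u) (lambda (qform S w))).
  have f'U : f' \in U.
    by apply: rpredB; [apply: U_stable => //; apply/Sp_fixM_M/rad_fixM | apply: memvZ].
  apply: (IH f') => //; last first.
    apply/eqP => /ffunP/(_ v)/eqP; rewrite fE ffunE mulf_eq0 (negPf fv) /=.
    by rewrite subr_eq0 (negPf lS).
  apply: leq_trans sf; apply: proper_card; apply/properP; split.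
    by apply/subsetP => u; rewrite !inE fE mulf_eq0 negb_or => /andP[].
  by exists w; rewrite !inE ?fw // fE subrr mulr0 eqxx.
exists v => //; have -> : Epm v = (f v)^-1 *: f; last exact: memvZ.
apply/ffunP => w; rewrite !ffunE.
have [->|wv] := eqVneq w v; first by rewrite /= [RHS]mulVf.
have [->|wnv] := eqVneq w (- v).
  by case: ef => _ ->; rewrite /= [RHS]mulVf.
by have := supp w; rewrite wv wnv !andbT negbK => /eqP ->; rewrite /= [RHS]mulr0.
Qed.

(** A nonzero submodule contains one of the spanning vectors, hence all of them by
    transitivity of the Levi factor. *)
Lemma X_plus_irreducible : U = 0%VS \/ U = X_plus Fq m F.
Proof.
have [->|U0] := eqVneq U 0%VS; [by left | right].
have [||v v0 vU] := @submodule_Epm (vpick U); first exact: memv_pick.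
  by rewrite vpick0.
apply/eqP; rewrite eqEsubv U_even X_plusE; apply/span_subvP => _ /mapP[w + ->].
rewrite mem_enum => w0; have [D uD <-] := transitive_vectors v0 w0.
by rewrite -(xact_emb_Epm _ lambda_char) // U_stable ?emb_M.
Qed.

End Irreducibility.

(** On the coordinate of [f] at [w] the group [Sp^M] acts by the form of [w] scaled by
    [kappa], and [qform_nonsquare] compares it with the form of [v]. *)
Lemma no_common_eigenvector lambda kappa f v :
  linear_character lambda -> nontrivial_character lambda ->
  kappa != 0 -> ~ (exists y, kappa = y ^+ 2) -> f 0 = 0 ->
  (forall S, S^T = S ->
    xact (twist_character lambda kappa) (rad S) f = lambda (qform S v) *: f) -> f = 0.
Proof.
move=> lc ln k0 nsq f0 fS; apply/ffunP => w; rewrite [RHS]ffunE.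
apply/eqP; apply: contraT => fw.
suff w0 : w = 0 by rewrite w0 f0 eqxx in fw.
apply: (qform_nonsquare lc ln (v := v) k0 nsq) => S sS.
have /ffunP/(_ w) := fS S sS; rewrite xact_rad // ffunE /twist_character.
by rewrite [_ *: _]mulrC => /(mulfI fw).
Qed.

End EvenFunctions.

(** * Copies of the even functions in the Steinberg module *)

Section GroupAlgebra.
Variables (G : finGroupType) (F : fieldType).
Local Notation GA := (group_algebra G F).

Lemma ga_leftM g h (x : GA) : ga_left (g * h)%g x = ga_left g (ga_left h x).
Proof. by apply/ffunP => k; rewrite !ga_leftE invMg mulgA. Qed.

Lemma ga_leftD g (x y : GA) : ga_left g (x + y) = ga_left g x + ga_left g y.
Proof. by apply/ffunP => k; rewrite ga_leftE ffunE [RHS]ffunE !ga_leftE. Qed.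

Lemma ga_leftZ g c (x : GA) : ga_left g (c *: x) = c *: ga_left g x.
Proof. by apply/ffunP => k; rewrite ga_leftE ffunE [RHS]ffunE ga_leftE. Qed.

Lemma ga_left0 g : ga_left g (0 : GA) = 0.
Proof. by rewrite -[0 in LHS](scale0r 0) ga_leftZ scale0r. Qed.

Lemma ga_left_sum (I : Type) (r : seq I) (P : pred I) (E : I -> GA) g :
  ga_left g (\sum_(i <- r | P i) E i) = \sum_(i <- r | P i) ga_left g (E i).
Proof. exact: (big_morph _ (ga_leftD g) (ga_left0 g)). Qed.

Lemma ga_leftK g : cancel (@ga_left G F g) (ga_left g^-1%g).
Proof. by move=> x; rewrite -ga_leftM mulVg; apply/ffunP => k; rewrite ga_leftE invg1 mul1g. Qed.

Lemma ga_left_eq0 g (x : GA) : ga_left g x = 0 -> x = 0.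
Proof. by move=> e; rewrite -[x](ga_leftK g) e ga_left0. Qed.

Lemma ga_mul_sum_subset (I : finType) (W : {set I}) (c : I -> F) (f : I -> G)
    (B : {set G}) (x : G) :
  ga_mul (\sum_(w in W) c w *: ga_delta F (f w)) (\sum_(b in B) ga_delta F b) x =
  \sum_(w in W) c w * (((f w)^-1 * x)%g \in B)%:R.
Proof.
have dB y : (\sum_(b in B) ga_delta F b) y = (y \in B)%:R.
  rewrite sum_ffunE; have [yB|yB] := boolP (y \in B).
    rewrite (bigD1 y) //= big1 ?addr0 => [|b /andP[_ /negPf by_]]; rewrite ffunE ?eqxx //.
    by rewrite eq_sym by_.
  by rewrite big1 // => b bB; rewrite ffunE; case: eqP bB yB => // -> ->.
rewrite ffunE; under eq_bigr => h _ do rewrite sum_ffunE dB mulr_suml.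
rewrite exchange_big; apply: eq_bigr => w _ /=.
rewrite (bigD1 (f w)) //= big1 ?addr0 => [|h /negPf hw]; rewrite !ffunE.
  by rewrite eqxx [_ *: 1]mulr1.
by rewrite hw [_ *: 0]mulr0 mul0r.
Qed.

End GroupAlgebra.

Section Embedding.
Variables (Fq : finFieldType) (F : fieldType) (m : nat).
Local Notation n := m.+1.
Local Notation gT := (GLn Fq m).
Local Notation GA := (group_algebra gT F).
Variable nw : coset_of (Torus Fq m) -> gT.

Transparent GLn.

Definition St : {vspace GA} := Steinberg F nw.
Definition gleft (g : gT) (x : GA) : GA := ga_left g x.

Lemma Steinberg_eltE : Steinberg_elt F nw = est F nw.
Proof.
apply/ffunP => x; rewrite /Steinberg_elt (ga_mul_sum_subset (G := gT)) [RHS]ffunE.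
by apply: eq_bigr => w _; rewrite -Bgrp_Borel.
Qed.

Lemma SteinbergE : St = <<[seq gleft g (est F nw) | g in SpG Fq m]>>%VS.
Proof. by rewrite -Steinberg_eltE. Qed.

Opaque GLn.

Hypothesis nwP : forall w, w \in WeylG Fq m -> nw w \in WeylLift Fq m /\ coset (Torus Fq m) (nw w) = w.
Hypothesis card_Fq : #|Fq|%:R = -1 :> F.
Variable lambda : Fq -> F.
Hypothesis lambda_char : linear_character lambda.
Implicit Types (g h x y u : gT) (D : 'M[Fq]_n) (v w : 'cV[Fq]_n).
Local Notation fvec := (fvec nw lambda).
Local Notation psi := (psi lambda).
Local Notation last := (delta_mx ord_max 0 : 'cV[Fq]_n).

Lemma gleft_est_St g : g \in SpG Fq m -> gleft g (est F nw) \in St.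
Proof. by move=> gS; rewrite SteinbergE; apply/memv_span/map_f; rewrite mem_enum. Qed.

Lemma fvec_sum : fvec = \sum_(u in Unip Fq m) psi u *: gleft u^-1%g (est F nw).
Proof.
apply/ffunP => x; rewrite ffunE sum_ffunE; apply: eq_bigr => u _.
by rewrite [RHS]ffunE /gleft ga_leftE invgK.
Qed.

Lemma gleft_fvec_St g : g \in SpG Fq m -> gleft g fvec \in St.
Proof.
move=> gS; rewrite fvec_sum /gleft ga_left_sum; apply: memv_suml => u uU.
rewrite ga_leftZ -ga_leftM; apply: memvZ; apply: gleft_est_St.
by rewrite Sp_mul ?Sp_inv //; apply/Borel_Sp/Unip_Borel.
Qed.

(** Some invertible matrix sending the last basis vector to [v]. *)
Definition frame v : 'M[Fq]_n :=
  odflt 1%:M [pick D : 'M[Fq]_n | (D \in unitmx) && (D *m last == v)].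

Lemma frameP v : v != 0 -> frame v \in unitmx /\ frame v *m last = v.
Proof.
move=> /extend_vector[D uD Dv]; rewrite /frame.
case: pickP => [D' /andP[uD' /eqP //]|/(_ D)]; by rewrite uD Dv eqxx.
Qed.

(** The image of [E_v + E_{-v}] under the embedding to be constructed. *)
Definition line_vec v : GA := gleft (emb (frame v)) fvec.

Lemma line_vec_St v : v != 0 -> line_vec v \in St.
Proof. by move=> v0; apply: gleft_fvec_St; apply: emb_Sp; case: (frameP v0). Qed.

Lemma line_vec_neq0 v : line_vec v <> 0.
Proof. by move/ga_left_eq0 => e; have := fvec_neq0 nwP lambda_char; rewrite e eqxx. Qed.

Lemma gleft_fix g : fixes nw lambda g -> gleft g fvec = fvec.
Proof.
move=> gf; apply/ffunP => x; rewrite /gleft ga_leftE -[in RHS](mulKVg g x).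
by rewrite gf.
Qed.

Lemma gleft_fixM u : u \in SpfM Fq m -> gleft u fvec = psi u *: fvec.
Proof.
move=> uM; apply/ffunP => x; rewrite /gleft ga_leftE [RHS]ffunE.
have := fvec_fixM nw lambda_char (u^-1 * x)%g uM; rewrite mulKVg => ->.
by apply/esym/mulVKf/psi_neq0.
Qed.

Lemma psi_sform u : psi u = lambda (sform (vact u (vb Fq ord_max)) (vb Fq ord_max)).
Proof.
have sE (y : 'cV[Fq]_(n + n)) : sform y (vb Fq ord_max) = y (lshift n (ord_max : 'I_n)) 0.
  rewrite sformE /vb col_mxKd col_mxKu mulmx0 subr0 !mxE (bigD1 ord_max) //= big1 => [|j jm].
    by rewrite !mxE eqxx mulr1 addr0.
  by rewrite !mxE (negPf jm) mulr0.
by rewrite sE vact_vb.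
Qed.

(** A vector attached to [v] is carried to the one attached to [g v], up to the
    phase of [g], because the stabilizer of the last vector up to sign fixes
    [fvec] and the unipotent radical acts on it by its character. *)
Lemma gleft_line_vec g v : g \in SpM Fq m -> v != 0 ->
  gleft g (line_vec v) = lambda (phase g v) *: line_vec (rep (drg g *m v)).
Proof.
move=> gM v0; have uG : drg g \in unitmx := dr_unit gM.
have gv0 : drg g *m v != 0.
  by apply: contraNneq v0 => e; rewrite -[v](mulKmx uG) e mulmx0.
set w := rep _; have w0 : w != 0 by apply: sign_rep_neq0 (rep_sign_rep gv0).
have [uD Dv] := frameP v0; have [uD' Dw] := frameP w0.
set D := frame v in uD Dv; set D' := frame w in uD' Dw.
have [e we e2] : exists2 e : Fq, w = e *: (drg g *m v) & e ^+ 2 = 1.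
  case: (repP (drg g *m v)) => we; [exists 1 | exists (-1)]; rewrite ?scale1r ?scaleN1r //.
    by rewrite expr1n.
  by rewrite sqrrN expr1n.
have ee : e * e = 1 by rewrite -expr2.
pose K := invmx D' *m (drg g *m D).
have uK : K \in unitmx by rewrite !unitmx_mul unitmx_inv uD' uG uD.
have Kl : K *m last = e *: last.
  rewrite -!mulmxA Dv; have -> : drg g *m v = e *: w by rewrite we scalerA ee scale1r.
  by rewrite -Dw -scalemxAr mulKmx.
have Kfix : fixes nw lambda (emb K).
  apply: (fixes_emb nwP card_Fq lambda_char uK e2) => i.
  have /colP/(_ i) := Kl; rewrite -colE !mxE andbT => ->.
  by rewrite mulr_natr.
have [s sE] : exists s, s = ((emb D')^-1 * g * emb D * (emb K)^-1)%g by eexists.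
have gE : (g * emb D = emb D' * s * emb K)%g.
  by rewrite sE !mulgA mulgKV mulgV mul1g.
have iK := embV uK; have iD' := embV uD'.
have uiK : invmx K \in unitmx by rewrite unitmx_inv.
have uiD' : invmx D' \in unitmx by rewrite unitmx_inv.
have sM : s \in SpfM Fq m.
  rewrite sE -iK -iD'; apply: Sp_fixM_of_dr; first by rewrite !Sp_M_mul ?emb_M.
  rewrite !dr_mul ?Sp_M_mul ?emb_M // !dr_emb //.
  by rewrite -[drsubmx (gmx g)]/(drg g) -(mulmxA (invmx D')) mulmxV.
rewrite /line_vec /gleft -ga_leftM gE !ga_leftM -/(gleft (emb K) _) gleft_fix //.
rewrite -/(gleft s _) gleft_fixM // ga_leftZ; congr (_ *: _).
rewrite psi_sform; congr lambda.
have vbE' : vb Fq ord_max = inN last by rewrite inNE.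
rewrite -(sform_Sp _ _ (emb_Sp uD')) -vactM vbE' vact_emb // Dw.
rewrite sE !mulgA mulgV mul1g -iK !vactM vact_emb //.
have Kil : invmx K *m last = e *: last.
  rewrite -[last in LHS]scale1r -ee -scalerA -Kl -scalemxAr mulKmx //.
have inNZ (c : Fq) (u : 'cV[Fq]_n) : inN (c *: u) = c *: inN u.
  by rewrite !inNE scale_col_mx scaler0.
rewrite Kil inNZ /vact -scalemxAr -/(vact (emb D) _) vact_emb // Dv -scalemxAr -/(vact g _).
rewrite we inNZ /phase /sform [(_ *: _)^T]linearZ /= -!scalemxAl -!scalemxAr scalerA ee scale1r.
by [].
Qed.

(** Half the basis suffices to define the embedding on even functions, in every
    characteristic of [F]. *)
Definition Phi (f : Nfun Fq m F) : GA := \sum_(v | sign_rep v) f v *: line_vec v.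

Lemma Phi_linear : linear Phi.
Proof.
move=> c f1 f2; rewrite /Phi scaler_sumr -big_split; apply: eq_bigr => v _.
by rewrite !ffunE scalerDl scalerA.
Qed.

HB.instance Definition _ := GRing.isLinear.Build F (Nfun Fq m F) GA *:%R Phi Phi_linear.

Lemma Phi_St f : Phi f \in St.
Proof. by apply: memv_suml => v /sign_rep_neq0 v0; apply/memvZ/line_vec_St. Qed.

Lemma Phi_Epm v : sign_rep v -> Phi (Epm F v) = line_vec v.
Proof.
move=> hv; rewrite /Phi (bigD1 v) //= big1 ?addr0 => [|w /andP[hw wv]].
  by rewrite ffunE eqxx scale1r.
rewrite ffunE (negPf wv); case: eqP => [e|_]; last by rewrite scale0r.
by rewrite -(rep_id hw) e repN rep_id ?eqxx in wv.
Qed.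

Lemma Phi_equivariant g f : g \in SpM Fq m -> even_fun f ->
  Phi (xact lambda g f) = gleft g (Phi f).
Proof.
move=> gM fe; have uG : drg g \in unitmx := dr_unit gM.
have [_ gfN] := xact_even lambda gM fe.
have rep_mul (M : 'M[Fq]_n) v : rep (M *m rep v) = rep (M *m v).
  by case: (repP v) => ->; rewrite ?mulmxN ?repN.
have half_rep v : sign_rep (rep v) = (v != 0).
  have [->|v0] := eqVneq v 0; last by rewrite rep_sign_rep.
  by rewrite /rep oppr0 if_same /sign_rep eqxx.
rewrite /gleft ga_left_sum.
rewrite /Phi (reindex_onto (fun v => rep (drg g *m v)) (fun w => rep (invmx (drg g) *m w))) /=.
  have condE v : sign_rep (rep (drg g *m v)) && (rep (invmx (drg g) *m rep (drg g *m v)) == v) = sign_rep v.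
    rewrite half_rep rep_mul mulKmx //.
    have -> : (drg g *m v != 0) = (v != 0).
      by congr (~~ _); apply/eqP/eqP => [e|->]; rewrite ?mulmx0 // -[v](mulKmx uG) e mulmx0.
    apply/andP/idP => [[v0 /eqP <-]|hv]; first by rewrite half_rep.
    by rewrite rep_id // sign_rep_neq0.
  apply: eq_big => // v; rewrite condE => hv.
  rewrite ga_leftZ -/(gleft g _) gleft_line_vec ?sign_rep_neq0 // scalerA; congr (_ *: _).
  rewrite -xactE //; case: (repP (drg g *m v)) => -> //; exact: gfN.
by move=> w hw; rewrite rep_mul mulKVmx // rep_id.
Qed.

Definition steinberg_copy : {vspace GA} := (linfun Phi @: X_plus Fq m F)%VS.

Lemma PhiE f : linfun Phi f = Phi f.
Proof. by rewrite lfunE. Qed.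

Lemma copy_sub_St : (steinberg_copy <= St)%VS.
Proof. by apply/subvP => _ /memv_imgP[f _ ->]; rewrite PhiE Phi_St. Qed.

Lemma copy_stable g (x : GA) : g \in SpM Fq m -> x \in steinberg_copy -> gleft g x \in steinberg_copy.
Proof.
move=> gM /memv_imgP[f fX ->]; have fe := (X_plusP f).1 fX.
rewrite PhiE -Phi_equivariant // -PhiE memv_img //.
by apply/X_plusP; apply: xact_even.
Qed.

Section Nontrivial.
Hypothesis lambda_nontriv : nontrivial_character lambda.

Lemma preimage_stable (U : {vspace GA}) :
  (forall g (x : GA), g \in SpM Fq m -> x \in U -> gleft g x \in U) ->
  let K := (X_plus Fq m F :&: linfun Phi @^-1: U)%VS in
  K = 0%VS \/ K = X_plus Fq m F.
Proof.
move=> Ustab K; apply: (X_plus_irreducible lambda_char lambda_nontriv) => [|g f gM].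
  exact: capvSl.
rewrite !memv_cap -!memv_preim !PhiE => /andP[/X_plusP fe fU].
rewrite Phi_equivariant // Ustab // andbT.
by apply/X_plusP; apply: xact_even.
Qed.

Lemma last_neq0 : last != 0.
Proof. by apply/eqP => /colP/(_ ord_max)/eqP; rewrite !mxE !eqxx oner_eq0. Qed.

Lemma Phi_inj : (X_plus Fq m F :&: lker (linfun Phi) = 0)%VS.
Proof.
rewrite -lpreim0; have [g x gM|//|e] := @preimage_stable 0%VS.
  by rewrite !memv0 => /eqP ->; rewrite /gleft ga_left0.
have hl := rep_sign_rep last_neq0.
have : Epm F (rep last) \in (X_plus Fq m F :&: linfun Phi @^-1: 0)%VS.
  by rewrite e Epm_X // sign_rep_neq0.
rewrite memv_cap -memv_preim PhiE Phi_Epm // memv0 => /andP[_ /eqP].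
by move/line_vec_neq0.
Qed.

Lemma copy_iso : iso_module (SpM Fq m) (xact lambda) (X_plus Fq m F) gleft steinberg_copy.
Proof.
exists (linfun Phi); split=> // [|g f gM /X_plusP fe]; first exact: Phi_inj.
by rewrite !PhiE Phi_equivariant.
Qed.

Lemma copy_irreducible : irreducible_module (SpM Fq m) gleft steinberg_copy.
Proof.
split=> [g x||U' U'c U'stab]; first exact: copy_stable.
  apply/eqP => c0; have hl := rep_sign_rep last_neq0.
  have : linfun Phi (Epm F (rep last)) \in steinberg_copy by rewrite memv_img ?Epm_X ?sign_rep_neq0.
  by rewrite c0 memv0 PhiE Phi_Epm // => /eqP/line_vec_neq0.
have inK (x : GA) : x \in U' -> exists2 f, f \in (X_plus Fq m F :&: linfun Phi @^-1: U')%VS & x = linfun Phi f.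
  move=> xU; have /memv_imgP[f fX xE] := subvP U'c _ xU.
  by exists f; rewrite // memv_cap fX -memv_preim -xE.
have [|K0|KX] := @preimage_stable U'; first exact: U'stab.
  left; apply/eqP; rewrite -subv0; apply/subvP => x /inK[f + ->].
  by rewrite K0 memv0 => /eqP ->; rewrite linear0 mem0v.
right; apply/eqP; rewrite eqEsubv U'c; apply/subvP => _ /memv_imgP[f fX ->].
by move: fX; rewrite -KX memv_cap -memv_preim => /andP[].
Qed.

End Nontrivial.
End Embedding.

Section TwoCopies.
Variables (Fq : finFieldType) (F : fieldType) (m : nat).
Local Notation n := m.+1.
Local Notation gT := (GLn Fq m).
Local Notation GA := (group_algebra gT F).
Variable nw : coset_of (Torus Fq m) -> gT.
Hypothesis nwP : forall w, w \in WeylG Fq m -> nw w \in WeylLift Fq m /\ coset (Torus Fq m) (nw w) = w.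
Hypothesis card_Fq : #|Fq|%:R = -1 :> F.
Variables (lambda : Fq -> F) (kappa : Fq).
Hypothesis lambda_char : linear_character lambda.
Hypothesis lambda_nontriv : nontrivial_character lambda.
Hypothesis kappa_neq0 : kappa != 0.
Hypothesis kappa_nonsquare : ~ (exists y, kappa = y ^+ 2).
Local Notation lambdak := (twist_character lambda kappa).
Local Notation last := (delta_mx ord_max 0 : 'cV[Fq]_n).

Lemma twist_char : linear_character lambdak.
Proof.
have [l0 lD] := lambda_char; split=> [x|x y]; first exact: l0.
by rewrite /twist_character mulrDr lD.
Qed.

Lemma twist_nontriv : nontrivial_character lambdak.
Proof.
have [x lx] := lambda_nontriv; exists (x / kappa).
by rewrite /twist_character mulrC divfK.
Qed.

Lemma xact_rad_Epm S (v : 'cV[Fq]_n) : S^T = S ->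
  xact lambda (rad S) (Epm F v) = lambda (qform S v) *: Epm F v.
Proof.
move=> sS; apply/ffunP => w; rewrite xact_rad // !ffunE.
have [->|wv] := eqVneq w v; first by rewrite mul1r [RHS]mulr1.
have [->|wnv] := eqVneq w (- v); first by rewrite qformN mul1r [RHS]mulr1.
by rewrite mul0r [RHS]mulr0.
Qed.

(** An isomorphism would carry [E_v + E_{-v}] to an eigenvector of [Sp^M] with the
    same character. *)
Lemma X_plus_not_iso : ~ iso_module (SpM Fq m) (xact lambda) (X_plus Fq m F)
  (xact lambdak) (X_plus Fq m F).
Proof.
case=> f [f_inj fX fG].
have EX : Epm F last \in X_plus Fq m F by rewrite Epm_X // last_neq0.
have := memv_img f EX; rewrite fX => /X_plusP[f0 _].
have fE0 : f (Epm F last) = 0.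
  apply: (no_common_eigenvector (v := last) lambda_char lambda_nontriv kappa_neq0) => // S sS.
  by rewrite -fG ?xact_rad_Epm ?linearZ //; apply/Sp_fixM_M/rad_fixM.
have : Epm F last \in (X_plus Fq m F :&: lker f)%VS by rewrite memv_cap EX memv_ker fE0 eqxx.
by rewrite f_inj memv0; apply/negP/Epm_neq0.
Qed.

Local Notation U1 := (steinberg_copy nw lambda).
Local Notation U2 := (steinberg_copy nw lambdak).

(** Otherwise the first copy, being irreducible, would lie in the second, and the
    image of [E_v + E_{-v}] would be an eigenvector of [Sp^M] in both. *)
Lemma copies_direct : directv (U1 + U2).
Proof.
apply/directv_addP.
have [_ _ irr] := copy_irreducible nwP card_Fq lambda_char lambda_nontriv.
have [||//|e] := irr (U1 :&: U2)%VS; first exact: capvSl.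
  move=> g x gM; rewrite !memv_cap => /andP[x1 x2].
  by rewrite !copy_stable //; apply: twist_char.
have hl := rep_sign_rep (last_neq0 Fq m); set v := rep last in hl.
have v0 : v != 0 := sign_rep_neq0 hl.
pose x : GA := Phi nw lambda (Epm F v).
have x1 : x \in U1 by rewrite /x -PhiE memv_img ?Epm_X.
have : x \in U2 by move: x1; rewrite -{1}e memv_cap => /andP[].
case/memv_imgP => f fX; rewrite PhiE => xE.
have fe := (X_plusP f).1 fX.
have inj := Phi_inj nwP card_Fq twist_char twist_nontriv.
have f0 : f = 0.
  apply: (no_common_eigenvector (v := v) lambda_char lambda_nontriv kappa_neq0) => //.
    by case: fe.
  move=> S sS; have rM : rad S \in SpM Fq m by apply/Sp_fixM_M/rad_fixM.
  apply/eqP; rewrite -subr_eq0 -memv0 -inj memv_cap memv_ker rpredB ?memvZ //=; last first.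
    by apply/X_plusP; apply: xact_even.
  rewrite linearB linearZ /= !PhiE (Phi_equivariant nwP card_Fq twist_char) // -xE.
  rewrite -(Phi_equivariant nwP card_Fq lambda_char) //; last exact: Epm_even.
  by rewrite xact_rad_Epm // -PhiE linearZ /= PhiE subrr.
have x0 : x = 0 by rewrite xE f0 linear0.
by move: x0; rewrite /x Phi_Epm // => /(line_vec_neq0 nwP lambda_char).
Qed.

End TwoCopies.

(** * Weil modules and the theorem *)

Lemma iso_module_eq (gT : finGroupType) (K : fieldType) (V : vectType K) (G : {set gT})
    (r1 r2 : gT -> V -> V) (U1 U2 : {vspace V}) :
  U1 = U2 -> (forall g u, g \in G -> u \in U1 -> r1 g u = r2 g u) ->
  iso_module G r1 U1 r2 U2.
Proof.
move=> <- r12; exists \1%VF; split.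
- apply/eqP; rewrite -subv0; apply/subvP => u.
  by rewrite memv_cap memv_ker id_lfunE memv0 => /andP[].
- exact: lim1g.
- by move=> g u gG uU; rewrite !id_lfunE r12.
Qed.

Section WeilModules.
Variables (Fq : finFieldType) (F : fieldType) (m : nat).
Local Notation n := m.+1.
Implicit Types (g : {'GL_(n + n)[Fq]}) (lambda : Fq -> F) (f : Nfun Fq m F).

Lemma theta_sqr g : theta F g ^+ 2 = 1.
Proof. by rewrite /theta; case: ifP => _; rewrite ?sqrrN expr1n. Qed.

Lemma Y_act_X_act lambda g f : Y_act lambda g f = theta F g ^+ n *: X_act lambda g f.
Proof.
rewrite /Y_act /X_act scaler_sumr; apply: eq_bigr => v _.
by rewrite scalerA mulrCA.
Qed.

Lemma twist_Y_act lambda g f : twist (theta_n F) (Y_act lambda) g f = X_act lambda g f.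
Proof.
rewrite /twist Y_act_X_act scalerA /theta_n -exprD addnn -muln2 mulnC exprM theta_sqr.
by rewrite expr1n scale1r.
Qed.

Lemma X_plus_Y_plus : 2 \notin [pchar Fq] -> X_plus Fq m F = Y_plus Fq m F.
Proof. by rewrite /X_plus => /negPf ->. Qed.

Lemma theta_char2 g : 2 \in [pchar F] -> theta F g = 1.
Proof. by move=> c2; rewrite /theta; case: ifP => // _; rewrite oppr_pchar2. Qed.

Lemma Y_minus_Y_plus : 2 \in [pchar F] -> Y_minus Fq m F = Y_plus Fq m F.
Proof.
move=> c2; rewrite /Y_minus /Y_plus; congr <<_>>%VS; apply/eq_in_map => v _.
by apply/ffunP => w; rewrite !ffunE; congr (_ + _); apply: oppr_pchar2.
Qed.

Lemma card_sign_rep : 2 \notin [pchar Fq] ->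
  #|[pred v : 'cV[Fq]_n | sign_rep v]| = ((#|Fq| ^ n - 1) %/ 2)%N.
Proof.
move=> c2; pose H := [set v : 'cV[Fq]_n | sign_rep v].
have -> : #|[pred v : 'cV[Fq]_n | sign_rep v]| = #|H| by apply: eq_card => v; rewrite !inE.
pose N := [set - v | v in H].
have cN : #|N| = #|H| by apply/card_imset/oppr_inj.
have HN0 : H :&: N = set0.
  apply/eqP; rewrite -subset0; apply/subsetP => v; rewrite !inE => /andP[hv /imsetP[w]].
  rewrite inE => hw ve; have := rep_id hv; rewrite ve repN rep_id // => /eqP.
  by rewrite opp_fixed // sign_rep_neq0.
have HN : H :|: N = [set~ 0].
  apply/setP => v; rewrite !inE; apply/orP/idP => [[/sign_rep_neq0 //|/imsetP[w + ->]]|v0].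
    by rewrite inE oppr_eq0 => /sign_rep_neq0.
  have := rep_sign_rep v0; rewrite /rep; case: ifP => hv hv'; [by left | right].
  by apply/imsetP; exists (- v); rewrite ?inE ?opprK.
have := cardsUI H N; rewrite HN HN0 cards0 addn0 cN addnn cardsC1 card_mx muln1 subn1 => ->.
by rewrite -muln2 mulnK.
Qed.

Lemma dim_X_plus : 2 \notin [pchar Fq] -> \dim (X_plus Fq m F) = ((#|Fq| ^ n - 1) %/ 2)%N.
Proof.
move=> c2; rewrite -card_sign_rep //.
pose s := enum [pred v : 'cV[Fq]_n | sign_rep v].
have sz : size s = #|[pred v : 'cV[Fq]_n | sign_rep v]| by rewrite -cardE.
have hs (i : 'I_(size s)) : sign_rep (nth 0 s i).
  by have : nth 0 s i \in s := mem_nth 0 (ltn_ord i); rewrite mem_enum.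
have XE : X_plus Fq m F = <<[seq Epm F v | v <- s]>>%VS.
  apply/eqP; rewrite eqEsubv; apply/andP; split; last first.
    by apply/span_subvP => _ /mapP[v + ->]; rewrite mem_enum => /sign_rep_neq0; apply: Epm_X.
  apply/subvP => f /X_plusP /even_fun_sum ->; apply: memv_suml => v hv.
  by apply/memvZ/memv_span/map_f; rewrite mem_enum.
have fs : free [seq Epm F v | v <- s].
  suff : free (in_tuple [seq Epm F v | v <- s]) by [].
  apply/freeP => k sum0 i.
  have ltis : (i < size s)%N by have := ltn_ord i; rewrite {2}size_map.
  have /ffunP/(_ (nth 0 s i)) := sum0; rewrite sum_ffunE (bigD1 i) //= big1 ?addr0.
    rewrite !ffunE (nth_map 0) // ffunE eqxx /= => <-.
    by rewrite [RHS]mulr1.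
  move=> j ji; have ltjs : (j < size s)%N by have := ltn_ord j; rewrite {2}size_map.
  rewrite ffunE (nth_map 0) // ffunE.
  have hi := hs (Ordinal ltis); have hj := hs (Ordinal ltjs).
  have ne : nth 0 s i != nth 0 s j.
    by rewrite nth_uniq ?enum_uniq // eq_sym; apply: contra ji => /eqP e; apply/eqP/val_inj.
  rewrite (negPf ne); case: eqP => [e|_]; last exact: mulr0.
  have := rep_id hi; rewrite /= e repN rep_id // => e'.
  by case/negP: ne; rewrite e -e'.
by rewrite XE (eqnP fs) size_map sz.
Qed.

End WeilModules.

Transparent GLn.

Theorem theorem5p7 (Fq : finFieldType) (F : fieldType) (m p l : nat)
    (lambda : Fq -> F)
    (nw : coset_of (Hgrp Fq m) -> {'GL_(m.+1 + m.+1)[Fq]}) :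
  p \in [pchar Fq] -> l \in [pchar F] -> l != p ->
  (exists z : F, p.-primitive_root z) ->
  linear_character lambda -> nontrivial_character lambda ->
  Weyl_transversal nw ->
  (l %| #|Fq| + 1)%N ->
  let I := Steinberg F nw in
  let G := Sp_M Fq m in
  let left := @ga_left {'GL_(m.+1 + m.+1)[Fq]} F in
  let Xp := X_plus Fq m F in
  let Yp := Y_plus Fq m F in
  let Ym := Y_minus Fq m F in
  (exists U : {vspace group_algebra {'GL_(m.+1 + m.+1)[Fq]} F},
     [/\ (U <= I)%VS, irreducible_module G left U &
         iso_module G (X_act lambda) Xp left U])
  /\
  (odd p -> forall kappa : Fq, kappa != 0 -> ~ (exists y, kappa = y ^+ 2) ->
     let lambdak := twist_character lambda kappa in
     [/\ exists U : {vspace group_algebra {'GL_(m.+1 + m.+1)[Fq]} F},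
           [/\ (U <= I)%VS, is_submodule G left U &
               iso_module G (X_act lambdak) Xp left U],
         ~ iso_module G (@X_act Fq m F lambda) Xp (X_act lambdak) Xp,
         exists U1 U2 : {vspace group_algebra {'GL_(m.+1 + m.+1)[Fq]} F},
           [/\ (U1 + U2 <= I)%VS, directv (U1 + U2),
               is_submodule G left U1 /\ is_submodule G left U2,
               iso_module G (X_act lambda) Xp left U1 &
               iso_module G (X_act lambdak) Xp left U2],
         iso_module G (X_act lambda) Xp
             (twist (theta_n F) (@Y_act Fq m F lambda)) Yp
           /\ iso_module G (X_act lambdak) Xp
             (twist (theta_n F) (@Y_act Fq m F lambdak)) Yp &
         l = 2%N ->
           [/\ \dim Ym = ((#|Fq| ^ m.+1 - 1) %/ 2)%N,
               forall P : {'GL_(m.+1 + m.+1)[Fq]} -> 'End(Nfun Fq m F),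
                 Weil_repr lambda P ->
                 iso_module G (X_act lambda) Xp (fun g => P g) Ym &
               forall P : {'GL_(m.+1 + m.+1)[Fq]} -> 'End(Nfun Fq m F),
                 Weil_repr lambdak P ->
                 iso_module G (X_act lambdak) Xp (fun g => P g) Ym]]).
Proof.
move=> pF lF _ _ lc ln nwT lq I G left Xp Yp Ym.
have card_Fq : #|Fq|%:R = -1 :> F.
  by apply/eqP; rewrite -addr_eq0 -[X in _ + X]/(1%:R) -natrD -(dvdn_pcharf lF).
pose copy_of mu : {vspace group_algebra (GLn Fq m) F} := steinberg_copy (nw : coset_of (Torus Fq m) -> GLn Fq m) mu.
have sub mu : (copy_of mu <= I)%VS by apply: copy_sub_St.
have irr mu : linear_character mu -> nontrivial_character mu -> irreducible_module G left (copy_of mu).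
  by move=> mc mn; apply: (copy_irreducible nwT card_Fq mc mn).
have iso mu : linear_character mu -> nontrivial_character mu ->
    iso_module G (X_act mu) Xp left (copy_of mu).
  by move=> mc mn; apply: (copy_iso nwT card_Fq mc mn).
split; first by exists (copy_of lambda); split; [apply: sub | apply: irr | apply: iso].
move=> p_odd kappa k0 nsq lambdak.
have kc : linear_character lambdak := twist_char kappa lc.
have kn : nontrivial_character lambdak := twist_nontriv ln k0.
have odd_char : 2 \notin [pchar Fq].
  by apply: contraL p_odd; rewrite (pcharf_eq pF) inE => /eqP <-.
have stab mu : linear_character mu -> nontrivial_character mu -> is_submodule G left (copy_of mu).
  by move=> mc mn; case: (irr _ mc mn).
split.
- by exists (copy_of lambdak); split; [apply: sub | apply: stab | apply: iso].
- exact: (X_plus_not_iso lc ln k0 nsq).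
- exists (copy_of lambda), (copy_of lambdak); split; try by apply: iso.
  + by rewrite subv_add !sub.
  + exact: (copies_direct nwT card_Fq lc ln k0 nsq).
  + by split; apply: stab.
- have XY : Xp = Yp := X_plus_Y_plus F m odd_char.
  by split; apply: (iso_module_eq XY) => g u _ _; rewrite twist_Y_act.
move=> l2; rewrite l2 in lF.
have XY : Xp = Ym by rewrite /Ym Y_minus_Y_plus // -X_plus_Y_plus.
have weil mu (P : {'GL_(m.+1 + m.+1)[Fq]} -> 'End(Nfun Fq m F)) :
    Weil_repr mu P -> iso_module G (X_act mu) Xp (fun g => P g) Ym.
  case=> _ PY _; apply: iso_module_eq => // g u gG _.
  by rewrite PY // Y_act_X_act theta_char2 // expr1n scale1r.
by split; [rewrite -XY dim_X_plus | apply: weil | apply: weil].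
Qed.
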